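(* Let $\mathcal I$ be an at most countable index set and let $\{T_i\}_{i\in\mathcal I}$ be a family of maps $[0,1]\to[0,1]$ generating a partition $\mathcal P$ of $[0,1]$, in the sense of the context; in particular each $T_i$ is a strictly increasing $C^1$ diffeomorphism onto its image, $T_i^{-1}\in C^{1+\varepsilon}$ for some $\varepsilon\in(0,1)$, and there is $c_M\in(0,1)$ with $0<T_i'(x)<c_M<1$ for every $i\in\mathcal I$, $x\in[0,1]$. Suppose that the geometric potential $\gamma_{\mathcal P}:\Sigma\to\mathbb R$, $\gamma_{\mathcal P}(\underline x)=-\log T_{x_1}'(\pi(\sigma\underline x))$, is nonlattice and is a regular potential. Let $\{L_n\}_{n\ge 0}$ be the sequence of sets of left endpoints of intervals which have been split up to time $n$ in the interval substitution scheme generated by $\{T_i\}_{i\in\mathcal I}$, and let $$\mu_n=\frac1{\#L_n}\sum_{x\in L_n}\delta_x .$$ Then for every interval $J\subset[0,1]$, $$\lim_{n\to\infty}\mu_n(J)=\mathrm{Leb}(J).$$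
   Context: $\mathrm{Leb}$ is Lebesgue measure on $[0,1]$, $\delta_x$ is the Dirac mass at $x$. Generating family. $\{T_i\}_{i\in\mathcal I}$ generates a partition $\mathcal P=\{T_i[0,1]\}_{i\in\mathcal I}$ of $[0,1]$ if: each $T_i[0,1]$ is a closed subinterval of $[0,1]$; $T_i([0,1))\cap T_j([0,1))=\varnothing$ for $i\ne j$; $\sum_{i}\mathrm{Leb}(T_i[0,1))=1$; each $T_i$ is a strictly increasing $C^1$ diffeomorphism from $[0,1]$ onto $T_i[0,1]$, with $T_i'>0$ on $[0,1]$, and $T_i^{-1}\in C^{1+\varepsilon}$ (i.e. its derivative is $\varepsilon$-Hölder) for some $\varepsilon\in(0,1)$; there is $c_M\in(0,1)$ with $0<T_i'(x)<c_M<1$ for all $i$, $x$. Interval substitution scheme. $\mathcal P_0=\{[0,1]\}$ (given by the identity map). Each $\mathcal P_n$ is a collection of intervals $S[0,1]$ with $S$ a finite composition of maps $T_i$; $\mathcal P_{n+1}$ is obtained from $\mathcal P_n$ by replacing every interval $S[0,1]\in\mathcal P_n$ of maximal Lebesgue measure by the intervals $(S\circ T_i)[0,1]$, $i\in\mathcal I$. Then $$L_n=\{\min(I): I\in\mathcal P_k\setminus\mathcal P_{k+1}\text{ for some }0\le k\le n\},$$ which is a finite set. Symbolic coding. $\Sigma=\mathcal I^{\mathbb N}$ is the set of sequences $\underline x=(x_1,x_2,\dots)$, with the product topology, $\sigma$ is the left shift, and $\pi(\underline x)=\lim_{n}T_{x_1}\circ\cdots\circ T_{x_n}(0)$. For a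 finite word $w$ of length $n$, $[w]\subset\Sigma$ is the cylinder of sequences starting with $w$. $S_n\gamma=\sum_{j=0}^{n-1}\gamma\circ\sigma^j$. For $\gamma\in C(\Sigma)$ and $\rho\in(0,1)$: $\mathrm{var}_n(\gamma)=\sup\{|\gamma(x)-\gamma(y)|:x_j=y_j,\ 1\le j\le n\}$; $\gamma\in\mathcal F_\rho(\Sigma)$ iff $\sup_{n\ge1}\rho^{-n}\mathrm{var}_n(\gamma)<\infty$; $\mathcal F_\rho^b(\Sigma)$ is the subset of bounded functions. Hölder continuous means belonging to $\mathcal F_\rho(\Sigma)$ for some $\rho$. The pressure is $P(\gamma)=\lim_n\frac1n\log\sum_{w\in\mathcal I^n}\exp(\sup_{[w]}S_n\gamma)$. $\gamma$ is summable if $\sum_{e\in\mathcal I}\exp(\sup_{[e]}\gamma)<\infty$. For a summable Hölder potential $\phi$, $\mu_\phi$ denotes its unique $\sigma$-invariant Gibbs probability measure (i.e. for some $C\ge1$, $C^{-1}\le\mu_\phi([w])/\exp(S_n\phi(x)-nP(\phi))\le C$ for all $n$, $w\in\mathcal I^n$, $x\in[w]$). Regular potential: a not identically zero $\gamma:\Sigma\to\mathbb R$ that is Hölder continuous, with $P(-\gamma)=0$, such that for all $t$ in a neighbourhood of $1$, $-t\gamma$ is summable and $\int t\gamma\,d\mu_{-\gamma}<\infty$. Lattice: $\gamma,\zeta\in\mathcal F_\rho(\Sigma)$ are cohomologous if $\gamma-\zeta=\varphi-\varphi\circ\sigma$ for some $\varphi\in\mathcal F^b_\rho(\Sigma)$.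 $\gamma$ is lattice if it is cohomologous (for some $\rho$) to a function taking values in a discrete subgroup of $\mathbb R$; otherwise it is nonlattice. *)

(* Defs.v *)
From HB Require Import structures.
From mathcomp Require Import all_boot all_order all_algebra finmap.
From mathcomp Require Import all_classical all_reals all_analysis.
Set Implicit Arguments.
Unset Strict Implicit.
Unset Printing Implicit Defensive.
Import Order.TTheory GRing.Theory Num.Theory.
Import numFieldNormedType.Exports.
Local Open Scope classical_set_scope.
Local Open Scope ring_scope.

(* Derivative relative to a set A: the increment y stays in A, so that it is
   one-sided at the endpoints when A is a closed interval.  It depends only on
   the values of f on A. *)
Definition diff_quotient (R : realType) (f : R -> R) (x y : R) : R :=
  (f y - f x) / (y - x).

Definition derivable_within (R : realType) (A : set R) (f : R -> R) (x : R) :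
    Prop :=
  cvg (diff_quotient f x @ within A x^').

Definition derive_within (R : realType) (A : set R) (f : R -> R) (x : R) : R :=
  lim (diff_quotient f x @ within A x^').

Definition C1_on (R : realType) (A : set R) (f : R -> R) : Prop :=
  (forall x, A x -> derivable_within A f x) /\
  {within A, continuous (derive_within A f)}.

Definition C1_holder_on (R : realType) (eps : R) (A : set R) (f : R -> R) :
    Prop :=
  (forall x, A x -> derivable_within A f x) /\
  exists K : R, forall x y, A x -> A y ->
    `|derive_within A f x - derive_within A f y| <= K * `|x - y| `^ eps.

(* Each T i is a map [0,1] -> [0,1], represented by a total function on R of
   which only the restriction to [0,1] is ever used. *)
Record generates_partition (R : realType) (I : pointedType) (T : I -> R -> R) :
    Prop := GeneratesPartition {
  gp_image : forall i, exists a b : R,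
    [/\ 0 <= a, a <= b, b <= 1 & T i @` `[0, 1] = `[a, b]%classic];
  gp_disjoint : forall i j, i <> j ->
    (T i @` `[0, 1[) `&` (T j @` `[0, 1[) = set0;
  gp_full : (\esum_(i in [set: I])
    (@lebesgue_measure R) (T i @` `[0%R, 1%R[) = 1)%E;
  gp_increasing : forall (i : I) (x y : R),
    0 <= x <= 1 -> 0 <= y <= 1 -> x < y -> T i x < T i y;
  gp_C1 : forall i, C1_on `[0, 1] (T i);
  gp_inverse : forall i, exists eps : R, 0 < eps < 1 /\
    C1_holder_on eps (T i @` `[0, 1]) (pinv (`[0, 1]%classic : set R) (T i));
  gp_contraction : exists cM : R, 0 < cM < 1 /\
    forall (i : I) (x : R), 0 <= x <= 1 -> 0 < derive_within `[0, 1] (T i) x < cM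
}.

(* T_{w_1} o ... o T_{w_n} for the word w = w_1 ... w_n *)
Definition compose_word (R : realType) (I : Type) (T : I -> R -> R) (w : seq I)
    (x : R) : R :=
  foldr T x w.

Definition word_interval (R : realType) (I : Type) (T : I -> R -> R)
    (w : seq I) : set R :=
  compose_word T w @` `[0, 1].

Definition of_maximal_length (R : realType) (P : set (set R)) (A : set R) :
    Prop :=
  P A /\ forall B, P B ->
    ((@lebesgue_measure R) B <= (@lebesgue_measure R) A)%E.

Definition split_step (R : realType) (I : Type) (T : I -> R -> R)
    (P : set (set R)) : set (set R) :=
  [set A | P A /\ ~ of_maximal_length P A] `|`
  [set A | exists (w : seq I) (i : I),
     of_maximal_length P (word_interval T w) /\
     A = word_interval T (rcons w i)].

Definition substitution_partition (R : realType) (I : Type) (T : I -> R -> R)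
    (n : nat) : set (set R) :=
  iter n (split_step T) [set `[0, 1]%classic].

Definition split_left_endpoints (R : realType) (I : Type) (T : I -> R -> R)
    (n : nat) : set R :=
  [set x | exists (k : nat) (A : set R),
     [/\ (k <= n)%N,
         (substitution_partition T k `\` substitution_partition T k.+1) A,
         A x & lbound A x]].

(* The set of left endpoints is finite; #|` fset_set A| is the cardinality of a
   finite set A. *)
Definition endpoint_measure (R : realType) (I : Type) (T : I -> R -> R)
    (n : nat) (A : set R) : \bar R :=
  ((#|` fset_set (split_left_endpoints T n)|%:R)^-1%:E *
   \sum_(x \in split_left_endpoints T n) (\d_x A : \bar R))%E.

(* Sequences are indexed from 0: x_1 is x 0. *)
Definition shift_space (I : pointedType) : Type :=
  {ptws nat -> discrete_topology I}.

HB.instance Definition _ (I : pointedType) := Pointed.on (shift_space I).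
HB.instance Definition _ (I : pointedType) := Nbhs.on (shift_space I).
HB.instance Definition _ (I : pointedType) := Topological.on (shift_space I).

Definition borel_shift_space (I : pointedType) : Type :=
  g_sigma_algebraType (@open (shift_space I)).

HB.instance Definition _ (I : pointedType) := Measurable.on (borel_shift_space I).

Definition left_shift (I : pointedType) (x : shift_space I) : shift_space I :=
  fun n => x n.+1.

Definition cylinder (I : pointedType) (w : seq I) : set (shift_space I) :=
  [set x | mkseq x (size w) = w].

Definition coding_map (R : realType) (I : pointedType) (T : I -> R -> R)
    (x : shift_space I) : R :=
  limn (fun n => compose_word T (mkseq x n) 0).

Definition geometric_potential (R : realType) (I : pointedType)
    (T : I -> R -> R) (x : shift_space I) : R :=
  - ln (derive_within `[0, 1] (T (x 0%N)) (coding_map T (left_shift x))).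

Definition birkhoff_sum (R : realType) (I : pointedType) (n : nat)
    (gamma : shift_space I -> R) (x : shift_space I) : R :=
  \sum_(0 <= j < n) gamma (iter j (@left_shift I) x).

Definition cylinder_variation (R : realType) (I : pointedType) (n : nat)
    (gamma : shift_space I -> R) : \bar R :=
  ereal_sup [set v | exists x y : shift_space I,
    (forall j, (j < n)%N -> x j = y j) /\ v = `|gamma x - gamma y|%:E].

Definition holder_class (R : realType) (I : pointedType) (rho : R)
    (gamma : shift_space I -> R) : Prop :=
  continuous gamma /\
  (ereal_sup [set (rho ^- n)%:E * cylinder_variation n gamma |
              n in [set n | (1 <= n)%N]]
     < +oo)%E.

Definition bounded_holder_class (R : realType) (I : pointedType) (rho : R)
    (gamma : shift_space I -> R) : Prop :=
  holder_class rho gamma /\ exists M : R, forall x, `|gamma x| <= M.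

Definition holder_potential (R : realType) (I : pointedType)
    (gamma : shift_space I -> R) : Prop :=
  exists rho : R, 0 < rho < 1 /\ holder_class rho gamma.

Definition sup_on_cylinder (R : realType) (I : pointedType)
    (gamma : shift_space I -> R) (w : seq I) : \bar R :=
  ereal_sup [set (gamma x)%:E | x in cylinder w].

(* A relation rather than a function built on lim, whose value is junk (here 0)
   when the limit does not exist. *)
Definition has_pressure (R : realType) (I : pointedType)
    (gamma : shift_space I -> R) (p : R) : Prop :=
  (fun n : nat => (n%:R^-1)%:E *
     lne (\esum_(w in [set: n.-tuple I])
            expeR (sup_on_cylinder (birkhoff_sum n gamma) w)))%E
    @ \oo --> p%:E.

Definition summable_potential (R : realType) (I : pointedType)
    (gamma : shift_space I -> R) : Prop :=
  (\esum_(e in [set: I]) expeR (sup_on_cylinder gamma [:: e]) < +oo)%E.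

Definition invariant_gibbs (R : realType) (I : pointedType)
    (phi : shift_space I -> R) (mu : probability (borel_shift_space I) R) :
    Prop :=
  (forall A : set (borel_shift_space I), measurable A ->
     mu (@left_shift I @^-1` A) = mu A) /\
  exists p C : R, [/\ has_pressure phi p, 1 <= C &
    forall (n : nat) (w : n.-tuple I) (x : shift_space I), cylinder w x ->
      C^-1 <= fine (mu (cylinder w)) / expR (birkhoff_sum n phi x - n%:R * p)
           <= C].

(* The invariant Gibbs probability measure of a summable Holder potential exists
   and is unique; mu below is that of - gamma. *)
Definition regular_potential (R : realType) (I : pointedType)
    (gamma : shift_space I -> R) : Prop :=
  [/\ exists x, gamma x <> 0,
      holder_potential gamma,
      has_pressure (fun x => - gamma x) 0 &
      exists mu : probability (borel_shift_space I) R,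
        invariant_gibbs (fun x => - gamma x) mu /\
        \forall t \near (1 : R),
          summable_potential (fun x => - (t * gamma x)) /\
          (\int[mu]_x (t * gamma x)%:E < +oo)%E].

Definition cohomologous (R : realType) (I : pointedType) (rho : R)
    (gamma zeta : shift_space I -> R) : Prop :=
  [/\ holder_class rho gamma, holder_class rho zeta &
    exists phi : shift_space I -> R, bounded_holder_class rho phi /\
      forall x, gamma x - zeta x = phi x - phi (left_shift x)].

Definition discrete_subgroup (R : realType) (D : set R) : Prop :=
  [/\ D 0, (forall x y, D x -> D y -> D (x - y)) & D `<=` isolated D].

Definition lattice_potential (R : realType) (I : pointedType)
    (gamma : shift_space I -> R) : Prop :=
  exists (rho : R) (zeta : shift_space I -> R) (D : set R),
    [/\ 0 < rho < 1, cohomologous rho gamma zeta, discrete_subgroup D &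
        forall x, D (zeta x)].

(* Main.v *)
Require Import Defs.
From HB Require Import structures.
From mathcomp Require Import all_boot all_order all_algebra finmap.
From mathcomp Require Import all_classical all_reals all_analysis.
From mathcomp Require Import ring lra.
Set Implicit Arguments.
Unset Strict Implicit.
Unset Printing Implicit Defensive.
Import Order.TTheory GRing.Theory Num.Theory.
Import numFieldNormedType.Exports.
Local Open Scope classical_set_scope.
Local Open Scope ring_scope.

(** Write T_w for the composition of the maps along a word w, len w for the
    length of T_w[0,1] and cost w for - ln (len w).  The scheme splits the
    intervals in the order of increasing cost, so that L_n consists of the
    points T_w 0 with cost w below a threshold which tends to infinity with n
    ([split_left_endpointsE]).  The point T_w 0 determines w once trailing
    letters i with T_i 0 = 0 are discarded ([reduced_inj]).  The theorem thus
    amounts to a statement on words: among the words of cost at most t, the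
    proportion of those which begin with a tends to len a as t grows
    ([words_equidistributed]).  Its proof rests on the properties of the
    function len collected in [length_system], above all on bounded distortion,
    which follows from the Hoelder continuity of the potential
    ([log_width_distortion]).

    The number of words of cost at most t is of exact order exp t
    ([subtree_sum_le], [count_linear_lower]).  Let density a t be the (slightly
    smoothed) number of words of cost at most t which extend a, divided by
    len a * exp t.  Two facts drive the argument.  Conditioning on the next
    letter, the density of a is an average of the densities of its children
    ([density_rec]), whence a maximum principle: where the density, or an
    increment of it, nearly attains its asymptotic supremum, it nearly attains
    it at each given descendant too ([max_words]).  And by bounded distortion
    the part of the tree below u ++ w looks like the part below w, up to a
    translation of t, when w is long ([density_shift]).

    As in Feller's proof of the renewal theorem, combine the two along the
    powers of a word v: if a shift of t by the cost tau of one repetition of v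
    changed the densities, it would change them by the same amount many times
    in succession, and they would not be bounded ([null_period_word]).  The
    shifts which do not change the densities asymptotically form a closed
    subgroup of the real line.  If this group is the whole line, then the
    densities of all words agree asymptotically, again by the maximum principle
    ([density_root_le]), and equidistribution follows.  If it is not, it is
    discrete and contains all the periods tau; an argument in the manner of
    Livsic then makes the geometric potential cohomologous to a function with
    values in this group ([lattice_of_periods]), so that it is lattice. *)

(** * Sums over letters and words *)

Section FiniteSums.
Variables (R : realType) (I : choiceType).

Lemma sum_le_esum (f : I -> \bar R) (s : seq I) :
  (forall i, (0 <= f i)%E) -> uniq s ->
  (\sum_(i <- s) f i <= \esum_(i in [set: I]) f i)%E.
Proof.
move=> f0 us; apply: esum_ge; exists [set` s]; first by split.
by rewrite fsbig_seq.
Qed.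

Lemma esum_le_of_sums (A : set I) (f : I -> R) (B : R) :
  (forall s, uniq s -> (forall i, i \in s -> A i) -> \sum_(i <- s) f i <= B) ->
  (\esum_(i in A) (f i)%:E <= B%:E)%E.
Proof.
move=> h; apply: ge_ereal_sup => /= _ [X [finX XA]] <-.
rewrite fsbig_finite// sumEFin lee_fin; apply: h => // i.
by rewrite in_fset_set// inE => /XA.
Qed.

Lemma sum_le_of_esum (f : I -> R) (s : seq I) (B : R) :
  (forall i, 0 <= f i) -> uniq s ->
  (\esum_(i in [set: I]) (f i)%:E <= B%:E)%E -> \sum_(i <- s) f i <= B.
Proof.
move=> f0 us h; rewrite -lee_fin -sumEFin; apply: le_trans h.
by apply: sum_le_esum => // i; rewrite lee_fin.
Qed.

(** Words are either empty or made of a first letter and a word: this is the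
    recursion behind all the counts below. *)
Lemma esum_words (G : seq I -> \bar R) : (forall w, 0 <= G w)%E ->
  (\esum_(v in [set: seq I]) G v =
   G [::] + \esum_(i in [set: I]) \esum_(v in [set: seq I]) G (i :: v))%E.
Proof.
move=> G0; rewrite (esumID [set [::]])//; congr (_ + _)%E.
  by rewrite setTI esum_set1.
rewrite (@esum_esum _ _ _ setT (fun=> setT) (fun i v => G (i :: v)))//.
rewrite (@reindex_esum _ _ _ ([set: I] `*`` (fun=> [set: seq I])) _
  (fun k => k.1 :: k.2))//.
split.
- by move=> [i v] _ /=; split.
- by move=> [i v] [j u] _ _ /= [-> ->].
- by move=> [|i v] /= [_ h]; [case: h|exists (i, v)].
Qed.

End FiniteSums.

(** * Counting words in a length system *)

(** What the counting argument retains of a generating family, with [len w] in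
    the role of the length of the interval coded by [w].  Uniformity in
    [ls_exhaust] allows infinite alphabets to be handled by finite sets of
    letters.  [ls_distortion] makes the system nearly self-similar: letters far
    from the beginning hardly influence the effect of a prefix.  [ls_summable]
    ensures that the children much shorter than their parents carry little
    length, so that the number of words has the right order of growth. *)
Record length_system (R : realType) (I : choiceType) (len : seq I -> R)
    (cM rho C kappa : R) : Prop := LengthSystem {
  ls_cM : 0 < cM < 1;
  ls_rho : 0 < rho < 1;
  ls_C : 0 <= C;
  ls_kappa : 0 < kappa < 1;
  ls_gt0 : forall w, 0 < len w;
  ls_nil : len [::] = 1;
  ls_rcons : forall w i, len (rcons w i) <= cM * len w;
  ls_children : forall w s, uniq s -> \sum_(i <- s) len (rcons w i) <= len w;
  ls_exhaust : forall e, 0 < e -> exists2 s, uniq s &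
    forall w, (1 - e) * len w <= \sum_(i <- s) len (rcons w i);
  ls_distortion : forall u w v,
    `|ln (len (u ++ w ++ v)) - ln (len (w ++ v))
      - (ln (len (u ++ w)) - ln (len w))| <= C * rho ^+ size w;
  ls_summable : exists S, forall s, uniq s ->
    \sum_(i <- s) len [:: i] `^ (1 - kappa) <= S
}.

Section Counting.
Variables (R : realType) (I : choiceType) (len : seq I -> R).
Variables (cM rho C kappa : R).
Hypothesis hl : length_system len cM rho C kappa.

Let len_gt0 := ls_gt0 hl.
Let len_ge0 w : 0 <= len w := ltW (len_gt0 w).
Let cM_gt0 : 0 < cM. Proof. by case/andP: (ls_cM hl). Qed.
Let cM_lt1 : cM < 1. Proof. by case/andP: (ls_cM hl). Qed.

Lemma len_cat_le a v : len (a ++ v) <= cM ^+ size v * len a.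
Proof.
elim/last_ind: v => [|v i IH]; first by rewrite cats0 mul1r.
rewrite -rcons_cat size_rcons exprS; apply: (le_trans (ls_rcons hl _ _)).
by rewrite -mulrA ler_pM2l.
Qed.

Lemma len_cat_le1 a v : len (a ++ v) <= len a.
Proof.
apply: (le_trans (len_cat_le a v)); rewrite ler_piMl//.
by rewrite exprn_ile1// ltW.
Qed.

(** An extended sum, so that it can be split along the tree of words before it is
    known to be finite. *)
Definition subtree_esum (F : seq I -> R) (a : seq I) : \bar R :=
  \esum_(v in [set: seq I]) (F (a ++ v))%:E.

Definition subtree_sum (F : seq I -> R) (a : seq I) : R :=
  fine (subtree_esum F a).

(** The support of such a weight consists of words of cost at most [ln X], which
    makes its sums finite. *)
Definition below (X : R) (F : seq I -> R) : Prop :=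
  forall w, 0 <= F w <= 1 /\ (len w * X < 1 -> F w = 0).

Lemma subtree_esum_rec F a : (forall w, 0 <= F w) ->
  (subtree_esum F a =
   (F a)%:E + \esum_(i in [set: I]) subtree_esum F (rcons a i))%E.
Proof.
move=> F0; rewrite /subtree_esum esum_words; last by move=> w; rewrite lee_fin.
rewrite cats0; congr (_ + _)%E; apply: eq_esum => i _; apply: eq_esum => v _.
by rewrite cat_rcons.
Qed.

Lemma subtree_esum_ge0 F a : (forall w, 0 <= F w) -> (0 <= subtree_esum F a)%E.
Proof. by move=> F0; apply: esum_ge0 => v _; rewrite lee_fin. Qed.

Definition countK : R := (1 - cM)^-1.

Lemma countK_gt0 : 0 < countK.
Proof. by rewrite invr_gt0 subr_gt0. Qed.

Section Below.
Variables (X : R) (F : seq I -> R).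
Hypotheses (X0 : 0 < X) (bF : below X F).

Lemma below_ge0 w : 0 <= F w. Proof. by have [/andP[]] := bF w. Qed.
Lemma below_le1 w : F w <= 1. Proof. by have [/andP[]] := bF w. Qed.

Lemma subtree_esum_eq0 a : len a * X < 1 -> subtree_esum F a = 0%E.
Proof.
move=> aX; apply: esum1 => v _; congr (_%:E); have [_ ->//] := bF (a ++ v).
by apply: le_lt_trans aX; rewrite ler_pM2r// len_cat_le1.
Qed.

(** The bound linear in [X] does not reproduce itself under the recursion,
    since each word contributes 1 on top of its children.  The negative
    constant makes room for it: the children are shorter than their parent by
    the factor [cM], which lets the induction close. *)
Lemma subtree_esum_le_aux d a : len a * X * cM ^+ d < 1 -> 1 <= len a * X ->
  (subtree_esum F a <= (countK * (len a * X) - countK * cM)%:E)%E.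
Proof.
elim: d a => [|d IH] a; first by rewrite mulr1 => /lt_geF ->.
move=> ad a1; rewrite subtree_esum_rec; last exact: below_ge0.
have cM1 : 0 < 1 - cM by rewrite subr_gt0.
pose G := Num.max 0 (countK * X - countK / len a).
have G0 : 0 <= G by rewrite /G le_max lexx.
have child i : (subtree_esum F (rcons a i) <= (len (rcons a i) * G)%:E)%E.
  have [lt1|ge1] := ltP (len (rcons a i) * X) 1.
    by rewrite subtree_esum_eq0// lee_fin mulr_ge0.
  apply: (le_trans (IH _ _ ge1)).
    apply: (le_lt_trans _ ad); rewrite exprS mulrA ler_pM2r ?exprn_gt0//.
    by rewrite mulrAC ler_pM2r// mulrC (ls_rcons hl).
  rewrite lee_fin /G; apply: (@le_trans _ _ (len (rcons a i) *
    (countK * X - countK / len a))); last first.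
    by rewrite ler_pM2l// le_max lexx orbT.
  rewrite mulrBr mulrCA lerB// mulrCA ler_pM2l ?countK_gt0//.
  by rewrite ler_pdivrMr// (ls_rcons hl).
have : (\esum_(i in [set: I]) subtree_esum F (rcons a i) <= (len a * G)%:E)%E.
  apply: (@le_trans _ _ (\esum_(i in [set: I]) (len (rcons a i) * G)%:E)%E).
    by apply: le_esum => i _; exact: child.
  apply: esum_le_of_sums => s us _.
  by rewrite -mulr_suml ler_wpM2r// (ls_children hl).
move=> /(leeD2l (F a)%:E) /le_trans; apply.
rewrite -EFinD lee_fin; apply: (@le_trans _ _ (1 + len a * G)).
  by rewrite lerD2r below_le1.
have KK : countK * (1 - cM) = 1 by rewrite mulVf// gt_eqF.
rewrite /G /Num.max; case: ifPn => _.
  rewrite mulrBr mulrCA (mulrC (len a) (_ / _)) divfK ?gt_eqF//.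
  by rewrite addrCA lerD2l; rewrite -KK; lra.
have : countK <= countK * (len a * X) by rewrite ler_peMr// ltW// countK_gt0.
by move: KK; lra.
Qed.

Lemma subtree_esum_le a : (subtree_esum F a <= (countK * X * len a)%:E)%E.
Proof.
have K0 := ltW countK_gt0; have X0' := ltW X0.
have [lt1|ge1] := ltP (len a * X) 1.
  by rewrite subtree_esum_eq0// lee_fin !mulr_ge0.
have [d hd] : exists d, len a * X * cM ^+ d < 1.
  have /cvgrPdist_lt/(_ (len a * X)^-1) : geometric 1 cM @ \oo --> 0.
    by apply: cvg_geometric; rewrite gtr0_norm.
  have aX : 0 < len a * X by rewrite mulr_gt0.
  rewrite invr_gt0 => /(_ aX) [d _ /(_ d (leqnn d))] /=.
  rewrite sub0r normrN mul1r gtr0_norm ?exprn_gt0// => h; exists d.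
  by rewrite -ltr_pdivlMl// mulr1.
apply: (le_trans (subtree_esum_le_aux hd ge1)); rewrite lee_fin.
by rewrite -mulrA (mulrC X) gerBl mulr_ge0// ltW.
Qed.

Lemma subtree_esumE a : subtree_esum F a = (subtree_sum F a)%:E.
Proof.
rewrite /subtree_sum fineK// ge0_fin_numE.
  by apply: le_lt_trans (subtree_esum_le a) _; rewrite ltry.
by apply: subtree_esum_ge0 => w; exact: below_ge0.
Qed.

Lemma subtree_sum_ge0 a : 0 <= subtree_sum F a.
Proof.
by rewrite -lee_fin -subtree_esumE subtree_esum_ge0// => w; exact: below_ge0.
Qed.

Lemma subtree_sum_le a : subtree_sum F a <= countK * X * len a.
Proof. by rewrite -lee_fin -subtree_esumE subtree_esum_le. Qed.

Lemma subtree_sum_ge a (s : seq I) : uniq s ->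
  F a + \sum_(i <- s) subtree_sum F (rcons a i) <= subtree_sum F a.
Proof.
move=> us; rewrite -lee_fin -subtree_esumE EFinD -sumEFin.
rewrite subtree_esum_rec; last exact: below_ge0.
rewrite leeD2l//; under eq_bigr do rewrite -subtree_esumE.
by apply: sum_le_esum => // i; apply: subtree_esum_ge0 => w; exact: below_ge0.
Qed.

Lemma subtree_sum_ge_self a : F a <= subtree_sum F a.
Proof. by have := @subtree_sum_ge a [::] isT; rewrite big_nil addr0. Qed.

(** The letters outside [s] contribute in proportion to their total length, by
    the linear bound on counts. *)
Lemma subtree_sum_le_rec a (s : seq I) : uniq s ->
  subtree_sum F a <= F a + \sum_(i <- s) subtree_sum F (rcons a i)
    + countK * X * (len a - \sum_(i <- s) len (rcons a i)).
Proof.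
move=> us; rewrite -lee_fin -subtree_esumE !EFinD.
rewrite subtree_esum_rec; last exact: below_ge0.
rewrite -addeA leeD2l// (esumID [set` s])//; last first.
  by move=> i _; apply: subtree_esum_ge0 => w; exact: below_ge0.
rewrite setTI setTI; apply: leeD.
  rewrite esum_fset//; last first.
    by move=> i _; apply: subtree_esum_ge0 => w; exact: below_ge0.
  rewrite -fsbig_seq// -sumEFin.
  by under eq_bigr do rewrite subtree_esumE.
under eq_esum do rewrite subtree_esumE.
apply: esum_le_of_sums => r ur rs.
apply: (@le_trans _ _ (countK * X * \sum_(i <- r) len (rcons a i))).
  by rewrite mulr_sumr ler_sum// => i _; exact: subtree_sum_le.
rewrite ler_pM2l ?mulr_gt0 ?countK_gt0// lerBrDr -big_cat/= (ls_children hl)//.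
rewrite cat_uniq ur us/= andbT; apply/hasPn => i is_.
by apply/negP => /rs /=; rewrite is_.
Qed.

End Below.

Lemma le_subtree_sum X X' F F' a a' : 0 < X -> 0 < X' -> below X F ->
  below X' F' ->
  (forall v, F (a ++ v) <= F' (a' ++ v)) ->
  subtree_sum F a <= subtree_sum F' a'.
Proof.
move=> X0 X0' bF bF' h; rewrite -lee_fin -(subtree_esumE X0 bF).
by rewrite -(subtree_esumE X0' bF'); apply: le_esum => v _; rewrite lee_fin.
Qed.

End Counting.

(** * A linear lower bound for the number of words *)

Section Costs.
Variables (R : realType) (I : choiceType) (len : seq I -> R).
Variables (cM rho C kappa : R).
Hypothesis hl : length_system len cM rho C kappa.

Let len_gt0 := ls_gt0 hl.
Let len_ge0 w : 0 <= len w := ltW (len_gt0 w).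
Let cM_gt0 : 0 < cM. Proof. by case/andP: (ls_cM hl). Qed.
Let cM_lt1 : cM < 1. Proof. by case/andP: (ls_cM hl). Qed.

Definition cost (w : seq I) : R := - ln (len w).

Lemma expR_cost w : expR (- cost w) = len w.
Proof. by rewrite opprK lnK ?posrE. Qed.

Lemma cost_nil : cost [::] = 0.
Proof. by rewrite /cost (ls_nil hl) ln1 oppr0. Qed.

Lemma cost_distortion u w v :
  `|cost (u ++ w ++ v) - cost (w ++ v) - (cost (u ++ w) - cost w)|
  <= C * rho ^+ size w.
Proof.
have := ls_distortion hl u w v; rewrite -normrN; congr (`|_| <= _).
by rewrite /cost; ring.
Qed.

Lemma cost_cat_near u v : `|cost (u ++ v) - cost u - cost v| <= C.
Proof.
have := cost_distortion u [::] v; rewrite cats0 cost_nil /= mulr1.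
by congr (`|_| <= _); ring.
Qed.


Definition child_ratio (a : seq I) (i : I) : R := len (rcons a i) / len a.

Lemma child_ratio_gt0 a i : 0 < child_ratio a i. Proof. exact: divr_gt0. Qed.

Lemma child_ratio_le a i : child_ratio a i <= cM.
Proof. by rewrite ler_pdivrMr// (ls_rcons hl). Qed.

Lemma sum_child_ratio a s : \sum_(i <- s) child_ratio a i =
  (\sum_(i <- s) len (rcons a i)) / len a.
Proof. by rewrite mulr_suml. Qed.

Lemma sum_child_ratio_le1 a s : uniq s -> \sum_(i <- s) child_ratio a i <= 1.
Proof.
by move=> us; rewrite sum_child_ratio ler_pdivrMr// mul1r (ls_children hl).
Qed.

Lemma child_ratio_exhaust e : 0 < e -> exists2 s, uniq s &
  forall a, 1 - e <= \sum_(i <- s) child_ratio a i.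
Proof.
move=> /(ls_exhaust hl)[s us h]; exists s => // a.
by rewrite sum_child_ratio ler_pdivlMr.
Qed.

(** Bounded distortion at the empty word: the probability of the letter [i] given
    the past [a] is comparable to its unconditional probability. *)
Lemma child_ratio_near a i : expR (- C) * len [:: i] <= child_ratio a i <= expR C * len [:: i].
Proof.
have := cost_cat_near a [:: i]; rewrite cats1 ler_norml => /andP[h1 h2].
have -> : child_ratio a i = expR (cost a - cost (rcons a i)).
  by rewrite [RHS]expRD expR_cost -[cost a]opprK expRN expR_cost /child_ratio mulrC.
rewrite -(expR_cost [:: i]) -!expRD !ler_expR.
by apply/andP; split; lra.
Qed.

Variable chi : pred (seq I).
Hypothesis chi_cat : forall u w, w != [::] -> chi (u ++ w) = chi w.

(** The predicate [chi] restricts the last letter of the words that are counted;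
    it serves to count left endpoints without repetition. *)
Definition hard_count (X : R) (w : seq I) : R := (chi w && (1 <= len w * X))%:R.

Lemma below_hard X : below len X (hard_count X).
Proof.
move=> w; rewrite /hard_count; split; first by rewrite ler0n lern1 leq_b1.
by move=> /lt_geF ->; rewrite andbF.
Qed.

Section LowerBound.
Variable j : I.
Hypothesis chi_j : chi [:: j].

Let E := expR C / len [:: j].
Let E_gt0 : 0 < E. Proof. by rewrite divr_gt0// expR_gt0. Qed.

(** The factor [E] leaves room for appending the letter [j], after which [chi]
    holds. *)
Lemma count_ge1 Y a : 0 < Y -> 1 <= len a * Y ->
  1 <= subtree_sum (hard_count (E * Y)) a.
Proof.
move=> Y0 aY; have X0 : 0 < E * Y by rewrite mulr_gt0.
have bF := below_hard (E * Y).
have h := @subtree_sum_ge _ _ _ _ _ _ _ hl _ _ X0 bF a [:: j] isT.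
apply: le_trans h; rewrite big_seq1 -[leLHS]add0r lerD//.
apply: le_trans (subtree_sum_ge_self hl X0 bF (rcons a j)).
rewrite /hard_count -cats1 chi_cat// chi_j/=.
suff -> : 1 <= len (a ++ [:: j]) * (E * Y) by [].
have /andP[h1 _] := child_ratio_near a j.
apply: (le_trans aY); rewrite mulrA ler_pM2r// cats1.
move: h1; rewrite /child_ratio ler_pdivlMr// => h1.
rewrite /E mulrCA -ler_pdivrMl ?expR_gt0// -expRN.
by rewrite ler_pdivlMr// (le_trans _ h1)// mulrAC.
Qed.

Let h (y : R) := expR (- kappa * ln y).

(** With [y] the length of [a] in units of the threshold, the count below [a]
    satisfies the renewal inequality [N y >= sum_i N (p_i y)], where only the
    letters with [p_i y >= 1] can be used.  By summability of the lengths to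
    the power [1 - kappa], these letters carry all but a fraction
    [S * y `^ (- kappa)] of the length.  The function [f y = y + L y `^ (1 - kappa)]
    is a subsolution for large [y]: the second term grows under averaging by the
    factor [m > 1], because each [p_i] is at most [cM], and this outweighs the
    loss. *)
Lemma count_linear_lower : exists2 c, 0 < c &
  forall X, E <= X -> c * X <= subtree_sum (hard_count X) [::].
Proof.
have /andP[k0 k1] := ls_kappa hl.
have [S0 hS0] := ls_summable hl.
pose S := expR C * `|S0| + 1.
have S1 : 1 <= S by rewrite /S lerDr mulr_ge0// expR_ge0.
have S_gt0 : 0 < S by lra.
have ln_cM : ln cM < 0 by rewrite ln_lt0// cM_gt0.
pose m := expR (- kappa * ln cM).
have m1 : 1 < m by rewrite /m expR_gt1; nra.
have m_gt0 : 0 < m by rewrite expR_gt0.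
pose L := 2 * S / (m - 1).
have L0 : 0 < L by rewrite divr_gt0 ?mulr_gt0// subr_gt0.
have Lm : L * (m - 1) = 2 * S by rewrite divfK// gt_eqF// subr_gt0.
pose y0 := Num.max 1 (expR (kappa^-1 * ln (L * m))).
have y01 : 1 <= y0 by rewrite le_max lexx.
have y0_gt0 : 0 < y0 by lra.
have h_gt0 y : 0 < h y by exact: expR_gt0.
have h_small y : y0 <= y -> L * m * h y <= 1.
  move=> yy; have y_gt0 : 0 < y by lra.
  have Lm0 : 0 < L * m by rewrite mulr_gt0//; lra.
  have ly : kappa^-1 * ln (L * m) <= ln y.
    rewrite -[leLHS]expRK ler_ln ?posrE ?expR_gt0//.
    by apply: le_trans yy; rewrite le_max lexx orbT.
  rewrite -{1}(@lnK _ (L * m)) ?posrE// /h -expRD -expR0 ler_expR.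
  by move: ly; rewrite ler_pdivrMl//; nra.
have tail a y s : 1 <= y -> uniq s ->
    \sum_(i <- s | child_ratio a i * y < 1) child_ratio a i <= (S - 1) * h y.
  move=> y1 us.
  have y_gt0 : 0 < y by lra.
  have step i : child_ratio a i * y < 1 ->
      child_ratio a i <= h y * (expR C * len [:: i] `^ (1 - kappa)).
    move=> py; have p0 := child_ratio_gt0 a i.
    rewrite /powR gt_eqF// /h -!expRD -[leLHS]lnK ?posrE// ler_expR.
    have lp : ln (child_ratio a i) + ln y < 0 by rewrite -lnM ?posrE// ln_lt0// mulr_gt0.
    have lpi : ln (child_ratio a i) <= C + ln (len [:: i]).
      rewrite -[leRHS]expRK ler_ln ?posrE ?expR_gt0// expRD lnK ?posrE//.
      by have /andP[] := child_ratio_near a i.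
    have C0 := ls_C hl; nra.
  apply: (@le_trans _ _ (\sum_(i <- s | child_ratio a i * y < 1)
      h y * (expR C * len [:: i] `^ (1 - kappa)))).
    exact: ler_sum.
  apply: (@le_trans _ _ (\sum_(i <- s) h y * (expR C * len [:: i] `^ (1 - kappa)))).
    rewrite [leRHS](bigID (fun i => child_ratio a i * y < 1))/= lerDl sumr_ge0// => i _.
    by rewrite !mulr_ge0 ?expR_ge0 ?powR_ge0.
  rewrite -!mulr_sumr mulrC ler_pM2r// /S addrK ler_pM2l ?expR_gt0//.
  by apply: le_trans (hS0 _ us) _; rewrite ler_norm.
pose f y := y * (1 + L * h y).
pose c := (y0 * (1 + L))^-1.
have c0 : 0 < c by rewrite invr_gt0 mulr_gt0//; lra.
have h_le1 y : 1 <= y -> h y <= 1.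
  move=> y1; rewrite /h -expR0 ler_expR.
  have := ln_ge0 y1; nra.
have claim d Y a : 0 < Y -> len a * Y * cM ^+ d < 1 -> 1 <= len a * Y ->
    c * f (len a * Y) <= subtree_sum (hard_count (E * Y)) a.
  move=> Y0; elim: d a => [|d IH] a ad a1.
    by move: ad; rewrite mulr1 ltNge a1.
  have [small|large] := leP (len a * Y) y0.
    apply: le_trans (count_ge1 Y0 a1).
    rewrite ler_pdivrMl ?mulr1; last by rewrite mulr_gt0//; lra.
    rewrite /f ler_pM//; first by lra.
      by rewrite addr_ge0// mulr_ge0// ltW.
    by rewrite lerD2l ler_piMr// ?h_le1// ltW.
  set y := len a * Y in ad a1 large *.
  have y_gt0 : 0 < y by lra.
  have [s us hs] := child_ratio_exhaust (h_gt0 y).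
  pose s' := [seq i <- s | 1 <= child_ratio a i * y].
  have us' : uniq s' by rewrite filter_uniq.
  have sum_s' : 1 - S * h y <= \sum_(i <- s') child_ratio a i.
    have := hs a; rewrite (bigID (fun i => 1 <= child_ratio a i * y))/= big_filter.
    under [X in _ <= _ + X]eq_bigl do rewrite -ltNge.
    by have := tail a y s a1 us; nra.
  have X0 : 0 < E * Y by rewrite mulr_gt0.
  have bF := below_hard (E * Y).
  apply: le_trans (subtree_sum_ge hl X0 bF a us').
  apply: (@le_trans _ _ (\sum_(i <- s') c * (y + L * m * (y * h y)) * child_ratio a i)).
    rewrite -mulr_sumr -mulrA ler_pM2l//.
    apply: (@le_trans _ _ ((y + L * m * (y * h y)) * (1 - S * h y))); last first.
      by rewrite ler_pM2l//; apply: addr_gt0 => //; apply: mulr_gt0; apply: mulr_gt0.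
    rewrite /f.
    have := h_small y (ltW large); have hy := h_gt0 y.
    move=> hs1.
    have Syh : 0 < S * (y * h y) by apply: mulr_gt0 => //; apply: mulr_gt0.
    have k1' : S * (y * h y) * (L * m * h y) <= S * (y * h y) * 1.
      by rewrite ler_pM2l.
    have k2' : L * (m - 1) * (y * h y) = 2 * S * (y * h y) by rewrite Lm.
    move: (h y) k1' k2' => z q1 q2. lra.
  rewrite -[leLHS]add0r lerD//.
  rewrite big_seq [leRHS]big_seq ler_sum// => i; rewrite mem_filter => /andP[i1 _].
  have e : child_ratio a i * y = len (rcons a i) * Y.
    by rewrite /child_ratio /y mulrA divfK// gt_eqF.
  rewrite e in i1.
  have cMd : len (rcons a i) * Y * cM ^+ d < 1.
    apply: (le_lt_trans _ ad); rewrite exprS mulrA ler_pM2r ?exprn_gt0//.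
    by rewrite /y mulrAC ler_pM2r// mulrC (ls_rcons hl).
  apply: le_trans (IH _ cMd i1); rewrite -mulrA ler_pM2l// -e /f.
  have p0 := child_ratio_gt0 a i.
  have : m * h y <= h (child_ratio a i * y).
    rewrite /m /h -expRD ler_expR -mulrDr -lnM ?posrE//.
    have ypi : 0 < child_ratio a i * y by exact: mulr_gt0.
    have ycM : 0 < cM * y by exact: mulr_gt0.
    rewrite !mulNr lerN2 ler_pM2l// ler_ln ?posrE//.
    by rewrite ler_pM2r// child_ratio_le.
  have py : 0 < L * (child_ratio a i * y) by do 2! apply: mulr_gt0 => //.
  move=> /(ler_wpM2l (ltW py)).
  move: (h (child_ratio a i * y)) (h y) (child_ratio a i) => z2 z1 p; lra.
exists (c / E); first by apply: divr_gt0.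
move=> X EX.
have X0 : 0 < X by apply: lt_le_trans EX.
have EY : E * (X / E) = X by rewrite mulrC divfK// gt_eqF.
have Y1 : 1 <= X / E by rewrite ler_pdivlMr// mul1r.
have [d hd] : exists d, len [::] * (X / E) * cM ^+ d < 1.
  have /cvgrPdist_lt/(_ (X / E)^-1) : geometric 1 cM @ \oo --> 0.
    by apply: cvg_geometric; rewrite gtr0_norm.
  rewrite invr_gt0 => /(_ (lt_le_trans ltr01 Y1))[d _ /(_ d (leqnn d))] /=.
  rewrite sub0r normrN mul1r gtr0_norm ?exprn_gt0// => hd; exists d.
  by rewrite (ls_nil hl) mul1r -ltr_pdivlMl ?mulr1// (lt_le_trans ltr01 Y1).
have := claim d (X / E) [::] (lt_le_trans ltr01 Y1) hd.
rewrite (ls_nil hl) mul1r EY => /(_ Y1); apply: le_trans.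
rewrite -mulrA ler_pM2l// mulrC ler_peMr ?(le_trans ler01 Y1)//.
by rewrite lerDl mulr_ge0 ?ltW.
Qed.

End LowerBound.
End Costs.

(** * Smoothed counts and densities *)

Section Soft.
Variables (R : realType) (I : choiceType) (len : seq I -> R).
Variables (cM rho C kappa : R).
Hypothesis hl : length_system len cM rho C kappa.

Let len_gt0 := ls_gt0 hl.
Let rho_gt0 : 0 < rho. Proof. by case/andP: (ls_rho hl). Qed.
Let rho_lt1 : rho < 1. Proof. by case/andP: (ls_rho hl). Qed.
Let C_ge0 : 0 <= C := ls_C hl.

Variable chi : pred (seq I).
Hypothesis chi_cat : forall u w, w != [::] -> chi (u ++ w) = chi w.

Variable eta : R.
Hypothesis eta_gt0 : 0 < eta.

Notation cost := (cost len).
Notation child_ratio := (child_ratio len).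
Notation K := (countK cM).

Let K_gt0 : 0 < K := countK_gt0 hl.

(** A Lipschitz substitute for the indicator function of the positive reals. *)
Definition ramp (x : R) : R := Num.min 1 (Num.max 0 (x / eta)).

Lemma ramp_itv x : 0 <= ramp x <= 1.
Proof.
by rewrite /ramp le_min ler01 le_max lexx ge_min lexx.
Qed.

Lemma ramp_mono x y : x <= y -> ramp x <= ramp y.
Proof.
move=> xy; rewrite /ramp; apply: le_min2 => //; apply: le_max2 => //.
by rewrite ler_pM2r// invr_gt0.
Qed.

Lemma ramp_eq0 x : x <= 0 -> ramp x = 0.
Proof.
move=> x0; rewrite /ramp max_l ?min_r//.
by rewrite ler_pdivrMr// mul0r.
Qed.

Lemma ramp_eq1 x : eta <= x -> ramp x = 1.
Proof.
move=> x0; rewrite /ramp min_l// le_max.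
by rewrite ler_pdivlMr// mul1r x0 orbT.
Qed.

Lemma ramp_lip x d : 0 <= d ->
  ramp (x + d) <= ramp x + d / eta * (0 <= x + d)%R%:R.
Proof.
move=> d0; have [h|h] := leP 0 (x + d); last first.
  by rewrite mulr0 addr0 ramp_eq0 ?(ltW h)//; case/andP: (ramp_itv x).
rewrite mulr1.
have d1 : 0 <= d / eta by rewrite divr_ge0// ltW.
rewrite /ramp mulrDl; move: (x / eta) (d / eta) d1 => z e e0.
have z1 : z <= Num.max 0 z by rewrite le_max lexx orbT.
have z0 : 0 <= Num.max 0 z by rewrite le_max lexx.
rewrite -lerBlDr le_min; apply/andP; split; rewrite lerBlDr ge_min.
  by rewrite lerDl e0.
by rewrite ge_max addr_ge0//= lerD2r z1 orbT.
Qed.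

Definition soft_count (t : R) (w : seq I) : R := (chi w)%:R * ramp (t - cost w).

Lemma len_expR_ge1 t w : (1 <= len w * expR t) = (0 <= t - cost w).
Proof.
by rewrite -(expR_cost hl) -expRD -expR0 ler_expR addrC.
Qed.

Lemma below_soft t : below len (expR t) (soft_count t).
Proof.
move=> w; rewrite /soft_count; have /andP[r0 r1] := ramp_itv (t - cost w).
split.
  by rewrite mulr_ge0//= -[leRHS]mulr1 ler_pM// lern1 leq_b1.
rewrite ltNge len_expR_ge1 -ltNge => /ltW h.
by rewrite ramp_eq0// mulr0.
Qed.

Lemma soft_le_hard t w : soft_count t w <= hard_count len chi (expR t) w.
Proof.
rewrite /soft_count /hard_count len_expR_ge1.
have /andP[r0 r1] := ramp_itv (t - cost w).
case: (chi w); rewrite /= ?mul0r// mul1r.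
by have [//|/ltW h] := leP 0 (t - cost w); rewrite ramp_eq0.
Qed.

Lemma hard_le_soft t w : hard_count len chi (expR t) w <= soft_count (t + eta) w.
Proof.
rewrite /soft_count /hard_count len_expR_ge1.
have /andP[r0 r1] := ramp_itv (t + eta - cost w).
case: (chi w); rewrite /= ?mul0r// mul1r.
by have [h|//] := leP 0 (t - cost w); rewrite ramp_eq1//; lra.
Qed.

Definition soft_sum (a : seq I) (t : R) : R := subtree_sum (soft_count t) a.

Lemma soft_sum_ge0 a t : 0 <= soft_sum a t.
Proof. exact: (subtree_sum_ge0 hl (expR_gt0 _) (below_soft t)). Qed.

Lemma soft_sum_le a t : soft_sum a t <= K * expR t * len a.
Proof. exact: (subtree_sum_le hl (expR_gt0 _) (below_soft t)). Qed.

Lemma soft_sum_mono a t t' : t <= t' -> soft_sum a t <= soft_sum a t'.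
Proof.
move=> tt'.
apply: (le_subtree_sum hl (expR_gt0 t) (expR_gt0 t')) => [||v]; try exact: below_soft.
by rewrite ler_wpM2l// ramp_mono// lerD2r.
Qed.

(** The ramp varies only where the hard count at time [t + d] is positive. *)
Lemma soft_sum_lip a t d : 0 <= d ->
  soft_sum a (t + d) <= soft_sum a t + d / eta * (K * expR (t + d) * len a).
Proof.
move=> d0; have bS := below_soft; have bH := below_hard len chi (expR (t + d)).
have e0 := @expR_gt0 R.
rewrite -lee_fin -(subtree_esumE hl (e0 _) (bS (t + d))).
apply: esum_le_of_sums => s us _.
apply: (@le_trans _ _ (\sum_(v <- s) (soft_count t (a ++ v) +
    d / eta * hard_count len chi (expR (t + d)) (a ++ v)))).
  apply: ler_sum => v _; rewrite /soft_count /hard_count len_expR_ge1.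
  case: (chi _); rewrite /= ?mul0r ?mulr0 ?addr0// !mul1r.
  by rewrite addrAC ramp_lip.
rewrite big_split -mulr_sumr/= lerD//.
  apply: sum_le_of_esum => //; first by move=> v; have [/andP[]] := bS t (a ++ v).
  by rewrite -(subtree_esumE hl (e0 t) (bS t)).
rewrite ler_wpM2l//; first by rewrite divr_ge0// ltW.
apply: sum_le_of_esum => //.
exact: (subtree_esum_le hl (e0 _) bH).
Qed.

(** The count below [a] relative to its natural size [len a * expR t]. *)
Definition density (a : seq I) (t : R) : R := expR (cost a - t) * soft_sum a t.

Lemma soft_sumE a t : soft_sum a t = len a * expR t * density a t.
Proof.
rewrite /density mulrA -(expR_cost hl) -!expRD.
by rewrite (_ : _ + _ = 0) ?expR0 ?mul1r//; ring.
Qed.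

Lemma density_ge0 a t : 0 <= density a t.
Proof. by rewrite mulr_ge0 ?expR_ge0 ?soft_sum_ge0. Qed.

Lemma expR_costB a t : expR (cost a - t) * (expR t * len a) = 1.
Proof.
rewrite -(expR_cost hl) -!expRD (_ : _ + _ = 0) ?expR0//; ring.
Qed.

Lemma density_le a t : density a t <= K.
Proof.
rewrite -[leRHS]mulr1 -(expR_costB a t) mulrCA ler_pM2l ?expR_gt0// mulrA.
exact: soft_sum_le.
Qed.

Definition lipK : R := K / eta + K.

Lemma lipK_ge0 : 0 <= lipK.
Proof. by rewrite addr_ge0 ?divr_ge0 ?ltW. Qed.

(** Upwards the density moves slowly because the count does, downwards because
    the count is nondecreasing and only the normalising factor decreases. *)
Lemma density_lip a t t' : `|density a t' - density a t| <= lipK * `|t' - t|.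
Proof.
wlog tt' : t t' / t <= t'.
  move=> h; have [|/ltW] := leP t t'; first exact: h.
  by move=> /h; rewrite distrC (distrC t).
rewrite (ger0_norm (_ : 0 <= t' - t)) ?subr_ge0//.
pose d := t' - t; have d0 : 0 <= d by rewrite subr_ge0.
have -> : t' = t + d by rewrite /d; ring.
rewrite (_ : t + d - t = d); last by ring.
have E : density a (t + d) = expR (- d) * (expR (cost a - t) * soft_sum a (t + d)).
  by rewrite /density mulrA -expRD; congr (expR _ * _); ring.
have ed : 1 - d <= expR (- d) <= 1.
  by rewrite -{2}expR0 ler_expR oppr_le0 d0 andbT -[1 - d]/(1 + (- d)) expR_ge1Dx.
have q0 := density_ge0 a t; have qK := density_le a t.
rewrite ler_norml; apply/andP; split.
  have : expR (- d) * density a t <= density a (t + d).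
    by rewrite E ler_pM2l ?expR_gt0// ler_pM2l ?expR_gt0// soft_sum_mono//; lra.
  have : (1 - d) * density a t <= expR (- d) * density a t.
    by rewrite ler_wpM2r//; case/andP: ed.
  have : d * density a t <= d * K by rewrite ler_wpM2l.
  have : 0 <= K / eta * d by rewrite mulr_ge0// divr_ge0 ?ltW.
  rewrite /lipK; lra.
have : density a (t + d) <= density a t + d / eta * K.
  have := soft_sum_lip a t d0.
  rewrite -(ler_pM2l (expR_gt0 (cost a - (t + d)))) => /le_trans; apply.
  rewrite mulrDr lerD//.
    by rewrite /density ler_wpM2r ?soft_sum_ge0// ler_expR; lra.
  by rewrite -[leRHS]mulr1 -(expR_costB a (t + d)) le_eqVlt; apply/orP; left; apply/eqP; ring.
have : 0 <= K * d by rewrite mulr_ge0// ltW.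
rewrite /lipK (mulrAC d) (mulrC d) -mulrA; lra.
Qed.

(** The errors come from the word [a] itself, which weighs little when [t] is
    large compared with [cost a], and from the letters outside [s]. *)
Lemma density_rec a t s : uniq s ->
  `|density a t - \sum_(i <- s) child_ratio a i * density (rcons a i) t|
  <= (1 + K) * (expR (cost a - t) + (1 - \sum_(i <- s) child_ratio a i)).
Proof.
move=> us.
have e0 := expR_gt0 t; have bS := below_soft t.
have h1 := subtree_sum_ge hl e0 bS a us.
have h2 := subtree_sum_le_rec hl e0 bS a us.
have /andP[F0 F1] : 0 <= soft_count t a <= 1 by have [] := bS a.
have ec := expR_gt0 (cost a - t).
have Es : \sum_(i <- s) child_ratio a i * density (rcons a i) t =
    expR (cost a - t) * \sum_(i <- s) subtree_sum (soft_count t) (rcons a i).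
  rewrite mulr_sumr; apply: eq_bigr => i _.
  have -> : child_ratio a i = expR (cost a - cost (rcons a i)).
    by rewrite expRD (expR_cost hl) -[cost a]opprK expRN (expR_cost hl) mulrC.
  by rewrite /density mulrA -expRD; congr (expR _ * _); ring.
rewrite Es /density -mulrBr.
have p1 := sum_child_ratio_le1 hl a us.
have K0 := K_gt0.
set N := soft_sum a t; set M := \sum_(i <- s) _.
have lo : 0 <= N - M by rewrite subr_ge0 (le_trans _ h1)// lerDr.
have up : N - M <= 1 + K * expR t * (len a - \sum_(i <- s) len (rcons a i)).
  by move: h2; rewrite -/(soft_sum a t) -/N -/M; lra.
rewrite ger0_norm ?mulr_ge0 ?expR_ge0//.
apply: (le_trans (ler_wpM2l (ltW ec) up)).
have -> : len a - \sum_(i <- s) len (rcons a i) = len a * (1 - \sum_(i <- s) child_ratio a i).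
  by rewrite sum_child_ratio mulrBr mulr1 mulrCA divff ?mulr1// gt_eqF.
rewrite mulrDr mulr1.
have -> : expR (cost a - t) * (K * expR t * (len a * (1 - \sum_(i <- s) child_ratio a i)))
   = K * (1 - \sum_(i <- s) child_ratio a i).
  by rewrite -[RHS]mul1r -(expR_costB a t); ring.
have : 0 <= K * expR (cost a - t) by rewrite mulr_ge0 ?ltW.
rewrite mulrDl mul1r; lra.
Qed.

Definition shiftK : R := C * (lipK + K * expR C).

Lemma shiftK_ge0 : 0 <= shiftK.
Proof.
by rewrite mulr_ge0// addr_ge0 ?lipK_ge0// mulr_ge0 ?expR_ge0 ?ltW.
Qed.

(** By bounded distortion, prepending [u] to the words that extend [w] raises all
    their costs by nearly the same amount when [w] is long. *)
Lemma density_shift u w t : w != [::] ->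
  `|density (u ++ w) t - density w (t - (cost (u ++ w) - cost w))|
  <= shiftK * rho ^+ size w.
Proof.
move=> w0; set th := cost (u ++ w) - cost w.
pose d := C * rho ^+ size w.
have d0 : 0 <= d by rewrite mulr_ge0// exprn_ge0// ltW.
have dC : d <= C by rewrite ler_piMr// exprn_ile1// ltW.
have key s s' : (forall v, s - cost (u ++ w ++ v) <= s' - cost (w ++ v)) ->
    soft_sum (u ++ w) s <= soft_sum w s'.
  move=> h; apply: (le_subtree_sum hl (expR_gt0 s) (expR_gt0 s')) => [||v];
    try exact: below_soft.
  rewrite /soft_count -catA (chi_cat u); last by case: (w) w0.
  by rewrite ler_wpM2l// ramp_mono.
have key' s s' : (forall v, s' - cost (w ++ v) <= s - cost (u ++ w ++ v)) ->
    soft_sum w s' <= soft_sum (u ++ w) s.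
  move=> h; apply: (le_subtree_sum hl (expR_gt0 s') (expR_gt0 s)) => [||v];
    try exact: below_soft.
  rewrite /soft_count -catA (chi_cat u); last by case: (w) w0.
  by rewrite ler_wpM2l// ramp_mono.
have dist v := cost_distortion hl u w v.
have up : density (u ++ w) t <= expR d * density w (t - th + d).
  rewrite /density mulrA -expRD (_ : d + _ = cost (u ++ w) - t).
    rewrite ler_pM2l ?expR_gt0// key// => v.
    by have := dist v; rewrite -/d -/th ler_norml; lra.
  by rewrite /th; ring.
have lo : expR (- d) * density w (t - th - d) <= density (u ++ w) t.
  rewrite /density mulrA -expRD (_ : - d + _ = cost (u ++ w) - t).
    rewrite ler_pM2l ?expR_gt0// key'// => v.
    by have := dist v; rewrite -/d -/th ler_norml; lra.
  by rewrite /th; ring.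
have l1 := density_lip w (t - th) (t - th + d).
have l2 := density_lip w (t - th) (t - th - d).
have e1 : 1 - d <= expR (- d) by rewrite -[1 - d]/(1 + (- d)) expR_ge1Dx.
have e2 : expR d <= 1 + d * expR C.
  have : expR d * (1 - d) <= 1.
    have ed : expR d * expR (- d) = 1 by rewrite -expRD subrr expR0.
    by rewrite -[leRHS]ed ler_pM2l ?expR_gt0.
  have : d * expR d <= d * expR C by rewrite ler_wpM2l// ler_expR.
  lra.
have Q1 := density_ge0 w (t - th + d); have Q1' := density_le w (t - th + d).
have Q2 := density_ge0 w (t - th - d); have Q2' := density_le w (t - th - d).
rewrite /shiftK mulrAC -/d.
rewrite (_ : t - th + d - (t - th) = d) in l1; last by ring.
rewrite (_ : t - th - d - (t - th) = - d) in l2; last by ring.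
rewrite normrN (ger0_norm d0) ler_norml in l2; case/andP: l2 => l2 _.
rewrite (ger0_norm d0) ler_norml in l1; case/andP: l1 => _ l1.
have eC := @expR_ge1Dx R C.
have eC1 : 1 <= expR C by lra.
have K0 := K_gt0.
have a1 : expR d * density w (t - th + d) <= density w (t - th + d) + d * expR C * K.
  apply: (@le_trans _ _ ((1 + d * expR C) * density w (t - th + d))).
    by rewrite ler_wpM2r.
  by rewrite mulrDl mul1r lerD2l ler_wpM2l// mulr_ge0 ?expR_ge0.
have a2 : density w (t - th - d) - d * K <= expR (- d) * density w (t - th - d).
  apply: (@le_trans _ _ ((1 - d) * density w (t - th - d))).
    by rewrite mulrBl mul1r lerB// ler_wpM2l.
  by rewrite ler_wpM2r.
have a3 : d * K <= d * K * expR C by rewrite ler_peMr// mulr_ge0// ltW.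
rewrite ler_norml; apply/andP; split; lra.
Qed.

End Soft.

(** * The maximum principle and null periods *)

Lemma exists_small_pow (R : realType) (r A e : R) : 0 < r < 1 -> 0 < e ->
  exists2 p, (0 < p)%N & A * r ^+ p <= e.
Proof.
move=> /andP[r0 r1] e0.
have A1 : 0 < `|A| + 1 by rewrite ltr_wpDl.
have /cvgrPdist_lt/(_ (e / (`|A| + 1))) : geometric 1 r @ \oo --> 0.
  by apply: cvg_geometric; rewrite gtr0_norm.
rewrite divr_gt0// => /(_ isT)[p _ /(_ p.+1 (leqnSn p))] /=.
rewrite sub0r normrN mul1r gtr0_norm ?exprn_gt0// ltr_pdivlMr// => /ltW h.
exists p.+1 => //; apply: le_trans h.
rewrite mulrC ler_pM2l ?exprn_gt0//.
by apply: le_trans (ler_norm _) _; rewrite lerDl.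
Qed.

Definition word_pow (I : Type) (v : seq I) (k : nat) : seq I := flatten (nseq k v).

Lemma word_powS (I : Type) (v : seq I) k : word_pow v k.+1 = v ++ word_pow v k.
Proof. by []. Qed.

Lemma word_powD (I : Type) (v : seq I) k p :
  word_pow v (k + p) = word_pow v k ++ word_pow v p.
Proof. by rewrite /word_pow nseqD flatten_cat. Qed.

Lemma word_powSr (I : Type) (v : seq I) k : word_pow v k.+1 = word_pow v k ++ v.
Proof. by rewrite -addn1 word_powD /word_pow /= cats0. Qed.

Lemma size_word_pow (I : Type) (v : seq I) k : size (word_pow v k) = (k * size v)%N.
Proof. by elim: k => //= k IH; rewrite size_cat IH mulSn. Qed.

Section MaximumPrinciple.
Variables (R : realType) (I : choiceType) (len : seq I -> R).
Variables (cM rho C kappa : R).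
Hypothesis hl : length_system len cM rho C kappa.

Let len_gt0 := ls_gt0 hl.
Let len_ge0 w : 0 <= len w := ltW (len_gt0 w).
Let rho_gt0 : 0 < rho. Proof. by case/andP: (ls_rho hl). Qed.
Let rho_lt1 : rho < 1. Proof. by case/andP: (ls_rho hl). Qed.
Let C_ge0 : 0 <= C := ls_C hl.

Notation cost := (cost len).
Notation ratio := (child_ratio len).

(** The asymptotic mean value property: [U a] is the mean of [U] over the children
    of [a], up to an error that vanishes as [t - cost a] tends to infinity and the
    finite set [s] exhausts the letters. *)
Definition averaging (B : R) (U : seq I -> R -> R) : Prop :=
  (forall a t, `|U a t| <= B) /\
  forall a t s, uniq s ->
    `|U a t - \sum_(i <- s) ratio a i * U (rcons a i) t|
    <= B * (expR (cost a - t) + (1 - \sum_(i <- s) ratio a i)).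

(** The maximum principle with its quantitative data, which do not depend on the
    family [U] nor on [a], [t] and [M].  The finite list [b] of descendants at
    which [U] is tested makes it applicable to pointwise upper limits. *)
Definition forces_max (B : R) (ws : seq (seq I)) (e : R) (b : seq (seq I))
    (S e' : R) : Prop :=
  forall U a t M, averaging B U -> `|M| <= B -> S <= t - cost a ->
    (forall v, v \in b -> U (a ++ v) t <= M + e') -> M - e' <= U a t ->
    forall w, w \in ws -> M - e <= U (a ++ w) t.

(** If the mean of the children is close to [M] and no child exceeds [M] by much,
    then the child [j] cannot fall short of [M] by much, since its weight is
    bounded below uniformly in [a]. *)
Lemma max_child B j e : 0 <= B -> 0 < e ->
  exists b S e', 0 < e' /\ forces_max B [:: [:: j]] e b S e'.
Proof.
move=> B0 e0.
pose pi0 := expR (- C) * len [:: j].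
have pi_gt0 : 0 < pi0 by rewrite mulr_gt0 ?expR_gt0.
(* Five errors of size at most e' each have to stay below e times the weight of j. *)
pose e' := e * pi0 / 8; have e'_gt0 : 0 < e' by rewrite divr_gt0// mulr_gt0.
pose x0 := e' / (B + 1).
have B1 : 0 < B + 1 by lra.
have x0_gt0 : 0 < x0 by rewrite divr_gt0.
have Bx0 : B * x0 <= e'.
  by rewrite /x0 mulrA ler_pdivrMr// mulrC ler_pM2l//; lra.
have [s0 us0 hs0] := child_ratio_exhaust hl x0_gt0.
have [s [us js hs]] : exists s, [/\ uniq s, j \in s &
    forall a, 1 - x0 <= \sum_(i <- s) ratio a i].
  have [js0|js0] := boolP (j \in s0); first by exists s0.
  exists (j :: s0); split => //=; first by rewrite js0.
    by rewrite inE eqxx.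
  by move=> a; rewrite big_cons ler_wpDl// ltW// (child_ratio_gt0 hl).
exists [seq [:: i] | i <- s], (- ln x0), e'; split => //.
move=> U a t M [Ub Urec] MB tS hb hU w; rewrite inE => /eqP ->.
have xa : expR (cost a - t) <= x0.
  by rewrite -[leRHS]lnK ?posrE// ler_expR; lra.
have := Urec a t s us; rewrite ler_norml => /andP[_].
rewrite !(big_rem j js)/= -cats1 => up.
have := hs a; rewrite (big_rem j js)/= => sum_lo.
have := sum_child_ratio_le1 hl a us; rewrite (big_rem j js)/= => sum_up.
have PU : \sum_(i <- rem j s) ratio a i * U (rcons a i) t <=
    (M + e') * \sum_(i <- rem j s) ratio a i.
  rewrite mulr_sumr big_seq [leRHS]big_seq ler_sum// => i /mem_rem is_.
  rewrite mulrC ler_pM2r ?(child_ratio_gt0 hl)// -cats1 hb// map_f//.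
move: up sum_lo sum_up PU.
have /andP[pj _] := child_ratio_near hl a j; rewrite -/pi0 in pj.
have P0 : 0 <= \sum_(i <- rem j s) ratio a i.
  by apply: sumr_ge0 => i _; rewrite ltW// (child_ratio_gt0 hl).
move: P0 pj; set P := \sum_(i <- rem j s) ratio a i; set p := ratio a j.
set SU := \sum_(i <- rem j s) _; set Uj := U (a ++ _) _.
move=> P0 pj up sum_lo sum_up PU.
have [M1 M2] : - B <= M /\ M <= B by apply/andP; rewrite -ler_norml.
have q0 : 0 <= 1 - (p + P) by lra.
have q1 : 1 - (p + P) <= x0 by lra.
have k1 : - e' <= M * (1 - (p + P)).
  have : - B * (1 - (p + P)) <= M * (1 - (p + P)) by rewrite ler_wpM2r.
  have : B * (1 - (p + P)) <= B * x0 by rewrite ler_wpM2l.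
  lra.
have k2 : B * (expR (cost a - t) + (1 - (p + P))) <= 2 * e'.
  have : B * (expR (cost a - t) + (1 - (p + P))) <= B * (x0 + x0).
    by rewrite ler_wpM2l// lerD.
  lra.
have k3 : e' * P <= e' by rewrite ler_piMr ?ltW//; lra.
have p_gt0 : 0 < p by lra.
have k4 : 8 * e' <= e * p.
  have -> : 8 * e' = e * pi0 by rewrite /e'; field.
  by rewrite ler_pM2l.
suff : p * (M - e) <= p * Uj by rewrite ler_pM2l.
lra.
Qed.

Lemma bounded_costs (b : seq (seq I)) :
  exists Z, forall v, v \in b -> cost v <= Z.
Proof.
elim: b => [|w b [Z hZ]]; first by exists 0.
exists (Num.max (cost w) Z) => v; rewrite inE => /orP[/eqP ->|/hZ h].
  by rewrite le_max lexx.
by rewrite le_max h orbT.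
Qed.

Lemma forces_max_weaken B ws e b S e' b2 S2 e2 :
  forces_max B ws e b S e' -> {subset b <= b2} -> S <= S2 -> 0 <= e2 <= e' ->
  forces_max B ws e b2 S2 e2.
Proof.
move=> h bb SS /andP[e20 ee] U a t M av MB tS hb hU w wws.
apply: (h U a t M av MB _ _ _ w wws); first by lra.
  by move=> v /bb /hb; lra.
by lra.
Qed.

(** Descend letter by letter. *)
Lemma max_word B w e : 0 <= B -> 0 < e ->
  exists b S e', 0 < e' /\ forces_max B [:: w] e b S e'.
Proof.
move=> B0; elim: w e => [|j w IH] e e0.
  exists [::], 0, e; split => // U a t M _ _ _ _ h w.
  by rewrite inE => /eqP ->; rewrite cats0.
have [b1 [S1 [e1 [e1_gt0 h1]]]] := IH e e0.
have [b0 [S0 [e2 [e2_gt0 h0]]]] := max_child j B0 e1_gt0.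
pose e' := Num.min e1 e2.
have e'_gt0 : 0 < e' by rewrite lt_min e1_gt0.
exists (b0 ++ [seq j :: v | v <- b1]), (Num.max S0 (S1 + cost [:: j] + C)), e'.
split => // U a t M av MB tS hb hU w'; rewrite inE => /eqP ->.
have tS0 : S0 <= t - cost a by apply: le_trans tS; rewrite le_max lexx.
have tS1 : S1 + cost [:: j] + C <= t - cost a.
  by apply: le_trans tS; rewrite le_max lexx orbT.
have e'1 : e' <= e1 by rewrite ge_min lexx.
have e'2 : e' <= e2 by rewrite ge_min lexx orbT.
have Uj : M - e1 <= U (a ++ [:: j]) t.
  apply: (h0 U a t M) => //; last by rewrite inE.
    move=> v vb; apply: le_trans (hb v _) _; last by lra.
    by rewrite mem_cat vb.
  by lra.
rewrite -cat1s catA; apply: (h1 U (a ++ [:: j]) t M) => //; last by rewrite inE.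
  have := cost_cat_near hl a [:: j]; rewrite ler_norml; lra.
move=> v vb; rewrite -catA; apply: le_trans (hb _ _) _; last by lra.
by rewrite mem_cat; apply/orP; right; apply/mapP; exists v.
Qed.

(** Feller's argument compares several descendants at one and the same time. *)
Lemma max_words B ws e : 0 <= B -> 0 < e ->
  exists b S e', 0 < e' /\ forces_max B ws e b S e'.
Proof.
move=> B0 e0; elim: ws => [|w ws [b [S [e' [e'0 h]]]]].
  by exists [::], 0, e; split => // U a t M _ _ _ _ _ w.
have [b1 [S1 [e1 [e10 h1]]]] := max_word w B0 e0.
exists (b ++ b1), (Num.max S S1), (Num.min e' e1).
have m0 : 0 < Num.min e' e1 by rewrite lt_min e'0.
split => // U a t M av MB tS hb hU x; rewrite inE => /orP[/eqP ->|xws].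
  have h1' : forces_max B [:: w] e (b ++ b1) (Num.max S S1) (Num.min e' e1).
    apply: (forces_max_weaken h1); rewrite ?le_max ?lexx ?orbT//.
      by move=> v vb; rewrite mem_cat vb orbT.
    by rewrite (ltW m0) ge_min lexx orbT.
  by apply: (h1' U a t M av MB tS hb hU); rewrite inE.
have h' : forces_max B ws e (b ++ b1) (Num.max S S1) (Num.min e' e1).
  apply: (forces_max_weaken h); rewrite ?le_max ?lexx ?orbT//.
    by move=> v vb; rewrite mem_cat vb.
  by rewrite (ltW m0) ge_min lexx.
exact: (h' U a t M av MB tS hb hU).
Qed.

Variable chi : pred (seq I).
Hypothesis chi_cat : forall u w, w != [::] -> chi (u ++ w) = chi w.

Section Eta.
Variable eta : R.
Hypothesis eta_gt0 : 0 < eta.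

Notation K := (countK cM).
Notation density := (density len chi eta).

Let K_gt0 : 0 < K := countK_gt0 hl.

Definition null_period (tau : R) : Prop :=
  forall e, 0 < e -> exists S, forall a t, S <= t - cost a ->
    `|density a (t + tau) - density a t| <= e.

(** The asymptotic cost [tau] of one more repetition of [v]; for the geometric
    potential it is the Birkhoff sum over the periodic orbit of [v]. *)
Definition word_period (v : seq I) (tau : R) : Prop :=
  exists C', forall k,
    `|cost (word_pow v k.+1) - cost (word_pow v k) - tau| <= C' * rho ^+ k.

Lemma increment_averaging sg :
  averaging ((1 + K) * (2 + expR (- sg)))
    (fun a t => density a (t + sg) - density a t).
Proof.
have es := expR_gt0 (- sg).
split=> [a t|a t s us].
  have := density_ge0 hl chi eta_gt0 a (t + sg).
  have := density_le hl chi eta_gt0 a (t + sg).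
  have := density_ge0 hl chi eta_gt0 a t; have := density_le hl chi eta_gt0 a t.
  have : 0 <= (1 + K) * expR (- sg) by rewrite mulr_ge0// ltW// addr_gt0.
  by rewrite ler_norml => *; apply/andP; split; have := K_gt0; lra.
have h1 := density_rec hl chi eta_gt0 a (t + sg) us.
have h2 := density_rec hl chi eta_gt0 a t us.
under eq_bigr do rewrite mulrBr.
rewrite sumrB [X in `|X|](_ : _ = (density a (t + sg) - \sum_(i <- s) ratio a i * density (rcons a i) (t + sg))
  - (density a t - \sum_(i <- s) ratio a i * density (rcons a i) t)); last by ring.
apply: (le_trans (ler_normB _ _)); apply: (le_trans (lerD h1 h2)).
have -> : expR (cost a - (t + sg)) = expR (cost a - t) * expR (- sg).
  by rewrite -expRD; congr expR; ring.
have q0 : 0 <= 1 - \sum_(i <- s) ratio a i by rewrite subr_ge0 (sum_child_ratio_le1 hl).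
have x0 := expR_gt0 (cost a - t).
rewrite -mulrDr -mulrA ler_pM2l ?addr_gt0//.
have : 0 <= expR (- sg) * (1 - \sum_(i <- s) ratio a i) by rewrite mulr_ge0// ltW.
lra.
Qed.

Section Period.
Variables (v : seq I) (tau C' : R).
Hypothesis v_neq0 : v != [::].
Hypothesis v_tau : forall k,
  `|cost (word_pow v k.+1) - cost (word_pow v k) - tau| <= C' * rho ^+ k.

Let rho_size k : rho ^+ size (word_pow v k) <= rho ^+ k.
Proof.
rewrite ler_wiXn2l ?ltW//.
by rewrite size_word_pow leq_pmulr// lt0n size_eq0.
Qed.

Lemma cost_pow_step a k :
  `|cost (a ++ word_pow v k.+1) - cost (a ++ word_pow v k) - tau|
  <= (C + C') * rho ^+ k.
Proof.
have h1 := cost_distortion hl a (word_pow v k) v; rewrite -word_powSr in h1.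
have h2 := v_tau k.
have h3 : C * rho ^+ size (word_pow v k) <= C * rho ^+ k by rewrite ler_wpM2l.
have := le_trans (ler_normD _ _) (lerD (le_trans h1 h3) h2).
rewrite -mulrDl; congr (`|_| <= _); ring.
Qed.

(** The initial word [a] hardly matters for the cost of [k] more repetitions of
    [v] once there are [p] of them. *)
Lemma cost_pow_shift a k p :
  `|cost (a ++ word_pow v (k + p)) - cost (a ++ word_pow v p) - k%:R * tau|
  <= k%:R * (C + C') * rho ^+ p.
Proof.
elim: k => [|k IH]; first by rewrite add0n subrr !mul0r subrr normr0.
have CC : 0 <= C + C'.
  have := cost_pow_step [::] 0; rewrite mulr1; exact: le_trans.
have h1 : (C + C') * rho ^+ (k + p) <= (C + C') * rho ^+ p.
  rewrite ler_wpM2l// ler_wiXn2l ?ltW// leq_addl//.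
have := le_trans (ler_normD _ _) (lerD IH (le_trans (cost_pow_step a (k + p)) h1)).
have -> : k.+1%:R * (C + C') * rho ^+ p
    = k%:R * (C + C') * rho ^+ p + (C + C') * rho ^+ p.
  by rewrite -natr1; ring.
by congr (`|_| <= _); rewrite addSn -natr1; ring.
Qed.

(** Powers of [v] with a common suffix compare through that suffix, which turns
    [k] repetitions of [v] into a shift of time by [k * tau]. *)
Lemma density_pow a k p t : (0 < p)%N ->
  `|density (a ++ word_pow v (k + p)) t
    - density (a ++ word_pow v p) (t - k%:R * tau)|
  <= (2 * shiftK cM C eta + lipK cM eta * (k%:R * (C + C'))) * rho ^+ p.
Proof.
move=> p0; set w := word_pow v p.
have w0 : w != [::].
  by rewrite -size_eq0 /w size_word_pow muln_eq0 size_eq0 (negbTE v_neq0) orbF -lt0n.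
have wsz : rho ^+ size w <= rho ^+ p by exact: rho_size.
pose s := t - (cost (a ++ word_pow v (k + p)) - cost (a ++ w)).
have h1 := density_shift hl chi_cat eta_gt0 (a ++ word_pow v k) t w0.
rewrite -catA -word_powD in h1.
have h2 := density_shift hl chi_cat eta_gt0 a s w0.
rewrite (_ : s - _ = t - (cost (a ++ word_pow v (k + p)) - cost w)) in h2; last first.
  by rewrite /s; ring.
have h3 := density_lip hl chi eta_gt0 (a ++ w) (t - k%:R * tau) s.
have h4 : `|s - (t - k%:R * tau)| <= k%:R * (C + C') * rho ^+ p.
  by have := cost_pow_shift a k p; rewrite -normrN; congr (`|_| <= _); rewrite /s; ring.
have l0 := lipK_ge0 hl eta_gt0.
have h5 := le_trans h3 (ler_wpM2l l0 h4).
have sh0 := shiftK_ge0 hl eta_gt0.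
have h6 := ler_wpM2l sh0 wsz.
move: h1 h2 h5; rewrite !ler_norml => /andP[? ?] /andP[? ?] /andP[? ?].
by apply/andP; split; lra.
Qed.

(** Suppose that the increments of the density over the shift [sg] had an
    asymptotic supremum [M > 0], nearly attained at [a].  By the maximum
    principle they would nearly equal [M] at [a ++ word_pow v (k + p)] for
    all [k < m] at the same time [t].  These are the increments at
    [a ++ word_pow v p] at the times [t - k * tau], and for [sg] equal to
    [tau] or [- tau] their sum telescopes, so it is at most [K], while it is about
    [m * M]. *)
Lemma increment_small sg :
  (forall f, (forall t, 0 <= f t <= K) -> forall m t,
     \sum_(k < m) (f (t - k%:R * tau + sg) - f (t - k%:R * tau)) <= K) ->
  forall e, 0 < e -> exists S, forall a t, S <= t - cost a ->
    density a (t + sg) - density a t <= e.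
Proof.
move=> tele e e0; apply: contrapT => /forallNP hno.
have {}hno S : exists a t, S <= t - cost a /\ e < density a (t + sg) - density a t.
  have := hno S => /existsNP[a /existsNP[t /not_implyP[h1 /negP h2]]].
  by exists a, t; rewrite ltNge.
pose U a t := density a (t + sg) - density a t.
pose B := (1 + K) * (2 + expR (- sg)).
have avU : averaging B U := increment_averaging sg.
pose E := [set M | exists S, forall a t, S <= t - cost a -> U a t <= M].
have E_lb M : E M -> e <= M.
  by move=> [S hS]; have [a [t [h1 h2]]] := hno S; apply: le_trans (ltW h2) (hS _ _ h1).
have BE : E B.
  by exists 0 => a t _; have := (avU.1 a t); apply: le_trans; exact: ler_norm.
have infE : has_inf E by split; [exists B|exists e => M; exact: E_lb].
pose M := inf E.
have eM : e <= M by apply: lb_le_inf; [exists B|move=> x; exact: E_lb].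
have M0 : 0 < M by lra.
have MB : `|M| <= B by rewrite gtr0_norm//; apply: ge_inf => //; exists e => x; exact: E_lb.
pose m := Num.bound (2 * K / M).
have hm : 2 * K < m%:R * M.
  rewrite -ltr_pdivrMr//; apply: archi_boundP.
  by rewrite divr_ge0 ?mulr_ge0// ltW.
have [p p0 hp] := exists_small_pow
  (2 * (2 * shiftK cM C eta + lipK cM eta * (m%:R * (C + C')))) (ls_rho hl)
  (divr_gt0 M0 (ltr0n R 4)).
have B0 : 0 <= B by apply: le_trans MB; exact: normr_ge0.
have [b [S [e' [e'0 force]]]] := max_words
  [seq word_pow v (k + p) | k <- iota 0 m] B0 (divr_gt0 M0 (ltr0n R 4)).
have [M' [S' hS'] MM'] : exists2 M', E M' & M' < M + e'.
  exact: inf_adherent.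
have [Z hZ] := bounded_costs b.
have /forallNP/(_ (Num.max S (S' + Z + C))) : ~ E (M - e').
  move=> h; have : M <= M - e' by apply: ge_inf => //; exists e => x; exact: E_lb.
  lra.
move=> /existsNP[a /existsNP[t /not_implyP[tS /negP]]]; rewrite -ltNge => Uat.
have tS0 : S <= t - cost a by apply: le_trans tS; rewrite le_max lexx.
have tS1 : S' + Z + C <= t - cost a by apply: le_trans tS; rewrite le_max lexx orbT.
have {}force := force U a t M avU MB tS0 _ (ltW Uat) _.
have hb x : x \in b -> U (a ++ x) t <= M + e'.
  move=> xb; apply: le_trans (ltW MM'); apply: hS'.
  have := hZ x xb; have := cost_cat_near hl a x; rewrite ler_norml; lra.
pose f s := density (a ++ word_pow v p) s.
have f_itv s : 0 <= f s <= K.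
  by rewrite /f (density_ge0 hl)//= (density_le hl).
have := tele f f_itv m t; rewrite leNgt => /negP; apply.
apply: (@lt_le_trans _ _ (\sum_(k < m) (M / 2))).
  by rewrite sumr_const card_ord -mulr_natl; lra.
apply: ler_sum => k _.
have kin : word_pow v (k + p) \in [seq word_pow v (k + p) | k <- iota 0 m].
  by apply/mapP; exists (k : nat) => //; rewrite mem_iota ltn_ord.
have := force hb _ kin; rewrite /U => hk.
have CC : 0 <= C + C'.
  have := cost_pow_step [::] 0; rewrite mulr1; exact: le_trans.
have small : (2 * shiftK cM C eta + lipK cM eta * (k%:R * (C + C'))) * rho ^+ p
    <= M / 4 / 2.
  rewrite ler_pdivlMr// mulrC; apply: le_trans hp; rewrite -[leRHS]mulrA.
  rewrite ler_pM2l// ler_pM2r ?exprn_gt0// lerD2l ler_wpM2l ?(lipK_ge0 hl)//.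
  by rewrite ler_wpM2r// ler_nat ltnW.
have := le_trans (density_pow a k t p0) small.
have := le_trans (density_pow a k (t + sg) p0) small.
rewrite (addrAC t sg) -/(f _) -/(f _).
rewrite !ler_norml => /andP[? ?] /andP[? ?]; lra.
Qed.

(** Both signs of the shift are needed to bound the absolute value. *)
Lemma null_period_word : null_period tau.
Proof.
move=> e e0.
have tele1 (f : R -> R) : (forall t, 0 <= f t <= K) -> forall m t,
    \sum_(k < m) (f (t - k%:R * tau + tau) - f (t - k%:R * tau)) <= K.
  move=> hf m t; pose g k := - f (t + tau - k%:R * tau).
  rewrite (eq_bigr (fun k : 'I_m => g k.+1 - g k)); last first.
    move=> k _; rewrite /g opprK [RHS]addrC; congr (f _ - f _); rewrite -?natr1; ring.
  rewrite -(big_mkord xpredT (fun k => g k.+1 - g k)) telescope_sumr// /g opprK.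
  by have := hf (t + tau - m%:R * tau); have := hf (t + tau - 0%:R * tau); lra.
have tele2 (f : R -> R) : (forall t, 0 <= f t <= K) -> forall m t,
    \sum_(k < m) (f (t - k%:R * tau + - tau) - f (t - k%:R * tau)) <= K.
  move=> hf m t; pose g k := f (t - k%:R * tau).
  rewrite (eq_bigr (fun k : 'I_m => g k.+1 - g k)); last first.
    move=> k _; rewrite /g; congr (f _ - f _); rewrite -?natr1; ring.
  rewrite -(big_mkord xpredT (fun k => g k.+1 - g k)) telescope_sumr// /g.
  by have := hf (t - m%:R * tau); have := hf (t - 0%:R * tau); lra.
have [S1 h1] := increment_small tele1 e0.
have [S2 h2] := increment_small tele2 e0.
exists (Num.max S1 (S2 - tau)) => a t tS.
have tS1 : S1 <= t - cost a by apply: le_trans tS; rewrite le_max lexx.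
have tS2 : S2 - tau <= t - cost a by apply: le_trans tS; rewrite le_max lexx orbT.
have := h2 a (t + tau); rewrite addrK => h2'.
rewrite ler_norml h1// andbT lerNl opprB h2'//; lra.
Qed.

End Period.

Lemma null_periodB s1 s2 : null_period s1 -> null_period s2 -> null_period (s1 - s2).
Proof.
move=> h1 h2 e e0.
have e2 : 0 < e / 2 by lra.
have [S1 {}h1] := h1 _ e2; have [S2 {}h2] := h2 _ e2.
exists (Num.max (S1 + s2) (S2 + s2)) => a t tS.
have tS1 : S1 + s2 <= t - cost a by apply: le_trans tS; rewrite le_max lexx.
have tS2 : S2 + s2 <= t - cost a by apply: le_trans tS; rewrite le_max lexx orbT.
have k1 : S1 <= t - s2 - cost a by lra.
have k2 : S2 <= t - s2 - cost a by lra.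
have := h1 a _ k1; have := h2 a _ k2; rewrite subrK.
rewrite (_ : t - s2 + s1 = t + (s1 - s2)); last by ring.
rewrite !ler_norml => /andP[? ?] /andP[? ?]; apply/andP; split; lra.
Qed.

Lemma null_period0 : null_period 0.
Proof. by move=> e e0; exists 0 => a t _; rewrite addr0 subrr normr0 ltW. Qed.

Lemma closed_null_period : closed [set tau | null_period tau].
Proof.
move=> tau htau e e0.
have l0 := lipK_ge0 hl eta_gt0.
pose d := e / 2 / (lipK cM eta + 1).
have d0 : 0 < d by rewrite !divr_gt0//; lra.
have [s [hs sd]] := htau _ (nbhsx_ballx tau d d0).
have [S hS] := hs _ (divr_gt0 e0 (ltr0n R 2)).
exists S => a t tS; have := hS a t tS.
have := density_lip hl chi eta_gt0 a (t + s) (t + tau).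
have dd : lipK cM eta * `|t + tau - (t + s)| <= e / 2.
  have -> : t + tau - (t + s) = tau - s by ring.
  have : lipK cM eta * `|tau - s| <= lipK cM eta * d.
    by rewrite ler_wpM2l// ltW.
  have : (lipK cM eta + 1) * d = e / 2 by rewrite /d mulrC divfK// gt_eqF//; lra.
  lra.
rewrite !ler_norml => /andP[? ?] /andP[? ?]; apply/andP; split; lra.
Qed.

End Eta.
End MaximumPrinciple.

(** * Equidistribution of words unless the periods lie in a lattice *)

Section ClosedSubgroups.
Variables (R : realType) (D : set R).
Hypotheses (D0 : D 0) (DB : forall x y, D x -> D y -> D (x - y)).

Lemma subgroupN x : D x -> D (- x).
Proof. by move=> Dx; rewrite -sub0r; exact: DB. Qed.

Lemma subgroupD x y : D x -> D y -> D (x + y).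
Proof. by move=> Dx Dy; rewrite -[y]opprK; apply: DB => //; exact: subgroupN. Qed.

Lemma subgroup_intmul x (n : int) : D x -> D (n%:~R * x).
Proof.
move=> Dx; have nat_case k : D (k%:R * x).
  elim: k => [|k IH]; first by rewrite mul0r.
  by rewrite -natr1 mulrDl mul1r; exact: subgroupD.
case: n => k; first exact: nat_case.
by rewrite NegzE mulrNz mulNr; apply: subgroupN; exact: nat_case.
Qed.

(** If some point were not isolated, the group would contain arbitrarily small
    positive elements, whose multiples are dense. *)
Lemma closed_subgroup_discrete : closed D -> D != setT -> discrete_subgroup D.
Proof.
move=> cD DT; split => // x Dx; split; first by rewrite inE.
apply: contrapT => xD.
move/eqP: DT; apply; apply/seteqP; split => // tau _; apply: cD => V.
move=> /nbhs_ballP[d /= d0 dV].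
have [h [Dh h0 hd]] : exists h, [/\ D h, 0 < h & h < d].
  apply: contrapT => hno; apply: xD.
  exists (ball x d); first exact: nbhsx_ballx.
  apply/seteqP; split => y /=; last by move=> ->; split => //; exact: ballxx.
  move=> [xy Dy]; apply: contrapT => /eqP yx; apply: hno.
  exists `|x - y|; split; last exact: xy.
    have [_|_] := ger0P (x - y); first exact: DB.
    by rewrite opprB; exact: DB.
  by rewrite normr_gt0 subr_eq0 eq_sym.
exists ((Num.floor (tau / h))%:~R * h); split; first exact: subgroup_intmul.
apply: dV; rewrite /ball/=.
have := floor_itv (tau / h); rewrite ler_pdivlMr// ltr_pdivrMr//.
rewrite rmorphD/= mulrDl mul1r => /andP[f1 f2].
by rewrite ger0_norm; lra.
Qed.

End ClosedSubgroups.

Section Equidistribution.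
Variables (R : realType) (I : choiceType) (len : seq I -> R).
Variables (cM rho C kappa : R).
Hypothesis hl : length_system len cM rho C kappa.

Let len_gt0 := ls_gt0 hl.

Notation cost := (cost len).
Notation ratio := (child_ratio len).

Variable chi : pred (seq I).
Hypothesis chi_cat : forall u w, w != [::] -> chi (u ++ w) = chi w.

Notation K := (countK cM).
Let K_gt0 : 0 < K := countK_gt0 hl.


Definition lattice_periods : Prop := exists D : set R,
  [/\ discrete_subgroup D, closed D &
      forall v tau, v != [::] -> word_period len rho v tau -> D tau].

Lemma null_period_or_lattice eta : 0 < eta -> ~ lattice_periods ->
  forall tau, null_period len chi eta tau.
Proof.
move=> eta0 nl; pose D := [set tau | null_period len chi eta tau].
have [DT|DT] := eqVneq D setT.
  by move=> tau; have : D tau by rewrite DT.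
have cD : closed D := closed_null_period hl eta0 (chi := chi).
exfalso; apply: nl; exists D; split => //.
  apply: closed_subgroup_discrete => //; first exact: null_period0.
  by move=> x y; exact: null_periodB.
by move=> v tau v0 [C' hC']; apply: (null_period_word hl chi_cat eta0 v0 hC').
Qed.

Lemma eventually_all (T : eqType) (s : seq T) (P : T -> R -> Prop) :
  (forall x, x \in s -> exists t0, forall t, t0 <= t -> P x t) ->
  exists t0, forall t, t0 <= t -> forall x, x \in s -> P x t.
Proof.
elim: s => [|x s IH] h; first by exists 0.
have [t1 h1] := h x (mem_head _ _).
have [t2 h2] : exists t0, forall t, t0 <= t -> forall x, x \in s -> P x t.
  by apply: IH => y ys; apply: h; rewrite inE ys orbT.
exists (Num.max t1 t2) => t; rewrite ge_max => /andP[tt1 tt2] y.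
by rewrite inE => /orP[/eqP ->|]; [exact: h1|exact: h2].
Qed.

(** Iterating the mean value property [n] times bounds an averaging family from
    below by its values at the words of length [n] below [a], finitely many of
    which suffice. *)
Lemma averaging_lower B n e : 0 <= B -> 0 < e ->
  exists (ws : seq (seq I)) (S : R),
  (forall w, w \in ws -> size w = n) /\
  forall U a t m, averaging len B U -> `|m| <= B -> S <= t - cost a ->
    (forall w, w \in ws -> m <= U (a ++ w) t) -> m - e <= U a t.
Proof.
move=> B0; elim: n e => [|n IH] e e0.
  exists [:: [::]], 0; split; first by move=> w; rewrite inE => /eqP ->.
  move=> U a t m _ _ _ h; have := h [::]; rewrite inE eqxx cats0 => /(_ isT); lra.
have [ws [S [sz h]]] := IH (e / 2) (divr_gt0 e0 (ltr0n R 2)).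
pose x0 := e / 8 / (B + e + 1).
have B1 : 0 < B + e + 1 by lra.
have x0_gt0 : 0 < x0 by rewrite !divr_gt0.
have Bx0 : (B + e + 1) * x0 = e / 8 by rewrite /x0 mulrC divfK// gt_eqF.
have [s us hs] := child_ratio_exhaust hl x0_gt0.
have [Z hZ] := bounded_costs len [seq [:: i] | i <- s].
exists [seq i :: w | i <- s, w <- ws], (Num.max (- ln x0) (S + Z + C)).
split.
  by move=> w /allpairsP[[i u] /= [_ uw ->]] /=; rewrite sz.
move=> U a t m av mB; rewrite ge_max => /andP[t1 t2] hU.
have xa : expR (cost a - t) <= x0.
  by rewrite -[leRHS]lnK ?posrE// ler_expR; lra.
have child i : i \in s -> m - e / 2 <= U (rcons a i) t.
  move=> is_; apply: h => //.
    have := hZ [:: i] (map_f _ is_).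
    by have := cost_cat_near hl a [:: i]; rewrite cats1 ler_norml; lra.
  move=> w ww; rewrite cat_rcons; apply: hU.
  by apply/allpairsP; exists (i, w).
have := av.2 a t s us; rewrite ler_norml => /andP[lo _].
have P1 := sum_child_ratio_le1 hl a us; have P2 := hs a.
have sumU : (m - e / 2) * \sum_(i <- s) ratio a i <=
    \sum_(i <- s) ratio a i * U (rcons a i) t.
  rewrite mulr_sumr big_seq [leRHS]big_seq ler_sum// => i is_.
  by rewrite mulrC ler_pM2l ?(child_ratio_gt0 hl)// child.
move: lo sumU P1 P2; set P := \sum_(i <- s) ratio a i.
set SU := \sum_(i <- s) _; set x := expR _ in xa * => lo sumU P1 P2.
have x_gt0 : 0 < x by exact: expR_gt0.
have [m1 m2] : - B <= m /\ m <= B by apply/andP; rewrite -ler_norml.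
have k1 : B * (x + (1 - P)) <= B * (x0 + x0).
  by rewrite ler_wpM2l// lerD//; lra.
have k2 : (m - e / 2) * (1 - P) <= (B + e + 1) * x0.
  have : (m - e / 2) * (1 - P) <= (B + e + 1) * (1 - P).
    by rewrite ler_wpM2r; lra.
  have : (B + e + 1) * (1 - P) <= (B + e + 1) * x0.
    by rewrite ler_wpM2l; lra.
  lra.
have : B * x0 <= (B + e + 1) * x0 by rewrite ler_wpM2r; lra.
lra.
Qed.

Section Eta.
Variable eta : R.
Hypothesis eta_gt0 : 0 < eta.
Hypothesis all_null : forall tau, null_period len chi eta tau.

Notation density := (density len chi eta).

Lemma defect_averaging : averaging len (1 + 2 * K)
  (fun a t => density [::] t - density a t).
Proof.
split=> [a t|a t s us].
  have := density_ge0 hl chi eta_gt0 a t; have := density_le hl chi eta_gt0 a t.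
  have := density_ge0 hl chi eta_gt0 [::] t; have := density_le hl chi eta_gt0 [::] t.
  by rewrite ler_norml => *; apply/andP; split; have := K_gt0; lra.
have h := density_rec hl chi eta_gt0 a t us.
under eq_bigr do rewrite mulrBr.
rewrite sumrB -mulr_suml.
have d0 := density_ge0 hl chi eta_gt0 [::] t; have d1 := density_le hl chi eta_gt0 [::] t.
have q0 : 0 <= 1 - \sum_(i <- s) ratio a i by rewrite subr_ge0 (sum_child_ratio_le1 hl).
move: h q0; set P := \sum_(i <- s) ratio a i; set SU := \sum_(i <- s) _.
move=> h q0.
have k1 : density [::] t * (1 - P) <= K * (1 - P) by rewrite ler_wpM2r.
have k2 : 0 <= density [::] t * (1 - P) by rewrite mulr_ge0.
have k3 : 0 <= K * expR (cost a - t) by rewrite mulr_ge0 ?expR_ge0// ltW.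
move: h; rewrite !ler_norml => /andP[? ?]; apply/andP; split; lra.
Qed.

(** Let [M] be the supremum over [a] of the upper limits of the excess of the
    density at the root over that at [a], and suppose [M > 0].  Where the excess
    at some [c] is close to [M], the maximum principle makes it close to [M] at
    all [c ++ w] with [w] of a large length [p].  Now [c ++ w] looks like [w] up to
    a time shift, and time shifts do not matter, so the excess is close to [M] at
    these [w] as well.  But its mean over them is the excess at the root,
    which is 0. *)
Lemma density_root_le a e : 0 < e ->
  exists t0, forall t, t0 <= t -> density [::] t - e <= density a t.
Proof.
move=> e0; apply: contrapT => hno.
pose U a t := density [::] t - density a t.
pose B := 1 + 2 * K; have B0 : 0 <= B by have := K_gt0; rewrite /B; lra.
have avU : averaging len B U := defect_averaging.
have {}hno T : exists t, T <= t /\ e < U a t.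
  apply: contrapT => /forallNP h; apply: hno; exists T => t Tt.
  by have /not_andP[//|/negP] := h t; rewrite -leNgt /U; lra.
pose E := [set M | forall a, exists T, forall t, T <= t -> U a t <= M].
have E_lb M : E M -> e <= M.
  move=> /(_ a)[T hT]; have [t [Tt et]] := hno T.
  by apply: le_trans (ltW et) (hT _ Tt).
have BE : E B.
  by move=> b; exists 0 => t _; have := (avU.1 b t); apply: le_trans; exact: ler_norm.
have hlb : has_lbound E by exists e => x; exact: E_lb.
have infE : has_inf E by split => //; exists B.
pose M := inf E.
have eM : e <= M by apply: lb_le_inf; [exists B|move=> x; exact: E_lb].
have M0 : 0 < M by lra.
have MB : M <= B by exact: ge_inf.
have [p p0 hp] := exists_small_pow (shiftK cM C eta) (ls_rho hl)
  (divr_gt0 M0 (ltr0n R 8)).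
have [ws [S1 [sz low]]] := averaging_lower p B0 (divr_gt0 M0 (ltr0n R 4)).
have [b [S [e' [e'0 force]]]] := max_words hl ws B0 (divr_gt0 M0 (ltr0n R 8)).
have [M' hM' MM'] : exists2 M', E M' & M' < M + e' by exact: inf_adherent.
have /existsNP[c hc] : ~ E (M - e').
  move=> h; have : M <= M - e' by exact: ge_inf.
  lra.
have {}hc T : exists t, T <= t /\ M - e' < U c t.
  apply: contrapT => /forallNP h; apply: hc; exists T => t Tt.
  by have /not_andP[//|/negP] := h t; rewrite -leNgt.
have [t1 ht1] : exists t0, forall t, t0 <= t -> forall v, v \in b ->
    U (c ++ v) t <= M'.
  by apply: eventually_all => v _; exact: hM'.
have [t2 ht2] : exists t0, forall t, t0 <= t -> forall w, w \in ws ->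
    `|density w (t - (cost (c ++ w) - cost w)) - density w t| <= M / 8.
  apply: eventually_all => w _.
  have [S' hS'] := all_null (- (cost (c ++ w) - cost w)) (divr_gt0 M0 (ltr0n R 8)).
  by exists (S' + cost w) => t tS; apply: hS'; lra.
pose T := Num.max (Num.max t1 t2) (Num.max (S + cost c) S1).
have [t [Tt Uct]] := hc T.
move: Tt; rewrite /T !ge_max => /andP[/andP[tt1 tt2] /andP[ttS ttS1]].
have hw w : w \in ws -> M / 2 <= U ([::] ++ w) t.
  move=> wws.
  have tS : S <= t - cost c by lra.
  have MB' : `|M| <= B by rewrite gtr0_norm.
  have hb v : v \in b -> U (c ++ v) t <= M + e'.
    by move=> vb; apply: le_trans (ltW MM'); exact: ht1.
  have := force U c t M avU MB' tS hb (ltW Uct) w wws.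
  have w0 : w != [::] by rewrite -size_eq0 (sz w wws) -lt0n.
  have := density_shift hl chi_cat eta_gt0 c t w0; rewrite (sz w wws).
  move=> /le_trans /(_ hp); have := ht2 t tt2 w wws.
  by rewrite !ler_norml /U cat0s => /andP[? ?] /andP[? ?]; lra.
have := low U [::] t (M / 2) avU; rewrite (cost_nil hl) subr0 gtr0_norm; last by lra.
have MB2 : M / 2 <= B by lra.
move=> /(_ MB2 ttS1 hw); rewrite /U subrr; lra.
Qed.

End Eta.

(** The hard count at time [t] lies between the smoothed counts at the times [t]
    and [t + eta]; as shifts by [eta] do not change the densities, this costs a
    factor [expR eta], close to 1 for small [eta]. *)
Lemma words_equidistributed j a e : chi [:: j] -> ~ lattice_periods -> 0 < e ->
  exists t0, forall t, t0 <= t ->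
  (len a - e) * subtree_sum (hard_count len chi (expR t)) [::] <=
  subtree_sum (hard_count len chi (expR t)) a.
Proof.
move=> chij nl e0.
have [c c0 hc] := count_linear_lower hl chi_cat chij.
pose eta := e / 2; have eta0 : 0 < eta by rewrite divr_gt0.
have null := null_period_or_lattice eta0 nl.
pose e1 := c * e / 4; have e10 : 0 < e1 by rewrite divr_gt0// mulr_gt0.
have [t1 h1] := density_root_le eta0 null a e10.
have [t2 h2] := null eta e1 e10.
have E0 : 0 < expR C / len [:: j] by rewrite divr_gt0// expR_gt0.
exists (Num.max (Num.max t1 t2) (ln (expR C / len [:: j]))) => t.
rewrite !ge_max => /andP[/andP[tt1 tt2] tt3].
have {}h1 := h1 t tt1.
have := h2 [::] t; rewrite (cost_nil hl) subr0 => /(_ tt2); rewrite ler_norml => /andP[_ {}h2].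
have {}hc : c * expR t <= subtree_sum (hard_count len chi (expR t)) [::].
  by apply: hc; rewrite -[leLHS]lnK ?posrE// ler_expR.
set N0 := subtree_sum _ [::] in hc *; set Na := subtree_sum _ a.
have et := expR_gt0 t.
have bS s := below_soft hl chi eta0 s.
have bH s := below_hard len chi s.
have up : N0 <= soft_sum len chi eta [::] (t + eta).
  apply: (le_subtree_sum hl et (expR_gt0 (t + eta))) => // v.
  by rewrite (hard_le_soft hl).
have lo : soft_sum len chi eta a t <= Na.
  apply: (le_subtree_sum hl et et) => // v.
  by rewrite (soft_le_hard hl).
rewrite (soft_sumE hl) (ls_nil hl) mul1r expRD in up.
rewrite (soft_sumE hl) in lo.
have len1 : len a <= 1.
  by rewrite -(ls_nil hl) -[a]cat0s; exact: (len_cat_le1 hl).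
have N0ge : 0 <= N0 by apply: le_trans hc; rewrite mulr_ge0// ltW.
have eeta : 1 - eta <= expR (- eta).
  by rewrite -[1 - eta]/(1 + (- eta)) expR_ge1Dx.
have up' : expR (- eta) * N0 <= expR t * density len chi eta [::] (t + eta).
  rewrite -(ler_pM2l (expR_gt0 (- eta))) in up; apply: le_trans up _.
  have ee : expR (- eta) * expR eta = 1 by rewrite -expRD addNr expR0.
  by rewrite -[leRHS]mul1r -ee le_eqVlt; apply/orP; left; apply/eqP; ring.
have low' : (1 - eta) * N0 <= expR t * density len chi eta [::] (t + eta).
  by apply: le_trans up'; rewrite ler_wpM2r.
have k1 : expR t * density len chi eta [::] (t + eta) - 2 * e1 * expR t
    <= expR t * density len chi eta a t.
  have : expR t * (density len chi eta [::] (t + eta) - 2 * e1) <=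
      expR t * density len chi eta a t by rewrite ler_pM2l//; lra.
  lra.
have k2 : 2 * e1 * expR t <= e / 2 * N0.
  have -> : 2 * e1 * expR t = e / 2 * (c * expR t) by rewrite /e1; field.
  by rewrite ler_pM2l// divr_gt0.
have k3 : (1 - e) * N0 <= expR t * density len chi eta a t.
  rewrite /eta in low'; lra.
have k4 : len a * ((1 - e) * N0) <= Na.
  apply: le_trans lo; rewrite -mulrA ler_pM2l//.
have : len a * (e * N0) <= e * N0 by rewrite ler_piMl// mulr_ge0// ltW.
lra.
Qed.

End Equidistribution.

(** * Geometry of a generating family *)

Section RealFunctions.
Variable R : realType.
Implicit Types (f g : R -> R).

Lemma derive_within_interior f (a b x : R) : a < x < b ->
  derivable_within `[a, b] f x -> is_derive x 1 f (derive_within `[a, b] f x).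
Proof.
move=> /andP[ax xb] dfx.
set l := derive_within _ _ _.
have main : h^-1 *: ((f \o shift x) (h *: 1) - f x) @[h --> 0^'] --> l.
  apply/cvgrPdist_lt => e e0.
  have /cvgrPdist_lt/(_ e e0) : diff_quotient f x @ within `[a, b] x^' --> l by exact: dfx.
  rewrite near_withinE /dnbhs near_withinE => /nbhs_ballP[d /= d0 hd].
  rewrite /dnbhs near_withinE.
  pose r := Num.min d (Num.min (x - a) (b - x)).
  have r0 : 0 < r by rewrite !lt_min d0 !subr_gt0 ax.
  apply/nbhs_ballP; exists r => // h /=; rewrite /ball/= sub0r normrN.
  rewrite !lt_min => /andP[hd' /andP[ha hb]] h0.
  have := hd (h + x); rewrite /ball/= opprD addrCA subrr addr0 normrN => /(_ hd').
  rewrite -subr_eq0 addrK => /(_ h0).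
  have : (h + x) \in `[a, b].
    by move: ha hb; rewrite !ltr_norml in_itv/= => /andP[? ?] /andP[? ?]; apply/andP; split; lra.
  move=> hin /(_ hin); rewrite /diff_quotient addrK.
  by rewrite /= [h *: 1]mulr1 [_ *: _]mulrC.
apply: DeriveDef; first by apply/cvg_ex; exists l.
exact: cvg_lim.
Qed.

(** The other intervals lie either to the left or to the right of a given one,
    so induction applies on both sides. *)
Lemma sum_increments_le (I : eqType) (lo hi : I -> R) f (s : seq I) (a b : R) :
  (forall x y, a <= x -> x <= y -> y <= b -> f x <= f y) ->
  (forall i, lo i <= hi i) ->
  (forall i j, i != j -> hi i <= lo j \/ hi j <= lo i) ->
  uniq s -> a <= b -> (forall i, i \in s -> a <= lo i /\ hi i <= b) ->
  \sum_(i <- s) (f (hi i) - f (lo i)) <= f b - f a.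
Proof.
move=> fmono lohi sep.
have [n] := ubnP (size s); elim: n s a b fmono => // n IH [|i s] a b fmono.
  by move=> _ _ ab _; rewrite big_nil subr_ge0 fmono.
rewrite /= ltnS => sn /andP[is_ us] ab hs.
have [ai ib] := hs i (mem_head _ _); have li := lohi i.
rewrite big_cons (bigID (fun j => hi j <= lo i))/=.
have left : \sum_(j <- s | hi j <= lo i) (f (hi j) - f (lo j)) <= f (lo i) - f a.
  rewrite -big_filter; apply: IH => //.
  - by move=> x y ax xy yb; apply: fmono => //; lra.
  - by rewrite size_filter (leq_ltn_trans (count_size _ _)).
  - exact: filter_uniq.
  - move=> j; rewrite mem_filter => /andP[ji js]; split => //.
    by have [] := hs j; rewrite // inE js orbT.
have right : \sum_(j <- s | ~~ (hi j <= lo i)) (f (hi j) - f (lo j)) <= f b - f (hi i).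
  rewrite -big_filter; apply: IH => //.
  - by move=> x y ax xy yb; apply: fmono => //; lra.
  - by rewrite size_filter (leq_ltn_trans (count_size _ _)).
  - exact: filter_uniq.
  - move=> j; rewrite mem_filter => /andP[ji js].
    have [_ jb] := hs j (mem_behead (s := i :: s) js); split => //.
    have ij : i != j by apply: contraNneq is_ => ->.
    by have [//|h] := sep _ _ ij; rewrite h in ji.
lra.
Qed.

End RealFunctions.

Section Geometry.
Variables (R : realType) (I : pointedType) (T : I -> R -> R).
Hypothesis hT : generates_partition T.

Notation word_map := (compose_word T).

Definition word_length (w : seq I) : R := word_map w 1 - word_map w 0.

Lemma T_itv i x : 0 <= x <= 1 -> 0 <= T i x <= 1.
Proof.
move=> x01; have [a [b [a0 ab b1 im]]] := gp_image hT i.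
have : (T i @` `[0, 1]) (T i x) by exists x => //=; rewrite in_itv.
rewrite im /= in_itv/= => /andP[? ?]; apply/andP; split; lra.
Qed.

Lemma T_lt i x y : 0 <= x -> y <= 1 -> x < y -> T i x < T i y.
Proof.
by move=> x0 y1 xy; apply: (gp_increasing hT) => //; apply/andP; split; lra.
Qed.

Lemma T_le i x y : 0 <= x -> y <= 1 -> x <= y -> T i x <= T i y.
Proof.
move=> x0 y1; rewrite le_eqVlt => /orP[/eqP -> //|xy].
by rewrite ltW// T_lt.
Qed.

Lemma T_image i : T i @` `[0, 1] = `[T i 0, T i 1]%classic.
Proof.
have [a [b [a0 ab b1 im]]] := gp_image hT i; rewrite im.
have p0 : (T i @` `[0, 1]) (T i 0) by exists 0 => //=; rewrite in_itv/= lexx ler01.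
have p1 : (T i @` `[0, 1]) (T i 1) by exists 1 => //=; rewrite in_itv/= lexx ler01.
have pa : (T i @` `[0, 1]) a by rewrite im /= in_itv/= lexx.
have pb : (T i @` `[0, 1]) b by rewrite im /= in_itv/= lexx andbT.
rewrite im /= in_itv/= in p0; rewrite im /= in_itv/= in p1.
case/andP: p0 => p0 p0'; case/andP: p1 => p1 p1'.
case: pa => x /=; rewrite in_itv/= => /andP[x0 x1] xa.
case: pb => y /=; rewrite in_itv/= => /andP[y0 y1] yb.
have := T_le i (lexx 0) x1 x0; have := T_le i y0 (lexx 1) y1.
rewrite xa yb => h1 h2.
have -> : T i 0 = a by apply/eqP; rewrite eq_le h2.
by have -> : T i 1 = b by apply/eqP; rewrite eq_le p1' h1.
Qed.

Lemma T_continuous i : {within `[0, 1], continuous (T i)}.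
Proof.
apply: segment_inc_surj_continuous.
  move=> x y; rewrite !in_itv/= => /andP[x0 x1] /andP[y0 y1].
  have [xy|yx] := leP x y; first by rewrite T_le.
  by apply/negbTE; rewrite -ltNge T_lt.
by rewrite -T_image; move=> y.
Qed.

Lemma T_mvt i x y : 0 <= x -> y <= 1 -> x < y -> exists2 z, x < z < y &
  T i y - T i x = derive_within `[0, 1] (T i) z * (y - x).
Proof.
move=> x0 y1 xy.
have [||z zxy e] := @MVT R (T i) (derive_within `[0, 1] (T i)) x y xy.
- move=> z; rewrite in_itv/= => /andP[xz zy].
  apply: derive_within_interior; first by apply/andP; split; lra.
  by apply: (gp_C1 hT i).1; rewrite /= in_itv/=; apply/andP; split; lra.
- have sub : `[x, y]%classic `<=` (`[0, 1]%classic : set R).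
    by move=> z /=; rewrite !in_itv/= => /andP[? ?]; apply/andP; split; lra.
  exact: (continuous_subspaceW sub (@T_continuous i)).
by exists z.
Qed.

Lemma T_contraction : exists2 cM, 0 < cM < 1 &
  forall i x y, 0 <= x -> x <= y -> y <= 1 -> T i y - T i x <= cM * (y - x).
Proof.
have [cM [cM01 h]] := gp_contraction hT; exists cM => // i x y x0 xy y1.
move: xy; rewrite le_eqVlt => /orP[/eqP ->|xy]; first by rewrite !subrr mulr0.
have [z /andP[xz zy] ->] := T_mvt i x0 y1 xy.
rewrite ler_pM2r ?subr_gt0// ltW//.
have /andP[_ //] : 0 < derive_within `[0, 1] (T i) z < cM.
by apply: h; apply/andP; split; lra.
Qed.

(** Otherwise the larger of the two left endpoints would lie in both half-open
    images. *)
Lemma T_separated i j : i != j -> T i 1 <= T j 0 \/ T j 1 <= T i 0.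
Proof.
move=> /eqP ij; apply: contrapT => /not_orP[/negP h1 /negP h2].
rewrite -!ltNge in h1 h2.
have pre k y : T k 0 <= y < T k 1 -> (T k @` `[0, 1[) y.
  move=> /andP[y0 y1]; have : (T k @` `[0, 1]) y.
    by rewrite T_image /= in_itv/= y0 ltW.
  move=> [x /=]; rewrite in_itv/= => /andP[x0 x1] xy; exists x => //=.
  rewrite in_itv/= x0 lt_neqAle x1 andbT; apply/eqP => x1'.
  by rewrite -xy x1' ltxx in y1.
have : ((T i @` `[0, 1[) `&` (T j @` `[0, 1[)) (Num.max (T i 0) (T j 0)).
  have ki : T i 0 < T i 1 by apply: T_lt.
  have kj : T j 0 < T j 1 by apply: T_lt.
  by split; apply: pre; rewrite le_max lexx ?orbT/= gt_max ?ki ?kj ?h1 ?h2.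
by rewrite (gp_disjoint hT ij).
Qed.

Lemma letters_exhaust e : 0 < e -> exists2 s : seq I, uniq s &
  1 - e <= \sum_(i <- s) (T i 1 - T i 0).
Proof.
move=> e0; have := gp_full hT.
have meas i : (@lebesgue_measure R) (T i @` `[0, 1[) = (T i 1 - T i 0)%:E.
  have -> : T i @` `[0, 1[ = `[T i 0, T i 1[%classic.
    apply/seteqP; split => y.
      move=> [x /=]; rewrite in_itv/= => /andP[x0 x1] <-.
      by rewrite in_itv/= T_le ?T_lt// ltW.
    rewrite /= in_itv/= => /andP[y0 y1]; have : (T i @` `[0, 1]) y.
      by rewrite T_image /= in_itv/= y0 ltW.
    move=> [x /=]; rewrite in_itv/= => /andP[x0 x1] xy; exists x => //=.
    rewrite in_itv/= x0 lt_neqAle x1 andbT; apply/eqP => x1'.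
    by rewrite -xy x1' ltxx in y1.
  by rewrite lebesgue_measure_itv/= lte_fin T_lt.
under eq_esum do rewrite meas.
move=> full.
have : ((1 - e)%:E < \esum_(i in [set: I]) (T i 1 - T i 0)%:E)%E.
  by rewrite full lte_fin; lra.
move=> /ereal_sup_gt[_ [X [finX _] <-]].
rewrite fsbig_finite// sumEFin lte_fin => /ltW h.
by exists (finmap.enum_fset (fset_set X)); first exact: finmap.fset_uniq.
Qed.

Lemma sum_T_le (f : R -> R) (s : seq I) : uniq s ->
  (forall x y, 0 <= x -> x <= y -> y <= 1 -> f x <= f y) ->
  \sum_(i <- s) (f (T i 1) - f (T i 0)) <= f 1 - f 0.
Proof.
move=> us fm.
have := @sum_increments_le R I (fun i => T i 0) (fun i => T i 1) f s 0 1.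
apply => // [i|i j|i _]; first by rewrite T_le.
  exact: T_separated.
have /andP[-> _] : 0 <= T i 0 <= 1 by apply: T_itv; rewrite lexx ler01.
by have /andP[_ ->] : 0 <= T i 1 <= 1 by apply: T_itv; rewrite lexx ler01.
Qed.

(** The intervals [T_i[0,1]], for [i] in [s], leave out a set of length at most [e],
    on which an [L]-Lipschitz function increases by at most [L * e].  To see it
    without describing that set, bound the increments of the nondecreasing
    function [L * x - f x] from above. *)
Lemma sum_T_ge (f : R -> R) (L e : R) (s : seq I) : uniq s -> 0 <= L ->
  1 - e <= \sum_(i <- s) (T i 1 - T i 0) ->
  (forall x y, 0 <= x -> x <= y -> y <= 1 -> f y - f x <= L * (y - x)) ->
  f 1 - f 0 - L * e <= \sum_(i <- s) (f (T i 1) - f (T i 0)).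
Proof.
move=> us L0 hs fL.
have := @sum_T_le (fun x => L * x - f x) s us.
have -> : \sum_(i <- s) (L * T i 1 - f (T i 1) - (L * T i 0 - f (T i 0))) =
    L * \sum_(i <- s) (T i 1 - T i 0) - \sum_(i <- s) (f (T i 1) - f (T i 0)).
  by rewrite mulr_sumr -sumrB; apply: eq_bigr => i _; ring.
rewrite mulr1 mulr0 sub0r opprK.
move=> h.
have {}h : L * \sum_(i <- s) (T i 1 - T i 0) - \sum_(i <- s) (f (T i 1) - f (T i 0)) <= L - f 1 + f 0.
  by apply: h => x y x0 xy y1; have := fL x y x0 xy y1; lra.
have := ler_wpM2l L0 hs; lra.
Qed.

Lemma word_map_itv w x : 0 <= x <= 1 -> 0 <= word_map w x <= 1.
Proof. by elim: w => //= i w IH /IH; exact: T_itv. Qed.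

Lemma word_map_lt w x y : 0 <= x -> y <= 1 -> x < y -> word_map w x < word_map w y.
Proof.
move=> x0 y1 xy; elim: w => //= i w IH.
have /andP[h0 _] : 0 <= word_map w x <= 1 by apply: word_map_itv; apply/andP; split; lra.
have /andP[_ h1] : 0 <= word_map w y <= 1 by apply: word_map_itv; apply/andP; split; lra.
exact: T_lt.
Qed.

Lemma word_map_le w x y : 0 <= x -> x <= y -> y <= 1 -> word_map w x <= word_map w y.
Proof.
move=> x0; rewrite le_eqVlt => /orP[/eqP -> //|xy] y1.
by rewrite ltW// word_map_lt.
Qed.

Lemma word_map_cat u v x : word_map (u ++ v) x = word_map u (word_map v x).
Proof. by rewrite /compose_word foldr_cat. Qed.

Lemma word_map_rcons w i x : word_map (rcons w i) x = word_map w (T i x).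
Proof. by rewrite -cats1 word_map_cat. Qed.

Lemma word_length_gt0 w : 0 < word_length w.
Proof. by rewrite subr_gt0 word_map_lt. Qed.

Lemma word_length_nil : word_length [::] = 1.
Proof. by rewrite /word_length /= subr0. Qed.

Lemma word_map_contraction : exists2 cM, 0 < cM < 1 &
  forall w x y, 0 <= x -> x <= y -> y <= 1 ->
    word_map w y - word_map w x <= cM ^+ size w * (y - x).
Proof.
have [cM cM01 h] := T_contraction; exists cM => // w x y x0 xy y1.
elim: w => [|i w IH] /=; first by rewrite mul1r.
have /andP[h0 _] : 0 <= word_map w x <= 1 by apply: word_map_itv; apply/andP; split; lra.
have /andP[_ h1] : 0 <= word_map w y <= 1 by apply: word_map_itv; apply/andP; split; lra.
apply: (le_trans (h i _ _ h0 (word_map_le _ x0 xy y1) h1)).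
by rewrite exprS -mulrA ler_pM2l//; case/andP: cM01.
Qed.

Lemma word_map_lip w x y : 0 <= x -> x <= y -> y <= 1 ->
  word_map w y - word_map w x <= 1 * (y - x).
Proof.
have [cM /andP[c0 c1] h] := word_map_contraction => x0 xy y1.
apply: (le_trans (h w x y x0 xy y1)); rewrite ler_wpM2r ?subr_ge0//.
by rewrite exprn_ile1// ltW.
Qed.

Lemma sum_word_map (f : R -> R) (L : R) w (e : R) (s : seq I) : uniq s -> 0 <= L ->
  1 - e <= \sum_(i <- s) (T i 1 - T i 0) ->
  (forall x y, 0 <= x -> x <= y -> y <= 1 ->
     f (word_map w y) - f (word_map w x) <= L * (y - x)) ->
  f (word_map w 1) - f (word_map w 0) - L * e <=
  \sum_(i <- s) (f (word_map (rcons w i) 1) - f (word_map (rcons w i) 0)).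
Proof.
move=> us L0 hs fL; have := sum_T_ge us L0 hs fL.
move=> /le_trans; apply; rewrite le_eqVlt; apply/orP; left; apply/eqP.
by apply: eq_bigr => i _; rewrite !word_map_rcons.
Qed.

Lemma word_length_children w s : uniq s ->
  \sum_(i <- s) word_length (rcons w i) <= word_length w.
Proof.
move=> us; have := @sum_T_le (word_map w) s us (fun x y => @word_map_le w x y).
apply: le_trans; rewrite le_eqVlt; apply/orP; left; apply/eqP.
by apply: eq_bigr => i _; rewrite /word_length !word_map_rcons.
Qed.

Definition clamp (a b x : R) : R := Num.min b (Num.max a x).

Lemma clamp_lip a b x y : a <= b -> x <= y ->
  0 <= clamp a b y - clamp a b x <= y - x.
Proof.
move=> ab xy; rewrite /clamp /Num.min /Num.max.
do 4 case: ifPn; rewrite -?leNgt => *; apply/andP; split; lra.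
Qed.

Lemma clamp_lt a b x y : a <= b -> clamp a b x < clamp a b y -> x < b /\ a < y.
Proof.
move=> ab xy; split; rewrite ltNge; apply/negP => h; move: xy; apply/negP; rewrite -leNgt.
  by rewrite /clamp [leRHS]min_l ?ge_min ?lexx// le_max h orbT.
by rewrite /clamp [X in Num.min b X <= _]max_l// min_r// le_min ab le_max lexx.
Qed.

Lemma clamp_word_lip a b w x y : a <= b -> 0 <= x -> x <= y -> y <= 1 ->
  clamp a b (word_map w y) - clamp a b (word_map w x) <= 1 * (y - x).
Proof.
move=> ab x0 xy y1.
have /andP[_ h] := clamp_lip ab (word_map_le w x0 xy y1).
exact: le_trans h (word_map_lip w x0 xy y1).
Qed.

(** A function [g] which increases only near [z] increases across [T_w[0,1]].  As
    the children fill their parent up to length 0, it increases across one of the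
    children, then across one of the grandchildren, and so on; intervals far
    down the tree are short, so they lie near [z]. *)
Lemma dense_words w z d : word_map w 0 < z < word_map w 1 -> 0 < d ->
  exists v, forall x, 0 <= x <= 1 -> z - d < word_map (w ++ v) x < z + d.
Proof.
move=> /andP[z0 z1] d0.
have [cM /andP[c0 c1] hc] := word_map_contraction.
pose r := d / 3; have r0 : 0 < r by rewrite divr_gt0.
have ab : z - r <= z + r by lra.
pose g := clamp (z - r) (z + r).
pose grows u := g (word_map u 0) < g (word_map u 1).
have gw : grows w.
  rewrite /grows /g /clamp /Num.min /Num.max.
  do 4 case: ifPn; rewrite -?leNgt => *; lra.
have step u : grows u -> exists i, grows (rcons u i).
  move=> gu; apply: contrapT => /forallNP hno.
  pose e := (g (word_map u 1) - g (word_map u 0)) / 2.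
  have e0 : 0 < e by rewrite divr_gt0// subr_gt0.
  have [s us hs] := letters_exhaust e0.
  have := sum_word_map us ler01 hs (fun x y => @clamp_word_lip _ _ u x y ab).
  have : \sum_(i <- s) (g (word_map (rcons u i) 1) - g (word_map (rcons u i) 0)) <= 0.
    by apply: sumr_le0 => i _; have /negP := hno i; rewrite -leNgt subr_le0.
  rewrite -/g; rewrite /e in e0 *; lra.
have [n hn] : exists n, cM ^+ n < r.
  have [n _ hn] := exists_small_pow 1 (introT andP (conj c0 c1)) (divr_gt0 r0 (ltr0n R 2)).
  by exists n; lra.
have [v [sv gv]] : exists v, size v = n /\ grows (w ++ v).
  elim: n {hn} => [|n [v [sv gv]]]; first by exists [::]; rewrite cats0.
  have [i gi] := step _ gv; exists (rcons v i).
  by rewrite size_rcons sv -rcons_cat.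
exists v => x /andP[x0 x1].
have len_small : word_map (w ++ v) 1 - word_map (w ++ v) 0 < r.
  apply: le_lt_trans (hc _ _ _ (lexx 0) ler01 (lexx 1)) _.
  apply: le_lt_trans hn; rewrite subr0 mulr1 size_cat sv exprD.
  by rewrite ler_piMl ?exprn_ge0 ?exprn_ile1// ltW.
have := word_map_le (w ++ v) (lexx 0) x0 x1.
have := word_map_le (w ++ v) x0 x1 (lexx 1).
have [k1 k2] := clamp_lt ab gv.
rewrite /r in len_small k1 k2 => *; apply/andP; split; lra.
Qed.

Lemma word_map_coding (x : shift_space I) n :
  word_map (mkseq x n) 0 <= coding_map T x <= word_map (mkseq x n) 1.
Proof.
pose u k := word_map (mkseq x k) 0.
have z01 : 0 <= (0 : R) <= 1 by rewrite lexx ler01.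
have u1 k : 0 <= u k <= 1 by exact: word_map_itv.
have ndu : nondecreasing_seq u.
  apply/nondecreasing_seqP => k; rewrite /u mkseqS word_map_rcons.
  by have /andP[h0 h1] := T_itv (x k) z01; exact: word_map_le.
have cu : cvgn u.
  apply: nondecreasing_is_cvgn => //; exists 1 => _ [k _ <-].
  by case/andP: (u1 k).
have low m k : word_map (mkseq x (m + k)) 0 <= word_map (mkseq x m) 1.
  have -> : mkseq x (m + k) = mkseq x m ++ [seq x i | i <- iota m k].
    by rewrite /mkseq iotaD map_cat.
  rewrite word_map_cat.
  by have /andP[h0 h1] := word_map_itv [seq x i | i <- iota m k] z01; exact: word_map_le.
apply/andP; split; first exact: (nondecreasing_cvgn_le ndu cu n).
apply: limr_le => //; exists n => // k /= nk.
by rewrite -(subnKC nk) low.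
Qed.

End Geometry.

(** * Bounded distortion of the geometric potential *)

Section Sequences.
Variables (R : realType) (I : pointedType).

Definition pad (w : seq I) : shift_space I := nth point w.

Definition scons (i : I) (x : shift_space I) : shift_space I :=
  fun n => if n is k.+1 then x k else i.

Lemma mkseq_pad (w : seq I) : mkseq (pad w) (size w) = w.
Proof. exact: mkseq_nth. Qed.

Lemma holder_class_bound (rho : R) (gamma : shift_space I -> R) : 0 < rho ->
  holder_class rho gamma ->
  exists2 Cg, 0 <= Cg & forall n (x y : shift_space I), (forall j, (j < n.+1)%N -> x j = y j) ->
    `|gamma x - gamma y| <= Cg * rho ^+ n.+1.
Proof.
move=> rho0 [_ fin]; set s := ereal_sup _ in fin.
have key n x y : (forall j, (j < n.+1)%N -> x j = y j) ->
    ((rho ^- n.+1 * `|gamma x - gamma y|)%:E <= s)%E.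
  move=> xy; apply: (@le_trans _ _ ((rho ^- n.+1)%:E * cylinder_variation n.+1 gamma)%E).
    rewrite EFinM lee_pmul2l// ?lte_fin ?invr_gt0 ?exprn_gt0//.
    by apply: ereal_sup_ubound; exists x, y.
  by apply: ereal_sup_ubound; exists n.+1.
have s0 : (0 <= s)%E.
  apply: le_trans (key 0%N point point _) => //.
  by rewrite subrr normr0 mulr0.
have sf : s \is a fin_num by rewrite ge0_fin_numE.
exists (fine s); first exact: fine_ge0.
move=> n x y /key; rewrite -(fineK sf) lee_fin.
by rewrite ler_pdivrMl ?exprn_gt0// mulrC.
Qed.

End Sequences.

Section Potential.
Variables (R : realType) (I : pointedType) (T : I -> R -> R).
Hypothesis hT : generates_partition T.

Notation gamma := (geometric_potential T).
Notation word_map := (compose_word T).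
Notation len := (word_length T).

Variables (rho Cg : R).
Hypotheses (rho01 : 0 < rho < 1) (Cg0 : 0 <= Cg).
Hypothesis holder : forall n (x y : shift_space I), (forall j, (j < n.+1)%N -> x j = y j) ->
  `|gamma x - gamma y| <= Cg * rho ^+ n.+1.

Let rho_gt0 : 0 < rho. Proof. by case/andP: rho01. Qed.
Let rho_lt1 : rho < 1. Proof. by case/andP: rho01. Qed.

Definition log_slope (i : I) (z : R) : R := ln (derive_within `[0, 1] (T i) z).

Lemma log_slope_continuous i z : 0 < z < 1 -> {for z, continuous (log_slope i)}.
Proof.
move=> /andP[z0 z1]; rewrite /log_slope.
apply: (@continuous_comp _ _ _ (derive_within `[0, 1] (T i)) (@ln R)).
  apply: (@within_continuous_continuous _ _ _ 0 1 _ z ltr01 (gp_C1 hT i).2).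
  by rewrite in_itv/= z0.
apply: continuous_ln.
have [cM [_ h]] := gp_contraction hT.
by have /andP[] : 0 < derive_within `[0, 1] (T i) z < cM by apply: h; rewrite !ltW.
Qed.

(** The coding map need not reach [z], but it reaches points close to [z] inside
    [T_w[0,1]], and the slope is continuous at [z]. *)
Lemma potential_near (x : shift_space I) (w : seq I) z : mkseq (left_shift x) (size w) = w ->
  word_map w 0 < z < word_map w 1 ->
  `|gamma x + log_slope (x 0%N) z| <= Cg * rho ^+ (size w).+1.
Proof.
move=> xw zw.
have z01 : 0 < z < 1.
  have /andP[h0 _] : 0 <= word_map w 0 <= 1 by apply: (word_map_itv hT); rewrite lexx ler01.
  have /andP[_ h1] : 0 <= word_map w 1 <= 1 by apply: (word_map_itv hT); rewrite lexx ler01.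
  by case/andP: zw => ? ?; apply/andP; split; lra.
apply/ler_addgt0Pr => e e0.
have /cvgrPdist_lt/(_ e e0)/nbhs_ballP[d /= d0 hd] := @log_slope_continuous (x 0%N) z z01.
have [v hv] := dense_words hT zw d0.
pose y := pad (w ++ v).
have yz : `|z - coding_map T y| < d.
  have := word_map_coding hT y (size (w ++ v)); rewrite mkseq_pad => /andP[y0 y1].
  have /andP[? ?] : z - d < word_map (w ++ v) 0 < z + d by apply: hv; rewrite lexx ler01.
  have /andP[? ?] : z - d < word_map (w ++ v) 1 < z + d by apply: hv; rewrite lexx ler01.
  by rewrite ltr_norml; apply/andP; split; lra.
have := hd _ yz.
have -> : log_slope (x 0%N) (coding_map T y) = - gamma (scons (x 0%N) y).
  by rewrite /geometric_potential opprK.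
have : `|gamma x - gamma (scons (x 0%N) y)| <= Cg * rho ^+ (size w).+1.
  apply: holder => -[//|k]; rewrite ltnS => kw /=.
  by rewrite /y /pad nth_cat kw -{1}xw nth_mkseq.
move: (gamma x) (gamma _) (log_slope _ _) => g g' l.
rewrite !ler_norml ltr_norml => /andP[? ?] /andP[? ?].
by apply/andP; split; lra.
Qed.

Lemma log_slope_variation i w z z' :
  word_map w 0 < z < word_map w 1 -> word_map w 0 < z' < word_map w 1 ->
  `|log_slope i z - log_slope i z'| <= 2 * Cg * rho ^+ (size w).
Proof.
move=> hz hz'; pose x := scons i (pad w).
have xw : mkseq (left_shift x) (size w) = w by exact: mkseq_pad.
have h1 : `|gamma x + log_slope i z| <= _ := potential_near xw hz.
have h2 : `|gamma x + log_slope i z'| <= _ := potential_near xw hz'.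
have h3 : Cg * rho ^+ (size w).+1 <= Cg * rho ^+ size w.
  by rewrite ler_wpM2l// exprS ler_piMl ?exprn_ge0// ltW.
move: h1 h2; move: (gamma x) (log_slope i z) (log_slope i z') => g l l'.
rewrite !ler_norml => /andP[? ?] /andP[? ?].
by apply/andP; split; lra.
Qed.

(** The logarithmic width of the image of the interval from [x] to [y]. *)
Definition log_width (x y : R) (w : seq I) : R := ln (word_map w y - word_map w x).

Lemma log_width_cons i w x y : 0 <= x -> x < y -> y <= 1 ->
  exists2 z, word_map w 0 < z < word_map w 1 &
  log_width x y (i :: w) - log_width x y w = log_slope i z.
Proof.
move=> x0 xy y1.
have wx : word_map w 0 <= word_map w x by apply: (word_map_le hT) => //; lra.
have wy : word_map w y <= word_map w 1 by apply: (word_map_le hT) => //; lra.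
have wxy : word_map w x < word_map w y by apply: (word_map_lt hT).
have /andP[h0 _] : 0 <= word_map w 0 <= 1 by apply: (word_map_itv hT); rewrite lexx ler01.
have /andP[_ h1] : 0 <= word_map w 1 <= 1 by apply: (word_map_itv hT); rewrite lexx ler01.
have [||//|z /andP[z0 z1] e] := @T_mvt _ _ _ hT i (word_map w x) (word_map w y).
- by lra.
- by lra.
exists z; first by apply/andP; split; lra.
have [cM [_ h]] := gp_contraction hT.
have /andP[dz _] : 0 < derive_within `[0, 1] (T i) z < cM.
  by apply: h; apply/andP; split; lra.
by rewrite /log_width /= e lnM ?posrE ?subr_gt0// addrK.
Qed.

Definition distortionC : R := 2 * Cg / (1 - rho).

Lemma distortionC_ge0 : 0 <= distortionC.
Proof. by rewrite divr_ge0// ?mulr_ge0// subr_ge0 ltW. Qed.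

(** By the mean value theorem each letter of [u] contributes the difference of the
    logarithmic slopes at two points of the image of a word; these images shrink
    as the word grows, and the differences form a geometric series. *)
Lemma log_width_distortion u w x y : 0 <= x -> x < y -> y <= 1 ->
  `|log_width x y (u ++ w) - log_width x y w
    - (log_width 0 1 (u ++ w) - log_width 0 1 w)| <= distortionC * rho ^+ size w.
Proof.
move=> x0 xy y1.
apply: (@le_trans _ _ (distortionC * rho ^+ size w * (1 - rho ^+ size u))); last first.
  have r0 := ltW rho_gt0.
  by rewrite ler_piMr ?gerBl ?exprn_ge0// mulr_ge0 ?distortionC_ge0 ?exprn_ge0.
elim: u => [|i u IH]; first by rewrite !subrr normr0 mulr0.
have [z zw ez] := log_width_cons i (u ++ w) x0 xy y1.
have [z' zw' ez'] := log_width_cons i (u ++ w) (lexx 0) ltr01 (lexx 1).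
have h := log_slope_variation i zw zw'.
have -> : log_width x y ((i :: u) ++ w) - log_width x y w -
    (log_width 0 1 ((i :: u) ++ w) - log_width 0 1 w) =
  (log_slope i z - log_slope i z') +
  (log_width x y (u ++ w) - log_width x y w
    - (log_width 0 1 (u ++ w) - log_width 0 1 w)).
  by rewrite -ez -ez' /=; ring.
apply: (le_trans (ler_normD _ _)); apply: (le_trans (lerD h IH)).
have -> : 2 * Cg = distortionC * (1 - rho) by rewrite /distortionC divfK// gt_eqF// subr_gt0.
rewrite size_cat exprD /= exprS le_eqVlt; apply/orP; left; apply/eqP; ring.
Qed.

Lemma log_width_lnlen w : log_width 0 1 w = ln (len w).
Proof. by []. Qed.

Lemma word_distortion u w v :
  `|ln (len (u ++ w ++ v)) - ln (len (w ++ v)) - (ln (len (u ++ w)) - ln (len w))|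
  <= distortionC * rho ^+ size w.
Proof.
have /andP[h0 _] : 0 <= word_map v 0 <= 1 by apply: (word_map_itv hT); rewrite lexx ler01.
have /andP[_ h1] : 0 <= word_map v 1 <= 1 by apply: (word_map_itv hT); rewrite lexx ler01.
have hv : word_map v 0 < word_map v 1 by exact: (word_map_lt hT).
have := log_width_distortion u w h0 hv h1.
by rewrite /log_width /word_length -!word_map_cat -catA.
Qed.

Lemma word_map_quasi_lip w x y : 0 <= x -> x <= y -> y <= 1 ->
  word_map w y - word_map w x <= expR distortionC * len w * (y - x).
Proof.
move=> x0; rewrite le_eqVlt => /orP[/eqP ->|xy] y1; first by rewrite !subrr mulr0.
have := log_width_distortion w [::] x0 xy y1; rewrite cats0 mulr1.
rewrite ler_norml => /andP[_].
have -> : log_width x y [::] = ln (y - x) by [].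
have -> : log_width 0 1 [::] = 0 by rewrite /log_width /= subr0 ln1.
have wxy : 0 < word_map w y - word_map w x by rewrite subr_gt0 (word_map_lt hT).
have wl := word_length_gt0 hT w.
have yx : 0 < y - x by rewrite subr_gt0.
have el : 0 < expR distortionC * len w by rewrite mulr_gt0 ?expR_gt0.
rewrite log_width_lnlen /log_width => h.
rewrite -ler_ln ?posrE//; last exact: mulr_gt0.
by rewrite lnM ?posrE// lnM ?posrE ?expR_gt0// expRK; lra.
Qed.

(** By bounded distortion the map [T_w] is Lipschitz with a constant comparable to
    [len w], which makes the exhaustion by letters uniform over all words. *)
Lemma words_exhaust e : 0 < e -> exists2 s : seq I, uniq s &
  forall w, (1 - e) * len w <= \sum_(i <- s) len (rcons w i).
Proof.
move=> e0; pose e' := e * expR (- distortionC).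
have e'0 : 0 < e' by rewrite mulr_gt0 ?expR_gt0.
have [s us hs] := letters_exhaust hT e'0; exists s => // w.
have L0 : 0 <= expR distortionC * len w.
  by rewrite mulr_ge0 ?expR_ge0// ltW// (word_length_gt0 hT).
have := sum_word_map hT (f := id) us L0 hs (fun x y => @word_map_quasi_lip w x y).
apply: le_trans; rewrite -/(len w).
have ee : expR distortionC * expR (- distortionC) = 1 by rewrite -expRD subrr expR0.
have -> : expR distortionC * len w * e' = e * len w * (expR distortionC * expR (- distortionC)).
  by rewrite /e'; ring.
by rewrite ee; lra.
Qed.

(** The maps contract when letters are prepended.  When they are appended, a child
    is shorter than its parent by a definite factor because its siblings take
    up a definite proportion of the room, by bounded distortion. *)
Lemma geometric_length_system kappa : 0 < kappa < 1 ->
  (exists S, forall s, uniq s ->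
    \sum_(i <- s) expR (- ((1 - kappa) * gamma (scons i (pad [::])))) <= S) ->
  exists cM, length_system len cM rho distortionC kappa.
Proof.
move=> k01 [S hS].
have [c /andP[c0 c1] hc] := T_contraction hT.
pose p := expR (- distortionC) * ((1 - c) / 2).
have p0 : 0 < p by rewrite mulr_gt0 ?expR_gt0// divr_gt0// subr_gt0.
have p1 : p < 1.
  apply: (@le_lt_trans _ _ ((1 - c) / 2)); last by lra.
  rewrite ler_piMl//; last by rewrite -expR0 ler_expR oppr_le0 distortionC_ge0.
  by rewrite divr_ge0// subr_ge0 ltW.
have near w j : expR (- distortionC) * len w * len [:: j] <= len (rcons w j).
  have := word_distortion w [::] [:: j]; rewrite /= mulr1 cats0 cats1.
  rewrite (word_length_nil T) ln1 subr0 ler_norml => /andP[h _].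
  have lw := word_length_gt0 hT w; have lj := word_length_gt0 hT [:: j].
  have lwj := word_length_gt0 hT (rcons w j).
  rewrite -ler_ln ?posrE ?mulr_gt0 ?expR_gt0//.
  by rewrite lnM ?posrE ?mulr_gt0 ?expR_gt0// lnM ?posrE ?expR_gt0// expRK; lra.
exists (1 - p); split => //.
- by apply/andP; split; lra.
- exact: distortionC_ge0.
- exact: (word_length_gt0 hT).
- exact: word_length_nil.
- move=> w i.
  have e0 : 0 < (1 - c) / 2 by rewrite divr_gt0// subr_gt0.
  have [s us hs] := words_exhaust e0.
  have [s' [us' is' hs']] : exists s', [/\ uniq s', i \in s' &
      (1 + c) / 2 <= \sum_(j <- s') len [:: j]].
    have := hs [::]; rewrite (word_length_nil T) mulr1 => h.
    have [js0|js0] := boolP (i \in s); first by exists s; split => //=; lra.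
    exists (i :: s); split => //=; first by rewrite js0.
      by rewrite inE eqxx.
    rewrite big_cons; have := word_length_gt0 hT [:: i]; rewrite /= in h; lra.
  have := word_length_children hT w us'; rewrite (big_rem i is')/=.
  have li : len [:: i] <= c.
    have := hc i 0 1 (lexx 0) ler01 (lexx 1).
    by rewrite subr0 mulr1.
  have : expR (- distortionC) * len w * \sum_(j <- rem i s') len [:: j]
      <= \sum_(j <- rem i s') len (rcons w j).
    by rewrite mulr_sumr; apply: ler_sum => j _.
  have : (1 - c) / 2 <= \sum_(j <- rem i s') len [:: j].
    by move: hs'; rewrite (big_rem i is')/=; lra.
  have lw : 0 < expR (- distortionC) * len w.
    by rewrite mulr_gt0 ?expR_gt0// (word_length_gt0 hT).
  rewrite -(ler_pM2l lw) => h1 h2 h3.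
  have : p * len w = expR (- distortionC) * len w * ((1 - c) / 2) by rewrite /p; ring.
  lra.
- by move=> w s us; exact: word_length_children.
- exact: words_exhaust.
- exact: word_distortion.
- exists (expR ((1 - kappa) * Cg) * S) => s us.
  apply: le_trans (ler_wpM2l (expR_ge0 _) (hS _ us)).
  rewrite mulr_sumr; apply: ler_sum => i _.
  have l0 := word_length_gt0 hT [:: i].
  rewrite /powR gt_eqF// -expRD ler_expR -mulrN -mulrDr ler_pM2l; last first.
    by case/andP: k01; rewrite subr_gt0.
  have [z zw] := log_width_cons i [::] (lexx 0) ltr01 (lexx 1).
  have -> : log_width 0 1 [::] = 0 by rewrite /log_width /= subr0 ln1.
  rewrite subr0 log_width_lnlen => ->.
  have : `|gamma (scons i (pad [::])) + log_slope i z| <= _ :=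
    @potential_near (scons i (pad [::])) [::] z erefl zw.
  have : Cg * rho ^+ 1 <= Cg by rewrite ler_piMr// ltW.
  move: (gamma _) (log_slope i z) => g l.
  by rewrite ler_norml /= => h /andP[_]; lra.
Qed.

(** By the mean value theorem the increment of the cost is minus the logarithmic
    slope at some point of the image of the shifted word. *)
Lemma potential_cost x n :
  `|gamma x - (cost len (mkseq x n.+1) - cost len (mkseq (left_shift x) n))|
  <= Cg * rho ^+ n.+1.
Proof.
have -> : mkseq x n.+1 = x 0%N :: mkseq (left_shift x) n.
  by rewrite /mkseq /= (iotaDl 1 0 n) -map_comp.
set w := mkseq _ n.
have [z zw e] := log_width_cons (x 0%N) w (lexx 0) ltr01 (lexx 1).
rewrite !log_width_lnlen in e.
have sw : size w = n by rewrite size_mkseq.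
have := @potential_near x w z; rewrite sw => /(_ erefl zw).
by rewrite /cost -e; congr (`|_| <= _); ring.
Qed.

End Potential.

(** * Periods in a closed discrete group force a lattice potential *)

Section HolderFunctions.
Variables (R : realType) (I : pointedType).

(** Adding and subtracting the tail of the geometric series gives monotone
    sequences that enclose the limit. *)
Lemma geometric_limit (u : nat -> R) (r A : R) : 0 < r < 1 ->
  (forall k, `|u k.+1 - u k| <= A * r ^+ k) ->
  exists l, forall k, `|u k - l| <= A / (1 - r) * r ^+ k.
Proof.
move=> /andP[r0 r1] hu; set B := A / (1 - r).
have r1' : 0 < 1 - r by rewrite subr_gt0.
have AB : A = B * (1 - r) by rewrite /B divfK// gt_eqF.
have A0 : 0 <= A by have := hu 0%N; rewrite mulr1; apply: le_trans.
have B0 : 0 <= B by rewrite divr_ge0// ltW.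
pose b k := u k - B * r ^+ k; pose t k := u k + B * r ^+ k.
have rk k : 0 <= B * r ^+ k by rewrite mulr_ge0// exprn_ge0// ltW.
have step k : b k <= b k.+1 /\ t k.+1 <= t k.
  have := hu k; rewrite AB /b /t exprS ler_norml => /andP[? ?]; split; lra.
have ndb : nondecreasing_seq b by apply/nondecreasing_seqP => k; case: (step k).
have nit : nonincreasing_seq t by apply/nonincreasing_seqP => k; case: (step k).
have bt k m : b k <= t m.
  have [km|mk] := leqP k m.
    by apply: le_trans (ndb _ _ km) _; rewrite /b /t; have := rk m; lra.
  by apply: le_trans (nit _ _ (ltnW mk)); rewrite /b /t; have := rk k; lra.
have cb : cvgn b by apply: nondecreasing_is_cvgn => //; exists (t 0%N) => _ [k _ <-].
exists (limn b) => k.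
have h1 : b k <= limn b by exact: nondecreasing_cvgn_le.
have h2 : limn b <= t k by apply: limr_le => //; near=> m; exact: bt.
by rewrite ler_norml; move: h1 h2; rewrite /b /t => ? ?; apply/andP; split; lra.
Unshelve. all: by end_near. Qed.

Lemma nbhs_cylinder (x : shift_space I) n :
  nbhs x [set y : shift_space I | forall j, (j < n)%N -> x j = y j].
Proof.
elim: n => [|n IH]; first by apply: filterS filterT => y _ j.
have cn : nbhs x [set y : shift_space I | x n = y n].
  have := @proj_continuous nat (fun=> discrete_topology I) n x.
  apply; rewrite /nbhs/= /principal_filter/=.
  by apply/principal_filterP.
apply: filterS2 IH cn => y h1 h2 j; rewrite ltnS leq_eqVlt => /orP[/eqP -> //|].
exact: h1.
Qed.

Lemma holder_class_intro (rho A : R) (f : shift_space I -> R) : 0 < rho < 1 ->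
  (forall n (x y : shift_space I), (forall j, (j < n.+1)%N -> x j = y j) ->
     `|f x - f y| <= A * rho ^+ n.+1) ->
  holder_class rho f.
Proof.
move=> rho01 hf; have /andP[r0 r1] := rho01; split.
  move=> x.
  apply: (proj2 (@cvgrPdist_lt R R (shift_space I) (nbhs x) (nbhs_filter x) f (f x))).
  move=> e e0.
  have [p p0 hp] := exists_small_pow A rho01 (divr_gt0 e0 (ltr0n R 2)).
  case: p p0 hp => // n _ hp.
  apply: filterS (nbhs_cylinder x n.+1) => y xy.
  by apply: le_lt_trans (hf _ _ _ xy) _; lra.
apply: (@le_lt_trans _ _ A%:E); last exact: ltry.
apply: ge_ereal_sup => _ [[//|n] _ <-].
have r0n : 0 < rho ^+ n.+1 by rewrite exprn_gt0.
rewrite -[A](mulKf (lt0r_neq0 r0n)) EFinM lee_pmul2l//; last first.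
  by rewrite lte_fin invr_gt0.
apply: ge_ereal_sup => _ [x [y [xy ->]]].
by rewrite lee_fin mulrC; exact: hf.
Qed.

End HolderFunctions.

Section Lattice.
Variables (R : realType) (I : pointedType) (len : seq I -> R).
Variables (cM rho C kappa : R).
Hypothesis hl : length_system len cM rho C kappa.

Notation cost := (cost len).

Let rho01 : 0 < rho < 1 := ls_rho hl.
Let rho_gt0 : 0 < rho. Proof. by case/andP: rho01. Qed.
Let rho_lt1 : rho < 1. Proof. by case/andP: rho01. Qed.
Let C_ge0 : 0 <= C := ls_C hl.

Definition periodK : R := C / (1 - rho).

Lemma periodK_ge0 : 0 <= periodK.
Proof. by rewrite divr_ge0// subr_ge0 ltW. Qed.

(** The error at [k = 1] is exponentially small in the size of [v], so that the
    period of a long word can be read off from its cost. *)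
Lemma word_period_exists v : v != [::] -> exists tau, forall k,
  `|cost (word_pow v k.+1) - cost (word_pow v k) - tau|
  <= periodK * rho ^+ (k * size v).
Proof.
move=> v0; pose r := rho ^+ size v.
have sv : (0 < size v)%N by rewrite lt0n size_eq0.
have r01 : 0 < r < 1.
  by rewrite /r exprn_gt0//= exprn_ilt1 ?ltW// -lt0n.
have r_le : r <= rho by rewrite -[leRHS]expr1 ler_wiXn2l ?ltW.
have /andP[r0 r1] := r01.
have [|l hlim] := @geometric_limit R
    (fun k => cost (word_pow v k.+1) - cost (word_pow v k)) r C r01.
  move=> k; have := cost_distortion hl v (word_pow v k) v.
  by rewrite -!word_powSr -!word_powS size_word_pow mulnC exprM -/r.
exists l => k; apply: le_trans (hlim k) _.
rewrite /r -exprM mulnC ler_wpM2r ?exprn_ge0// ?(ltW rho_gt0)//.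
by rewrite ler_wpM2l// lef_pV2 ?posrE ?subr_gt0// lerD2l lerN2.
Qed.

Variable gamma : shift_space I -> R.
Variable Cg : R.
Hypothesis gamma_holder : holder_class rho gamma.
Hypothesis gamma_cost : forall x n,
  `|gamma x - (cost (mkseq x n.+1) - cost (mkseq (left_shift x) n))|
  <= Cg * rho ^+ n.+1.

Lemma mkseqSl (x : shift_space I) n :
  mkseq x n.+1 = x 0%N :: mkseq (left_shift x) n.
Proof. by rewrite /mkseq /= (iotaDl 1 0 n) -map_comp. Qed.

(** The function [phi] compares the costs of a sequence without and with an
    infinite past made of the letter [point]; [tau] is the cost of one letter of
    this past. *)
Lemma transfer_function : exists tau (phi : shift_space I -> R) B,
  0 <= B /\ forall x n,
  `|phi x - (cost (mkseq x n) - cost (word_pow [:: point] n ++ mkseq x n) + n%:R * tau)|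
  <= B * rho ^+ n.
Proof.
have [tau htau] := @word_period_exists [:: point] isT.
pose A := 2 * C + periodK.
have A0 : 0 <= A by rewrite addr_ge0 ?periodK_ge0// mulr_ge0.
exists tau.
pose psi (x : shift_space I) n :=
  cost (mkseq x n) - cost (word_pow [:: point] n ++ mkseq x n) + n%:R * tau.
have lim x : exists l, forall n, `|psi x n - l| <= A / (1 - rho) * rho ^+ n.
  apply: geometric_limit => // n.
  have h1 := cost_distortion hl (word_pow [:: point] n.+1) (mkseq x n) [:: x n].
  have h2 := cost_distortion hl [:: point] (word_pow [:: point] n) (mkseq x n).
  have h3 := htau n.
  rewrite size_mkseq cats1 -mkseqS in h1.
  rewrite size_word_pow muln1 in h2; rewrite muln1 in h3.
  rewrite catA -word_powS in h2.
  move: h1 h2 h3; rewrite /psi -natr1 /A !ler_norml.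
  by move=> /andP[? ?] /andP[? ?] /andP[? ?]; apply/andP; split; lra.
have [phi hphi] := boolp.choice lim.
exists phi, (A / (1 - rho)); split; first by rewrite divr_ge0// subr_ge0 ltW.
by move=> x n; rewrite distrC; exact: hphi.
Qed.

(** Subtracting the coboundary of the transfer function from the potential leaves
    the cost of inserting [x_1] after the infinite past.  This
    is the limit of the differences between the periods of the words
    [i x_1 x_2 ... x_n] and [i x_2 ... x_n], where [i] is a long stretch of the
    past, and a closed group which contains the periods contains it. *)
Lemma lattice_of_periods : lattice_periods len rho -> lattice_potential gamma.
Proof.
move=> [D [dD cD perD]]; have [tau [phi [B [B0 hphi]]]] := transfer_function.
pose psi (x : shift_space I) n :=
  cost (mkseq x n) - cost (word_pow [:: point] n ++ mkseq x n) + n%:R * tau.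
have phi_var n (x y : shift_space I) : (forall j, (j < n)%N -> x j = y j) ->
    `|phi x - phi y| <= 2 * B * rho ^+ n.
  move=> xy; have e : mkseq x n = mkseq y n.
    by apply/eq_in_map => j; rewrite mem_iota add0n => /andP[_ /xy].
  have := hphi x n; have := hphi y n; rewrite e !ler_norml.
  by move=> /andP[? ?] /andP[? ?]; apply/andP; split; lra.
have phi_bound x : `|phi x| <= B.
  have := hphi x 0%N; rewrite /= mul0r mulr1 /mkseq /= (cost_nil hl).
  by rewrite subrr addr0 subr0.
pose zeta x := gamma x - (phi x - phi (left_shift x)).
have [Cv Cv0 hCv] := holder_class_bound rho_gt0 gamma_holder.
exists rho, zeta, D; split => //.
  split => //; last first.
    exists phi; split; last by move=> x; rewrite /zeta; ring.
    split; last by exists B.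
    by apply: (@holder_class_intro _ _ _ (2 * B)) => // n x y; exact: phi_var.
  apply: (@holder_class_intro _ _ _ (Cv + 2 * B + 2 * B / rho)) => // n x y xy.
  have h1 := hCv n x y xy; have h2 := phi_var n.+1 x y xy.
  have h3 : `|phi (left_shift x) - phi (left_shift y)| <= 2 * B * rho ^+ n.
    by apply: phi_var => j jn; exact: xy.
  have e : 2 * B / rho * rho ^+ n.+1 = 2 * B * rho ^+ n.
    by rewrite exprS mulrA divfK// gt_eqF.
  rewrite mulrDl mulrDl e /zeta.
  move: (gamma x) (gamma y) h1 => g g'; move: h2 h3; rewrite !ler_norml.
  by move=> /andP[? ?] /andP[? ?] /andP[? ?]; apply/andP; split; lra.
move=> x; apply: cD => V /nbhs_ballP[d /= d0 dV].
pose A := Cg * rho + 2 * B + C + 2 * periodK + 4 * C.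
have [n n0 hn] := exists_small_pow A rho01 (divr_gt0 d0 (ltr0n R 2)).
pose i := word_pow [:: @point I] n.
pose w := mkseq (left_shift x) n.
pose v := i ++ x 0%N :: w; pose v' := i ++ w.
have si : size i = n by rewrite /i size_word_pow muln1.
have sw : size w = n by rewrite /w size_mkseq.
have v0 : v != [::] by rewrite /v /i; case: (n) n0.
have v'0 : v' != [::] by rewrite /v' /i; case: (n) n0.
have [t1 ht1] := word_period_exists v0.
have [t2 ht2] := word_period_exists v'0.
have rho_pow u k : (k <= size u)%N -> rho ^+ size u <= rho ^+ k.
  by move=> ku; rewrite ler_wiXn2l ?ltW.
have period_word (u : seq I) t (u0 : u != [::]) : (forall k,
  `|cost (word_pow u k.+1) - cost (word_pow u k) - t| <= periodK * rho ^+ (k * size u)) ->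
  D t.
  move=> ht; apply: (perD u) => //; exists periodK => k; apply: le_trans (ht k) _.
  rewrite ler_wpM2l ?periodK_ge0// ler_wiXn2l ?ltW//.
  by rewrite leq_pmulr// lt0n size_eq0.
have Dt1 := period_word _ _ v0 ht1; have Dt2 := period_word _ _ v'0 ht2.
have [D0 DB _] := dD.
exists (t1 - t2); split; first exact: DB.
apply: dV; rewrite /ball/=.
have near u t (u0 : u = i ++ drop n u) : (n <= size u)%N -> (forall k,
    `|cost (word_pow u k.+1) - cost (word_pow u k) - t| <= periodK * rho ^+ (k * size u)) ->
    `|cost (u ++ i) - cost i - t| <= (periodK + C) * rho ^+ n.
  move=> nu ht; have h1 := ht 1%N; rewrite mul1n /word_pow /= cats0 in h1.
  have h2 := cost_distortion hl u i (drop n u); rewrite -u0 si in h2.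
  have h3 : periodK * rho ^+ size u <= periodK * rho ^+ n.
    by rewrite ler_wpM2l ?periodK_ge0// rho_pow.
  move: h1 h2; rewrite !ler_norml => /andP[? ?] /andP[? ?].
  by apply/andP; split; lra.
have sv : (n <= size v)%N by rewrite /v size_cat si leq_addr.
have sv' : (n <= size v')%N by rewrite /v' size_cat si leq_addr.
have dv : v = i ++ drop n v by rewrite /v drop_size_cat.
have dv' : v' = i ++ drop n v' by rewrite /v' drop_size_cat.
have k1 := near v t1 dv sv ht1.
have k2 := near v' t2 dv' sv' ht2.
have k3 := cost_distortion hl (rcons i (x 0%N)) w i.
have k4 := cost_distortion hl i w i.
rewrite !cat_rcons -cat_cons catA -/v in k3; rewrite catA -/v' in k4.
have k5 := gamma_cost x n; rewrite mkseqSl -/w in k5.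
have k6 := hphi x n; have k7 := hphi (left_shift x) n.
rewrite -/w -/i -/v' in k7; rewrite -/i in k6.
have k8 := cost_distortion hl i (mkseq x n) [:: x n].
rewrite cats1 -mkseqS mkseqSl -/w -/v in k8.
rewrite sw in k3 k4; rewrite size_mkseq in k8.
have k9 : Cg * rho ^+ n.+1 = Cg * rho * rho ^+ n by rewrite exprS mulrA.
rewrite k9 in k5.
apply: (@le_lt_trans _ _ (A * rho ^+ n)); last by lra.
rewrite /zeta /A.
move: (gamma x) k5 => g.
move: k1 k2 k3 k4 k6 k7 k8; rewrite !ler_norml.
move=> /andP[? ?] /andP[? ?] /andP[? ?] /andP[? ?] /andP[? ?] /andP[? ?] /andP[? ?] /andP[? ?].
by apply/andP; split; lra.
Qed.

End Lattice.

(** * The intervals split by the substitution scheme *)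

Section Scheme.
Variables (R : realType) (I : pointedType) (T : I -> R -> R).
Hypothesis hT : generates_partition T.
Variables (cM rho C kappa : R).
Hypothesis hl : length_system (word_length T) cM rho C kappa.

Notation len := (word_length T).
Notation cost := (cost (word_length T)).
Notation word_map := (compose_word T).

Lemma word_intervalE w :
  word_interval T w = `[word_map w 0, word_map w 1]%classic.
Proof.
rewrite /word_interval; elim: w => [|i w IH].
  by apply/seteqP; split => [x [y /= hy <-]|x hx] //; exists x.
apply/seteqP; split => y.
  move=> [x /=]; rewrite in_itv/= => /andP[x0 x1] <-.
  by rewrite in_itv/=; apply/andP; split; apply: (word_map_le hT (i :: w)).
rewrite /= in_itv/= => /andP[y0 y1].
have /andP[a0 a1] : 0 <= word_map w 0 <= 1 by apply: (word_map_itv hT); rewrite lexx ler01.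
have /andP[b0 b1] : 0 <= word_map w 1 <= 1 by apply: (word_map_itv hT); rewrite lexx ler01.
have : (T i @` `[0, 1]) y.
  rewrite (T_image hT) /= in_itv/=; apply/andP; split.
    by apply: le_trans y0; apply: (T_le hT).
  by apply: (le_trans y1); apply: (T_le hT).
move=> [x /=]; rewrite in_itv/= => /andP[x0 x1] xy.
have : [set word_map w z | z in `[0, 1]] x.
  rewrite IH /= in_itv/=; apply/andP; split; rewrite leNgt; apply/negP => h.
    by have := T_lt hT i x0 a1 h; rewrite ltNge xy y0.
  by have := T_lt hT i b0 x1 h; rewrite ltNge xy y1.
by move=> [z hz zx]; exists z => //; rewrite -xy -zx.
Qed.

Lemma measure_word_interval w :
  (@lebesgue_measure R) (word_interval T w) = (len w)%:E.
Proof.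
by rewrite word_intervalE lebesgue_measure_itv/= lte_fin (word_map_lt hT).
Qed.

Lemma cost_len_le u w : (len u <= len w) = (cost w <= cost u).
Proof.
by rewrite /cost lerN2 ler_ln ?posrE ?(word_length_gt0 hT).
Qed.

Lemma cost_word_interval u w : word_interval T u = word_interval T w ->
  cost u = cost w.
Proof.
move=> uw; have : (len u)%:E = (len w)%:E by rewrite -!measure_word_interval uw.
by move=> [e]; rewrite /cost e.
Qed.

Lemma cost_rcons_gt w i : cost w < cost (rcons w i).
Proof.
have [cM0 cM1] := andP (ls_cM hl).
have w0 := word_length_gt0 hT w.
rewrite /cost ltrN2 ltr_ln ?posrE ?(word_length_gt0 hT)//.
by apply: le_lt_trans (ls_rcons hl w i) _; rewrite gtr_pMl.
Qed.

Lemma cost_ge0 w : 0 <= cost w.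
Proof.
elim/last_ind: w => [|w i IH]; first by rewrite (cost_nil hl).
by apply: le_trans IH _; rewrite ltW// cost_rcons_gt.
Qed.

Lemma count_words_le (s : seq (seq I)) t : uniq s ->
  (forall w, w \in s -> cost w <= t) -> (size s)%:R <= countK cM * expR t.
Proof.
move=> us hs.
have bF := below_hard len (fun=> true) (expR t).
have := subtree_esum_le hl (expR_gt0 t) bF [::].
rewrite (word_length_nil T) mulr1 /subtree_esum => h.
have f0 (v : seq I) : 0 <= hard_count len (fun=> true) (expR t) v.
  by have [/andP[]] := bF v.
apply: le_trans (sum_le_of_esum f0 us h).
rewrite -sum1_size natr_sum big_seq [leRHS]big_seq ler_sum// => w /hs wt.
by rewrite /hard_count (len_expR_ge1 hl) subr_ge0 wt.
Qed.

(** Their number is bounded by the linear upper bound on counts. *)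
Lemma finite_words t : finite_set [set w | cost w <= t].
Proof.
apply: contrapT => inf.
have [B BA hB] := infinite_set_fset (Num.bound (countK cM * expR t)) inf.
have Bu : uniq (finmap.enum_fset B) by exact: finmap.fset_uniq.
have := count_words_le Bu (fun w wB => BA w wB); apply/negP; rewrite -ltNge.
apply: (@lt_le_trans _ _ (Num.bound (countK cM * expR t))%:R).
  apply: archi_boundP; rewrite mulr_ge0 ?expR_ge0// ltW//.
  exact: (countK_gt0 hl).
by rewrite ler_nat.
Qed.

Lemma exists_min_on (S : eqType) (f : S -> R) (s : seq S) (P : S -> Prop) :
  (exists2 x, x \in s & P x) ->
  exists x, P x /\ forall y, y \in s -> P y -> f x <= f y.
Proof.
elim: s => [|a s IH] [x]; first by rewrite in_nil.
have [[y ys Py] _ _|hno] := pselect (exists2 y, y \in s & P y).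
  have [z [Pz hz]] := IH (ex_intro2 _ _ y ys Py).
  have [Pa|nPa] := pselect (P a); last first.
    by exists z; split => // u; rewrite inE => /orP[/eqP -> //|]; exact: hz.
  have [az|za] := leP (f a) (f z).
    exists a; split => // u; rewrite inE => /orP[/eqP -> //|us Pu].
    exact: le_trans az (hz _ us Pu).
  exists z; split => // u; rewrite inE => /orP[/eqP -> _|]; [exact: ltW|exact: hz].
rewrite inE => /orP[/eqP -> Pa|xs Px]; last by case: hno; exists x.
exists a; split => // u; rewrite inE => /orP[/eqP -> //|us Pu].
by case: hno; exists u.
Qed.

Definition next_cost (t t' : R) : Prop :=
  [/\ exists w, cost w = t', t < t' & forall w, t < cost w -> t' <= cost w].

(** The set of costs is unbounded, but finite below each bound. *)
Lemma next_cost_exists t : exists t', next_cost t t'.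
Proof.
have [n hn] : exists n : nat, countK cM * expR t < n%:R.
  exists (Num.bound (countK cM * expR t)); apply: archi_boundP.
  by rewrite mulr_ge0 ?expR_ge0// ltW// (countK_gt0 hl).
have [w0 w0t] : exists w, t < cost w.
  apply: contrapT => /forallNP h.
  pose s := [seq nseq k (@point I) | k <- iota 0 n].
  have us : uniq s.
    rewrite map_inj_uniq ?iota_uniq// => a b ab.
    by rewrite -(size_nseq a (@point I)) ab size_nseq.
  have : (size s)%:R <= countK cM * expR t.
    by apply: count_words_le => // w _; rewrite leNgt; apply/negP.
  by rewrite size_map size_iota leNgt hn.
have fin := finite_words (cost w0).
have w0in : w0 \in finmap.enum_fset (fset_set [set w | cost w <= cost w0]).
  by rewrite in_fset_set// inE /=.
have [w [tw hw]] := @exists_min_on _ cost _ (fun w => t < cost w)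
  (ex_intro2 _ _ w0 w0in w0t).
exists (cost w); split => //; first by exists w.
move=> u tu; have [uw0|/ltW uw0] := leP (cost u) (cost w0).
  by apply: hw => //; rewrite in_fset_set// inE.
by apply: le_trans uw0; exact: hw.
Qed.

(** The state of the scheme when its longest intervals have cost [t]. *)
Definition stage (t : R) : set (set R) := [set A | exists w,
  [/\ A = word_interval T w, t <= cost w &
      forall u i, w = rcons u i -> cost u < t]].

Lemma stage_cost t w : cost w = t -> stage t (word_interval T w).
Proof.
move=> wt; exists w; split => //; first by rewrite wt.
by move=> u i e; rewrite -wt e cost_rcons_gt.
Qed.

Lemma maximal_stage t w : (exists w0, cost w0 = t) ->
  of_maximal_length (stage t) (word_interval T w) <-> cost w = t.
Proof.
move=> [w0 w0t]; split.
  move=> [[u [wu tu _]] hmax]; apply/eqP; rewrite eq_le.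
  rewrite {2}(cost_word_interval wu) tu andbT -w0t -cost_len_le.
  by rewrite -lee_fin -!measure_word_interval; apply: hmax; exact: stage_cost.
move=> wt; split; first exact: stage_cost.
move=> B [u [-> tu _]]; rewrite !measure_word_interval lee_fin cost_len_le.
by rewrite wt.
Qed.

(** The children of the longest intervals have costs at least [t'], and the words
    whose parent costs less than [t'] but at least [t] are exactly these. *)
Lemma split_stage t t' : (exists w, cost w = t) -> next_cost t t' ->
  split_step T (stage t) = stage t'.
Proof.
move=> att [_ tt' next]; have maxP := fun w => maximal_stage w att.
have [w0 w0t] := att; have t0 : 0 <= t by rewrite -w0t cost_ge0.
apply/seteqP; split => A.
  move=> [[[w [-> tw par]] nmax]|[u [i [umax ->]]]].
    have wt : t < cost w.
      by rewrite lt_neqAle tw andbT; apply/eqP => e; apply: nmax; apply/maxP.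
    exists w; split => //; first exact: next.
    by move=> u i /par h; exact: lt_trans h tt'.
  have ut : cost u = t by apply/maxP.
  exists (rcons u i); split => //.
    by apply: next; rewrite -ut cost_rcons_gt.
  by move=> u' i' /rcons_inj[<- _]; rewrite ut.
move=> [w [-> tw par]]; case/lastP: w tw par => [|u i] tw par.
  by move: tw; rewrite (cost_nil hl) => tw; exfalso; lra.
have ut : cost u <= t.
  by rewrite leNgt; apply/negP => /next; rewrite leNgt (par _ _ erefl).
move: ut; rewrite le_eqVlt => /orP[/eqP ut|ut].
  by right; exists u, i; split => //; apply/maxP.
left; split.
  exists (rcons u i); split => //; first by apply: le_trans tw; exact: ltW.
  by move=> u' i' /rcons_inj[<- _].
by move=> /maxP e; move: tw; rewrite e leNgt tt'.
Qed.

(** An interval is removed at the time when the threshold equals its cost, so the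
    intervals split up to time [n] are those of cost at most [tt n]. *)
Lemma split_left_endpointsE : exists tt : nat -> R,
  (forall n, split_left_endpoints T n =
     [set x | exists w, cost w <= tt n /\ x = word_map w 0]) /\
  (forall Z, exists n0, forall n, (n0 <= n)%N -> Z <= tt n).
Proof.
have [f hf] := boolp.choice next_cost_exists.
pose tt n := iter n f 0.
have att n : exists w, cost w = tt n.
  by case: n => [|n]; [exists [::]; exact: (cost_nil hl)|case: (hf (tt n))].
have tt_lt n : tt n < tt n.+1 by case: (hf (tt n)).
have tt_next n w : tt n < cost w -> tt n.+1 <= cost w by case: (hf (tt n)) => _ _; apply.
have tt_mono : {homo tt : m n / (m <= n)%N >-> m <= n}.
  by apply: homo_leq => // [x y z|n]; [exact: le_trans|exact: ltW].
have stageE n : substitution_partition T n = stage (tt n).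
  elim: n => [|n IH]; last first.
    by rewrite /substitution_partition iterS -/(substitution_partition T n) IH; apply: split_stage.
  apply/seteqP; split => A.
    move=> /= ->; exists [::]; split.
    - by rewrite word_intervalE.
    - by rewrite (cost_nil hl).
    - by move=> [].
  move=> [w [-> _ par]]; case/lastP: w par => [_|u i par]; first by rewrite /= word_intervalE.
  by have := par _ _ erefl; rewrite ltNge cost_ge0.
exists tt; split.
  move=> n; apply/seteqP; split => x.
    move=> [k [A [kn [Ak nAk] Ax Al]]]; rewrite stageE in Ak.
    have [w [Aw tw _]] := Ak.
    have wk : cost w = tt k.
      apply/(maximal_stage w (att k)); rewrite -Aw; apply: contrapT => nmax.
      by apply: nAk; left; rewrite -/(substitution_partition T k) stageE.
    exists w; split; first by rewrite wk tt_mono.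
    rewrite Aw word_intervalE /= in_itv/= in Ax.
    apply/eqP; rewrite eq_le; case/andP: Ax => -> _; rewrite andbT.
    apply: Al; rewrite Aw word_intervalE /= in_itv/= lexx.
    exact: (word_map_le hT).
  move=> [w [wn ->]].
  have [k kn wk] : exists2 k, (k <= n)%N & cost w = tt k.
    elim: n wn => [|n IH].
      by move=> h; exists 0%N => //; apply/eqP; rewrite eq_le h cost_ge0.
    have [/IH[k kn wk] _|/tt_next h1 h2] := leP (cost w) (tt n).
      by exists k => //; exact: leqW.
    by exists n.+1 => //; apply/eqP; rewrite eq_le h1 h2.
  exists k, (word_interval T w); split => //.
  - split; rewrite !stageE; first exact: stage_cost.
    move=> [u [/cost_word_interval e tu _]].
    by move: tu; rewrite -e wk leNgt tt_lt.
  - by rewrite word_intervalE /= in_itv/= lexx; exact: (word_map_le hT).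
  - by move=> y; rewrite word_intervalE /= in_itv/= => /andP[].
move=> Z; have [n hn] : exists n : nat, countK cM * expR Z < n%:R.
  exists (Num.bound (countK cM * expR Z)); apply: archi_boundP.
  by rewrite mulr_ge0 ?expR_ge0// ltW// (countK_gt0 hl).
exists n => m nm; rewrite leNgt; apply/negP => mZ.
have [g hg] := boolp.choice att.
pose s := [seq g k | k <- iota 0 n].
have us : uniq s.
  rewrite map_inj_uniq ?iota_uniq// => a b ab.
  have e : tt a = tt b by rewrite -!hg ab.
  have tt_smono : {homo tt : m n / (m < n)%N >-> m < n}.
    by apply: homo_ltn => // x y z; exact: lt_trans.
  by case: (ltngtP a b) => // /tt_smono; rewrite e ltxx.
have : (size s)%:R <= countK cM * expR Z.
  apply: count_words_le => // w /mapP[k]; rewrite mem_iota add0n => /andP[_ kn] ->.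
  rewrite hg; apply: le_trans (ltW mZ); apply: tt_mono.
  exact: leq_trans (ltnW kn) nm.
by rewrite size_map size_iota leNgt hn.
Qed.

End Scheme.

(** * Left endpoints in an interval *)

Lemma interval_measurable (R : realType) (J : set R) :
  is_interval J -> measurable J.
Proof. by move/is_intervalP => ->; exact: measurable_itv. Qed.

Section Endpoints.
Variables (R : realType) (I : pointedType) (T : I -> R -> R).
Hypothesis hT : generates_partition T.
Variables (cM rho C kappa : R).
Hypothesis hl : length_system (word_length T) cM rho C kappa.

Notation len := (word_length T).
Notation cost := (cost (word_length T)).
Notation word_map := (compose_word T).

(** Since [T_(rcons w i) 0 = T_w 0] when [T_i 0 = 0], each left endpoint has a
    representative word which does not end in such a letter. *)
Definition reduced (w : seq I) : bool :=
  (w == [::]) || (T (last point w) 0 != 0).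

Lemma reduced_cat u w : w != [::] -> reduced (u ++ w) = reduced w.
Proof.
rewrite /reduced last_cat; case: w => // i w _.
by rewrite -size_eq0 size_cat addnS.
Qed.

(** At most one image can start at 0, and one contraction does not fill [0, 1]. *)
Lemma exists_reduced_letter : exists j, reduced [:: j].
Proof.
apply: contrapT => /forallNP hno.
have T0 i : T i 0 = 0.
  by apply/eqP/negPn/negP => h; apply: (hno i); rewrite /reduced /= h.
have same (i j : I) : i = j.
  apply: contrapT => ij; have [|] := T_separated hT (introN eqP ij).
    by rewrite T0 leNgt -(T0 i) (T_lt hT).
  by rewrite T0 leNgt -(T0 j) (T_lt hT).
have [c /andP[c0 c1] hc] := T_contraction hT.
have e0 : 0 < (1 - c) / 2 by rewrite divr_gt0// subr_gt0.
have [s us hs] := letters_exhaust hT e0.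
have hi i : T i 1 - T i 0 <= c.
  by have := hc i 0 1 (lexx 0) ler01 (lexx 1); rewrite subr0 mulr1.
case: s us hs => [|i [|j s]] us; rewrite ?big_nil ?big_seq1.
- by move=> ?; lra.
- by move: (hi i) => ? ?; lra.
by move: us; rewrite (same i j) /= inE eqxx.
Qed.

Lemma word_map0_lt1 w : 0 <= word_map w 0 < 1.
Proof.
have /andP[-> _] : 0 <= word_map w 0 <= 1 by apply: (word_map_itv hT); rewrite lexx ler01.
apply: lt_le_trans (word_map_lt hT w (lexx 0) (lexx 1) ltr01) _.
by have /andP[_ ->] : 0 <= word_map w 1 <= 1 by apply: (word_map_itv hT); rewrite ler01 lexx.
Qed.

(** All letters of a word with [T_w 0 = 0] fix 0, the last one included. *)
Lemma reduced_root w : reduced w -> word_map w 0 = 0 -> w = [::].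
Proof.
elim: w => //= i w IH; have /andP[w0 w1] := word_map0_lt1 w.
have Ti : 0 <= T i 0 by have /andP[] : 0 <= T i 0 <= 1 by apply: (T_itv hT); rewrite lexx ler01.
move=> red Tw; have e : word_map w 0 = 0.
  apply/eqP; rewrite eq_le w0 andbT leNgt; apply/negP => h.
  by have := T_lt hT i (lexx 0) (ltW w1) h; rewrite Tw ltNge Ti.
have Ti0 : T i 0 = 0 by rewrite -[in LHS]e.
case: w red e IH {w0 w1 Tw} => [|j w] red e IH; first by move: red; rewrite /reduced /= Ti0 eqxx.
by move: red; rewrite -cat1s reduced_cat// => red; have := IH red e.
Qed.

Lemma reduced_inj u w : reduced u -> reduced w ->
  word_map u 0 = word_map w 0 -> u = w.
Proof.
elim: u w => [|i u IH] w ru rw uw; first by rewrite (reduced_root rw).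
case: w rw uw => [|j w] rw uw; first by rewrite (reduced_root ru).
have /andP[u0 u1] := word_map0_lt1 u; have /andP[w0 w1] := word_map0_lt1 w.
have ij : i = j.
  apply: contrapT => ij.
  have : ((T i @` `[0, 1[) `&` (T j @` `[0, 1[)) (word_map (i :: u) 0).
    split; first by exists (word_map u 0) => //=; rewrite in_itv/= u0.
    by rewrite uw; exists (word_map w 0) => //=; rewrite in_itv/= w0.
  by rewrite (gp_disjoint hT ij).
subst j; have e : word_map u 0 = word_map w 0.
  move: uw => /= uw; case: (ltgtP (word_map u 0) (word_map w 0)) => // h.
    by have := T_lt hT i u0 (ltW w1) h; rewrite uw ltxx.
  by have := T_lt hT i w0 (ltW u1) h; rewrite uw ltxx.
have tail v : reduced (i :: v) -> reduced v.
  by case: v => // k v; rewrite -cat1s reduced_cat.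
by rewrite (IH w (tail _ ru) (tail _ rw) e).
Qed.

Lemma reduce w : exists2 u, reduced u & cost u <= cost w /\ word_map u 0 = word_map w 0.
Proof.
elim/last_ind: w => [|w i [u ru [uw e]]]; first by exists [::].
have [Ti|Ti] := eqVneq (T i 0) 0; last first.
  by exists (rcons w i) => //; rewrite /reduced last_rcons Ti orbT.
exists u => //; rewrite (word_map_rcons T) Ti; split => //.
by apply: le_trans uw _; rewrite ltW// (cost_rcons_gt hT hl).
Qed.

Definition endpoints_below (t : R) : set R :=
  [set x | exists w, cost w <= t /\ x = word_map w 0].

Definition reduced_below (t : R) : set (seq I) :=
  [set w | reduced w /\ cost w <= t].

Lemma endpoints_below_image t :
  endpoints_below t = (fun w => word_map w 0) @` reduced_below t.
Proof.
apply/seteqP; split => x.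
  move=> [w [wt ->]]; have [u ru [uw e]] := reduce w.
  by exists u => //; split => //; exact: le_trans wt.
by move=> [w [_ wt] <-]; exists w.
Qed.

Definition count_in (A : set R) (t : R) (w : seq I) : R :=
  hard_count len reduced (expR t) w * (word_map w 0 \in A)%:R.

Lemma hard_countE t w :
  hard_count len reduced (expR t) w = (reduced w && (cost w <= t))%:R.
Proof. by rewrite /hard_count (len_expR_ge1 hl) subr_ge0. Qed.

Lemma below_count_in A t : below len (expR t) (count_in A t).
Proof.
move=> w; have [/andP[h0 h1] h] := below_hard len reduced (expR t) w.
rewrite /count_in; split; last by move=> /h ->; rewrite mul0r.
by case: (_ \in _); rewrite ?mulr1 ?mulr0 ?h0 ?lexx ?ler01.
Qed.

Lemma sum_dirac A t : \sum_(x \in endpoints_below t) (\d_x A : \bar R) =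
  (subtree_sum (count_in A t) [::])%:E.
Proof.
have fin : finite_set (endpoints_below t).
  rewrite endpoints_below_image; apply: finite_image.
  by apply: (sub_finite_set _ (finite_words hl t)) => w [].
rewrite -(subtree_esumE hl (expR_gt0 t) (below_count_in A t)).
rewrite -esum_fset//.
rewrite endpoints_below_image esum_image; last first.
  by move=> u w /set_mem[ru _] /set_mem[rw _]; exact: reduced_inj.
rewrite esum_mkcond /subtree_esum; apply: eq_esum => w _ /=.
rewrite /count_in hard_countE diracE.
have [wt|wt] := boolP (reduced w && (cost w <= t)).
  by rewrite mul1r ifT// inE; case/andP: wt.
by rewrite mul0r ifF//; apply/negP; rewrite inE => -[rw wt']; rewrite rw wt' in wt.
Qed.

Lemma card_endpoints t :
  (#|` fset_set (endpoints_below t)|%:R : R) =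
  subtree_sum (hard_count len reduced (expR t)) [::].
Proof.
have fin : finite_set (endpoints_below t).
  rewrite endpoints_below_image; apply: finite_image.
  by apply: (sub_finite_set _ (finite_words hl t)) => w [].
have := sum_dirac setT t.
have -> : count_in setT t = hard_count len reduced (expR t).
  by apply: funext => w; rewrite /count_in in_setT mulr1.
move=> h; apply: EFin_inj; rewrite -h fsbig_finite//=.
under eq_bigr do rewrite diracE in_setT.
by rewrite sumEFin -natr_sum sum1_size.
Qed.

(** Used with an interval and the two open intervals of its complement: lower
    bounds for the latter give an upper bound for the former. *)
Lemma le_count_in A1 A2 A3 t a :
  (forall x, (x \in A1)%:R + (x \in A2)%:R + (x \in A3)%:R <= 1 :> R) ->
  subtree_sum (count_in A1 t) a + subtree_sum (count_in A2 t) a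
    + subtree_sum (count_in A3 t) a
  <= subtree_sum (hard_count len reduced (expR t)) a.
Proof.
move=> sumA; have e0 := expR_gt0 t.
have bF := below_hard len reduced (expR t).
have ge0 D w : (0 <= (count_in D t w)%:E)%E.
  by rewrite lee_fin; have [/andP[]] := below_count_in D t w.
rewrite -lee_fin !EFinD -!(subtree_esumE hl e0 (below_count_in _ t)).
rewrite -(subtree_esumE hl e0 bF) /subtree_esum -!esumD//; last first.
  by move=> w _; exact: adde_ge0.
apply: le_esum => w _; rewrite -!EFinD lee_fin /count_in -!mulrDr.
by rewrite ler_piMr//; have [/andP[]] := bF (a ++ w).
Qed.

Hypothesis not_lattice : ~ lattice_periods len rho.

(** Descend [n] levels in the tree, to intervals shorter than [c].  A function [g]
    which increases with slope 1 between [al + c] and [be - c] and is constant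
    elsewhere increases at most by [len a] across a word [a] of that level, and
    only if [T_a[0,1]] lies between [al] and [be]; equidistribution of words then
    bounds the count below [a].  The sum of all increments is [be - al - 2 * c]. *)
Lemma count_open_interval al be e : 0 <= al -> al <= be -> be <= 1 -> 0 < e ->
  exists t0, forall t, t0 <= t ->
  (be - al - e) * subtree_sum (hard_count len reduced (expR t)) [::] <=
  subtree_sum (count_in `]al, be[ t) [::].
Proof.
move=> al0 albe be1 e0.
have N0 t : 0 <= subtree_sum (hard_count len reduced (expR t)) [::].
  exact: (subtree_sum_ge0 hl (expR_gt0 t) (below_hard _ _ _)).
have NG0 t a : 0 <= subtree_sum (count_in `]al, be[ t) a.
  exact: (subtree_sum_ge0 hl (expR_gt0 t) (below_count_in _ t)).
have [small|large] := leP (be - al - e) 0.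
  exists 0 => t _; apply: le_trans (NG0 t [::]).
  by rewrite mulr_le0_ge0.
pose c := e / 4; have c0 : 0 < c by rewrite divr_gt0.
have ab : al + c <= be - c by rewrite /c; lra.
pose g := clamp (al + c) (be - c).
have [j redj] := exists_reduced_letter.
have [k0 /andP[k00 k01] hk] := word_map_contraction hT.
have [n _ hn] := exists_small_pow 1 (introT andP (conj k00 k01)) c0.
have claim k a e' : (k + size a)%N = n -> 0 < e' -> exists t0, forall t, t0 <= t ->
    (g (word_map a 1) - g (word_map a 0) - e') *
      subtree_sum (hard_count len reduced (expR t)) [::] <=
    subtree_sum (count_in `]al, be[ t) a.
  elim: k a e' => [|k IH] a e' sz e'0.
    have [dec|inc] := leP (g (word_map a 1)) (g (word_map a 0)).
      exists 0 => t _; apply: le_trans (NG0 t a).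
      by rewrite mulr_le0_ge0//; lra.
    have [t0 ht0] := words_equidistributed hl reduced_cat a redj not_lattice e'0.
    exists t0 => t tt0.
    have [l1 l2] := clamp_lt ab inc.
    have len_c : word_map a 1 - word_map a 0 <= c.
      apply: le_trans (hk a 0 1 (lexx 0) ler01 (lexx 1)) _.
      by move: hn; rewrite mul1r subr0 mulr1 -sz add0n.
    have <- : subtree_sum (hard_count len reduced (expR t)) a =
        subtree_sum (count_in `]al, be[ t) a.
      congr fine; apply: eq_esum => v _; rewrite /count_in.
      suff -> : word_map (a ++ v) 0 \in (`]al, be[%classic : set R) by rewrite mulr1.
      apply: mem_set; rewrite /= in_itv/= word_map_cat.
      have /andP[v0 v1] := word_map0_lt1 v.
      have m1 := word_map_le hT a (lexx 0) v0 (ltW v1).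
      have m2 := word_map_le hT a v0 (ltW v1) (lexx 1).
      by apply/andP; split; lra.
    apply: le_trans (ht0 t tt0); rewrite ler_wpM2r// lerB//.
    have /andP[_] := clamp_lip ab (word_map_le hT a (lexx 0) ler01 (lexx 1)).
    exact.
  have e2 : 0 < e' / 2 by rewrite divr_gt0.
  have [s us hs] := letters_exhaust hT e2.
  pose d := e' / 2 / (size s).+1%:R.
  have d0 : 0 < d by rewrite divr_gt0.
  have [t0 ht0] : exists t0, forall t, t0 <= t -> forall i, i \in s ->
      (g (word_map (rcons a i) 1) - g (word_map (rcons a i) 0) - d) *
        subtree_sum (hard_count len reduced (expR t)) [::] <=
      subtree_sum (count_in `]al, be[ t) (rcons a i).
    apply: eventually_all => i _; apply: IH => //.
    by rewrite size_rcons addnS -addSn.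
  exists t0 => t tt0.
  have := subtree_sum_ge hl (expR_gt0 t) (below_count_in `]al, be[ t) a us.
  apply: le_trans.
  apply: (@le_trans _ _ (\sum_(i <- s) subtree_sum (count_in `]al, be[ t) (rcons a i))); last first.
    by rewrite lerDr; have [/andP[]] := below_count_in `]al, be[ t a.
  apply: (@le_trans _ _ (\sum_(i <- s)
      (g (word_map (rcons a i) 1) - g (word_map (rcons a i) 0) - d) *
        subtree_sum (hard_count len reduced (expR t)) [::])); last first.
    by rewrite big_seq [leRHS]big_seq ler_sum// => i; exact: ht0.
  rewrite -mulr_suml ler_wpM2r// sumrB.
  have := sum_word_map hT us ler01 hs (fun x y => @clamp_word_lip _ _ _ hT _ _ a x y ab).
  have -> : \sum_(i <- s) d = (size s)%:R * d.
    by rewrite big_const_seq count_predT iter_addr_0 mulr_natl.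
  have : (size s)%:R * d <= e' / 2.
    have -> : e' / 2 = (size s).+1%:R * d by rewrite /d [RHS]mulrC divfK// gt_eqF.
    by rewrite ler_wpM2r ?ler_nat// ltW.
  rewrite -/g; lra.
have [t0 ht0] := claim n [::] (e / 2) (addn0 n) (divr_gt0 e0 (ltr0n R 2)).
exists t0 => t /ht0; apply: le_trans; rewrite ler_wpM2r//=.
have -> : g 1 = be - c by rewrite /g /clamp min_l// le_max; apply/orP; right; lra.
have -> : g 0 = al + c.
  by rewrite /g /clamp max_l ?min_r//; lra.
rewrite /c; lra.
Qed.

Lemma count_interval J e : is_interval J -> J `<=` `[0, 1] -> 0 < e ->
  exists t0, forall t, t0 <= t ->
  `|subtree_sum (count_in J t) [::] / subtree_sum (hard_count len reduced (expR t)) [::]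
     - fine ((@lebesgue_measure R) J)| <= e.
Proof.
move=> iJ J01 e0.
have Npos t : 0 <= t -> 1 <= subtree_sum (hard_count len reduced (expR t)) [::].
  move=> t0.
  apply: le_trans (subtree_sum_ge_self hl (expR_gt0 t) (below_hard _ _ _) [::]).
  by rewrite hard_countE /reduced eqxx (cost_nil hl) t0.
have [->|/set0P[x0 Jx0]] := eqVneq J set0.
  exists 0 => t _; rewrite measure0 /= subr0.
  have -> : subtree_sum (count_in set0 t) [::] = 0.
    rewrite /subtree_sum /subtree_esum esum1// => w _.
    by rewrite /count_in in_set0 mulr0.
  by rewrite mul0r normr0 ltW.
have J0 y : J y -> 0 <= y by move=> /J01 /=; rewrite in_itv/= => /andP[].
have J1 y : J y -> y <= 1 by move=> /J01 /=; rewrite in_itv/= => /andP[].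
have hlb : has_lbound J by exists 0 => y; exact: J0.
have hub : has_ubound J by exists 1 => y; exact: J1.
have infJ : has_inf J by split => //; exists x0.
have supJ : has_sup J by split => //; exists x0.
pose al := inf J; pose be := sup J.
have alJ y : J y -> al <= y by move=> Jy; exact: ge_inf.
have Jbe y : J y -> y <= be by move=> Jy; exact: ub_le_sup.
have al0 : 0 <= al by apply: lb_le_inf => //; exists x0.
have be1 : be <= 1 by apply: ge_sup => //; exists x0.
have albe : al <= be by apply: le_trans (alJ _ Jx0) (Jbe _ Jx0).
have inJ : `]al, be[%classic `<=` J.
  move=> y /=; rewrite in_itv/= => /andP[ay yb].
  have [u Ju uy] : exists2 u, J u & u < al + (y - al).
    by apply: inf_adherent => //; rewrite subr_gt0.
  have [v Jv yv] : exists2 v, J v & be - (be - y) < v.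
    by apply: sup_adherent => //; rewrite subr_gt0.
  by apply: (iJ u v Ju Jv); apply/andP; split; lra.
have outJ : J `<=` `[al, be]%classic.
  by move=> y Jy; rewrite /= in_itv/= alJ// Jbe.
have mJ := interval_measurable iJ.
have -> : fine ((@lebesgue_measure R) J) = be - al.
  suff -> : (@lebesgue_measure R) J = (be - al)%:E by [].
  apply/eqP; rewrite eq_le; apply/andP; split.
    apply: (@le_trans _ _ ((@lebesgue_measure R) `[al, be]%classic)).
      by apply: le_measure => //; rewrite ?inE.
    rewrite lebesgue_measure_itv/= lte_fin.
    by case: ifPn => // _; rewrite lee_fin subr_ge0.
  apply: (@le_trans _ _ ((@lebesgue_measure R) `]al, be[%classic)).
    rewrite lebesgue_measure_itv/= lte_fin.
    by case: ifPn => //; rewrite -leNgt => h; rewrite lee_fin subr_le0.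
  by apply: le_measure => //; rewrite ?inE.
have e2 : 0 < e / 2 by rewrite divr_gt0.
have [t1 h1] := count_open_interval al0 albe be1 e2.
have [t2 h2] := count_open_interval (lexx 0) al0 (le_trans albe be1) e2.
have [t3 h3] := count_open_interval (le_trans al0 albe) be1 (lexx 1) e2.
exists (Num.max (Num.max t1 t2) (Num.max t3 0)) => t.
rewrite !ge_max => /andP[/andP[tt1 tt2] /andP[tt3 tt0]].
have {}h1 := h1 t tt1; have {}h2 := h2 t tt2; have {}h3 := h3 t tt3.
have N1 := Npos t tt0.
have low : subtree_sum (count_in `]al, be[ t) [::] <= subtree_sum (count_in J t) [::].
  apply: (le_subtree_sum hl (expR_gt0 t) (expR_gt0 t)) => [||v];
    try exact: below_count_in.
  rewrite /count_in ler_wpM2l// ler_nat.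
  case: (boolP (_ \in _)) => // /set_mem /inJ Jx.
  by rewrite mem_set.
have up : subtree_sum (count_in J t) [::] + subtree_sum (count_in `]0, al[ t) [::]
    + subtree_sum (count_in `]be, 1[ t) [::]
    <= subtree_sum (hard_count len reduced (expR t)) [::].
  apply: le_count_in => x.
  have [/set_mem Jx|nJx] := boolP (x \in J).
    rewrite [x \in _]memNset ?[x \in _]memNset /= ?addr0//.
      by rewrite /= in_itv/= ltNge Jbe.
    by rewrite /= in_itv/= [x < al]ltNge alJ// andbF.
  have [/set_mem/=|nx] := boolP (x \in `]0, al[%classic).
    rewrite in_itv/= => /andP[_ xal]; rewrite [x \in _]memNset /= ?addr0 ?add0r//.
    by rewrite in_itv/= ltNge (le_trans (ltW xal)).
  by rewrite add0r add0r lern1 leq_b1.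
set N := subtree_sum (hard_count _ _ _) _ in h1 h2 h3 N1 up *.
set NJ := subtree_sum (count_in J t) _ in low up *.
have Ngt : 0 < N by lra.
have lo : be - al - e <= NJ / N by rewrite ler_pdivlMr//; nra.
have hi : NJ / N <= be - al + e by rewrite ler_pdivrMr//; nra.
by rewrite ler_norml; apply/andP; split; lra.
Qed.

End Endpoints.

Theorem theorem1p3 (R : realType) (I : pointedType) (T : I -> R -> R)
    (hI : countable [set: I])
    (hT : generates_partition T)
    (hnonlattice : ~ lattice_potential (geometric_potential T))
    (hregular : regular_potential (geometric_potential T))
    (J : set R) (hJ : is_interval J) (hJ01 : J `<=` `[0, 1]) :
  endpoint_measure T n J @[n --> \oo] --> (@lebesgue_measure R) J.
Proof.
have [_ [rho [rho01 hholder]] _ [mu [_ near1]]] := hregular.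
have /andP[rho0 rho1] := rho01.
have [Cg Cg0 hCg] := holder_class_bound rho0 hholder.
have [kappa k01 hsum] : exists2 kappa, 0 < kappa < 1 &
    summable_potential (fun x => - ((1 - kappa) * geometric_potential T x)).
  move: near1 => /nbhs_ballP[d /= d0 hd].
  (* Summability at the exponent t = 1 - kappa, slightly smaller than 1. *)
  pose kappa := Num.min (d / 2) (1 / 2).
  have k0 : 0 < kappa by rewrite lt_min !divr_gt0.
  have k1 : kappa <= 1 / 2 by rewrite ge_min lexx orbT.
  have kd : kappa <= d / 2 by rewrite ge_min lexx.
  exists kappa; first by rewrite k0/=; lra.
  have [] // := hd (1 - kappa) _.
  rewrite /ball/= opprB addrCA subrr addr0 gtr0_norm//; lra.
have [S hS] : exists S, forall s : seq I, uniq s ->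
    \sum_(i <- s) expR (- ((1 - kappa) * geometric_potential T (scons i (pad [::])))) <= S.
  pose psi (x : shift_space I) : R := - ((1 - kappa) * geometric_potential T x).
  exists (fine (\esum_(i in [set: I]) expeR (sup_on_cylinder psi [:: i]))) => s us.
  have pos i : (0 <= expeR (sup_on_cylinder psi [:: i]))%E by exact: expeR_ge0.
  rewrite -lee_fin fineK; last by rewrite ge0_fin_numE ?esum_ge0.
  apply: le_trans (sum_le_esum pos us); rewrite -sumEFin.
  apply: lee_sum => i _; rewrite -[X in (X <= _)%E]/(expeR (_%:E)) lee_expeR.
  by apply: ereal_sup_ubound; exists (scons i (pad [::])).
have [cM hl] := geometric_length_system hT rho01 Cg0 hCg k01 (ex_intro _ S hS).
have nl : ~ lattice_periods (word_length T) rho.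
  move=> h; apply: hnonlattice.
  exact: (lattice_of_periods hl hholder (potential_cost hT hCg) h).
have [tt [ttE tt_oo]] := split_left_endpointsE hT hl.
have mJ : (@lebesgue_measure R) J = (fine ((@lebesgue_measure R) J))%:E.
  rewrite fineK// ge0_fin_numE//.
  apply: (@le_lt_trans _ _ ((@lebesgue_measure R) `[0, 1]%classic)).
    by apply: le_measure => //; rewrite inE//; exact: interval_measurable.
  by rewrite lebesgue_measure_itv/= lte_fin ltr01 ltry.
have E n : endpoint_measure T n J =
   (subtree_sum (count_in T J (tt n)) [::] /
    subtree_sum (hard_count (word_length T) (reduced T) (expR (tt n))) [::])%:E.
  rewrite /endpoint_measure ttE -/(endpoints_below T (tt n)) (sum_dirac hT hl).
  by rewrite (card_endpoints hT hl) -EFinM mulrC.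
rewrite mJ; apply: cvg_EFin.
  by apply: nearW => n; rewrite E.
apply/cvgrPdist_le => e e0.
have [t0 ht0] := count_interval hT hl nl hJ hJ01 e0.
have [n0 hn0] := tt_oo t0.
exists n0 => // n /= n0n; rewrite E /= distrC.
exact: ht0 _ (hn0 _ n0n).
Qed.
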